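(* Let $t,k$ be integers with $3 \le t < k$, and let $m \ge 0$ be an integer. Write $m = q\binom{k-1}{2} + b$ with integers $q \ge 0$ and $0 \le b < \binom{k-1}{2}$. If $G$ is a graph with $m$ edges containing no cycle of length at least $k$, then $$k_t(G) \le k_t(qK_{k-1} \cup L_b).$$ Moreover, such a $G$ attains equality if and only if $G$ is isomorphic (after deleting isolated vertices) to some graph in $\mathcal{G}_{forest}(qK_{k-1}, L)$ for some $L \in \mathcal{C}_{t,k}(b)$.
   Context: $k_t(G)$ denotes the number of copies of $K_t$ in $G$; $qK_{k-1}\cup L_b$ is the vertex-disjoint union of $q$ copies of $K_{k-1}$ and $L_b$. Graphs are considered equivalent if they are isomorphic after deleting all isolated vertices. Colex order on finite subsets of $\mathbb{N}$: $A \prec B$ iff $\max((A\setminus B)\cup(B\setminus A)) \in B$. The colex graph $L_m$ has vertex set $\mathbb{N}$ and as edges the first $m$ two-element subsets in colex order; if $m = \binom{r}{2}+s$ with $0 \le s < r$, then (up to isolated vertices) $L_m$ is a clique $K_r$ together with one further vertex adjacent to exactly $s$ vertices of the clique. The family $\mathcal{C}_{t,k}(m)$: for $m=0$ it consists of the empty graph; for $0 < m \le \binom{k-1}{2}$, write $m = \binom{r}{2}+s$ with $0 \le s < r$; then (i) if $s \ge t-1$, $\mathcal{C}_{t,k}(m) = \{L_m\}$; (ii) if $r \ge t$ and $s < t-1$, $\mathcal{C}_{t,k}(m)$ consists of $L_m$ together with all $m$-edge graphs with no cycle of length at least $k$ that contain $K_r$ as a subgraph; (iii) if $r < t$, $\mathcal{C}_{t,k}(m)$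 consists of $L_m$ together with all $m$-edge graphs with no cycle of length at least $k$. For connected graphs $F_1,\dots,F_l$, $\mathcal{G}_{forest}(F_1,\dots,F_l)$ is the family of graphs $G$ such that: (1) $E(G)$ can be partitioned into sets $E_1,\dots,E_l$ with the graph $G(E_i)$ formed by the edges of $E_i$ isomorphic to $F_i$, and $|V(G(E_i))\cap V(G(E_j))| \le 1$ for $i\ne j$; (2) the auxiliary graph on $\{1,\dots,l\}$ with $ij$ an edge iff $G(E_i)$ and $G(E_j)$ share a vertex is a forest. ''$qK_{k-1}$'' in the argument list means $q$ blocks each equal to $K_{k-1}$. For possibly disconnected arguments, $\mathcal{G}_{forest}(F_1,\dots,F_l)$ is defined as $\mathcal{G}_{forest}$ of the list of all connected components of all the $F_i$.
   Formalization: In condition (2) of G_forest the auxiliary graph need not be a forest: cycles of parts that all contain one common vertex are allowed. With the literal condition the ''only if'' fails, e.g. for three triangles sharing a vertex (t=3, k=4, q=3, b=0). *)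

(* Defs.v *)
From mathcomp Require Import all_boot.

Set Implicit Arguments.
Unset Strict Implicit.
Unset Printing Implicit Defensive.

Record sgraph := SGraph {
  svertex :> finType;
  sedge : rel svertex;
  sedge_sym : symmetric sedge;
  sedge_irr : irreflexive sedge }.

Definition edges (G : sgraph) : {set {set G}} :=
  [set [set p.1; p.2] | p : G * G & sedge p.1 p.2].

Definition nedges (G : sgraph) : nat := #|edges G|.

(* The t-cliques of G, i.e. the vertex sets of the copies of K_t in G. *)
Definition cliques (t : nat) (G : sgraph) : {set {set G}} :=
  [set A : {set G} | (#|A| == t) &&
     [forall x in A, forall y in A, (x != y) ==> sedge x y]].

Definition ncliques (t : nat) (G : sgraph) : nat := #|cliques t G|.

(* ucycle only asks for distinct, cyclically adjacent vertices, so it also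
   holds of the empty sequence and of the two ends of an edge: the length
   bound excludes these. *)
Definition is_cycle (G : sgraph) (c : seq G) : Prop :=
  3 <= size c /\ ucycle (@sedge G) c.

Definition no_cycle_geq (k : nat) (G : sgraph) : Prop :=
  forall c : seq G, is_cycle c -> size c < k.

Lemma induced_sym (G : sgraph) (A : {set G}) :
  symmetric (fun x y : {x | x \in A} => sedge (val x) (val y)).
Proof. by move=> x y; rewrite sedge_sym. Qed.

Lemma induced_irr (G : sgraph) (A : {set G}) :
  irreflexive (fun x y : {x | x \in A} => sedge (val x) (val y)).
Proof. by move=> x; rewrite sedge_irr. Qed.

Definition induced (G : sgraph) (A : {set G}) : sgraph :=
  SGraph (@induced_sym G A) (@induced_irr G A).

Definition nonisolated (G : sgraph) : {set G} :=
  [set x : G | [exists y : G, sedge x y]].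

(* Isomorphism after deleting all isolated vertices. *)
Definition sg_equiv (G H : sgraph) : Prop :=
  exists f : induced (nonisolated G) -> induced (nonisolated H),
    bijective f /\ forall x y, sedge (f x) (f y) = sedge x y.

Lemma complete_sym n : symmetric (fun x y : 'I_n => x != y).
Proof. by move=> x y; rewrite eq_sym. Qed.

Lemma complete_irr n : irreflexive (fun x y : 'I_n => x != y).
Proof. by move=> x; rewrite eqxx. Qed.

Definition complete (n : nat) : sgraph :=
  SGraph (@complete_sym n) (@complete_irr n).

Section Union.
Variables G H : sgraph.

Definition union_edge (x y : G + H) : bool :=
  match x, y with
  | inl a, inl b => sedge a b
  | inr a, inr b => sedge a b
  | _, _ => false
  end.

Lemma union_sym : symmetric union_edge.
Proof. by case=> a [] b //=; rewrite sedge_sym. Qed.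

Lemma union_irr : irreflexive union_edge.
Proof. by case=> a /=; rewrite sedge_irr. Qed.

Definition sg_union : sgraph := SGraph union_sym union_irr.
End Union.

Section Copies.
Variables (q : nat) (G : sgraph).

Definition copies_edge (x y : 'I_q * G) : bool :=
  (x.1 == y.1) && sedge x.2 y.2.

Lemma copies_sym : symmetric copies_edge.
Proof. by move=> x y; rewrite /copies_edge eq_sym sedge_sym. Qed.

Lemma copies_irr : irreflexive copies_edge.
Proof. by move=> x; rewrite /copies_edge sedge_irr andbF. Qed.

Definition sg_copies : sgraph := SGraph copies_sym copies_irr.
End Copies.

(* A precedes B iff the maximum of the symmetric difference lies in B. *)
Definition colex (n : nat) (A B : {set 'I_n}) : bool :=
  [exists x in B :\: A, [forall y in (A :\: B) :|: (B :\: A), y <= x]].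

Section ColexGraph.
Variable m : nat.

(* {x, y} is an edge iff fewer than m pairs precede it.  Restricting the
   vertices from nat to {0, ..., m} only deletes isolated vertices: every
   predecessor of a pair has at most the same maximum, and the pairs inside
   {0, ..., m} number 'C(m.+1, 2) >= m. *)
Definition colex_edge (x y : 'I_m.+1) : bool :=
  (x != y) &&
  (#|[set B : {set 'I_m.+1} | (#|B| == 2) && colex B [set x; y]]| < m).

Lemma colex_sym : symmetric colex_edge.
Proof. by move=> x y; rewrite /colex_edge eq_sym setUC. Qed.

Lemma colex_irr : irreflexive colex_edge.
Proof. by move=> x; rewrite /colex_edge eqxx. Qed.

Definition colex_graph : sgraph := SGraph colex_sym colex_irr.
End ColexGraph.

(* L belongs to C_{t,k}(m), up to isolated vertices.  The pair (r, s) below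
   is unique, since 'C(r, 2) <= m < 'C(r.+1, 2). *)
Definition Cfamily (t k m : nat) (L : sgraph) : Prop :=
  (m = 0 /\ sg_equiv L (complete 0)) \/
  (0 < m <= 'C(k.-1, 2) /\
   exists r s : nat, [/\ m = 'C(r, 2) + s, s < r &
     [\/ t.-1 <= s /\ sg_equiv L (colex_graph m),
         [/\ t <= r, s < t.-1 &
            sg_equiv L (colex_graph m) \/
            [/\ nedges L = m, no_cycle_geq k L & cliques r L != set0]]
       | r < t /\
            (sg_equiv L (colex_graph m) \/
             nedges L = m /\ no_cycle_geq k L)]]).

Section EdgeGraph.
Variables (G : sgraph) (E : {set {set G}}).

Definition edge_graph_rel (x y : G) : bool :=
  (x != y) && ([set x; y] \in E).

Lemma edge_graph_sym : symmetric edge_graph_rel.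
Proof. by move=> x y; rewrite /edge_graph_rel eq_sym setUC. Qed.

Lemma edge_graph_irr : irreflexive edge_graph_rel.
Proof. by move=> x; rewrite /edge_graph_rel eqxx. Qed.

(* The graph formed by the edges in E, on all the vertices of G; those not
   covered by E are isolated. *)
Definition edge_graph : sgraph := SGraph edge_graph_sym edge_graph_irr.

(* V(G(E)) *)
Definition everts : {set G} := nonisolated edge_graph.
End EdgeGraph.

Section Auxiliary.
Variables (l : nat) (G : sgraph) (E : 'I_l -> {set {set G}}).

Definition aux_edge (i j : 'I_l) : bool :=
  (i != j) && (everts (E i) :&: everts (E j) != set0).

Lemma aux_sym : symmetric aux_edge.
Proof. by move=> i j; rewrite /aux_edge eq_sym setIC. Qed.

Lemma aux_irr : irreflexive aux_edge.
Proof. by move=> i; rewrite /aux_edge eqxx. Qed.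

Definition aux_graph : sgraph := SGraph aux_sym aux_irr.

(* The parts are glued together along a forest.  Parts that all contain one
   common vertex are pairwise adjacent in aux_graph, so three of them already
   form a cycle there, although gluing them at that vertex is tree-like; for
   instance q copies of K_{k-1} glued at one vertex must be allowed for any q.
   Hence only the cycles of aux_graph whose parts have no common vertex are
   forbidden.  If no vertex lies in three parts, this says precisely that
   aux_graph is a forest. *)
Definition glued_forest : Prop :=
  forall c : seq aux_graph, is_cycle c ->
    exists v : G, forall i, i \in c -> v \in everts (E i).
End Auxiliary.

Definition Gforest_conn (Fs : seq sgraph) (G : sgraph) : Prop :=
  exists E : 'I_(size Fs) -> {set {set G}},
    [/\ \bigcup_i E i = edges G,
        forall i j, i != j -> [disjoint E i & E j],
        forall i, sg_equiv (edge_graph (E i)) (nth (complete 0) Fs i),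
        forall i j, i != j -> #|everts (E i) :&: everts (E j)| <= 1
      & glued_forest E].

Definition components (G : sgraph) : seq sgraph :=
  [seq induced A |
     A <- enum (equivalence_partition (connect (@sedge G)) [set: G])].

Definition Gforest (Fs : seq sgraph) (G : sgraph) : Prop :=
  Gforest_conn (flatten [seq components F | F <- Fs]) G.

(* Main.v *)
Require Import Defs.
From mathcomp Require Import all_boot zify.

Set Implicit Arguments.
Unset Strict Implicit.
Unset Printing Implicit Defensive.

(* Put K = k - 1, t = w + 2 and D = 'C(K, 2).  Without cycles of length greater
   than K, two vertices of a K-clique A are joined by no path using an edge
   outside A.  Hence the K-cliques are edge-disjoint and contribute 'C(K, t)
   copies of K_t each, and it remains to treat the graph left after removing
   their edges.  With fewer than D edges, Kruskal-Katona with its equality cases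
   applies: delete a vertex of minimum degree.

   A K_K-free graph with m >= D edges is strictly below the bound, by induction
   on m.  A graph with a cut vertex splits.  In a 2-connected graph write
   m = q D + 'C(r, 2) + s; a vertex of degree less than r can be deleted, so let
   all the degrees be at least r.  The degrees of the two ends of a longest path
   sum to at most K, so rotating the path about one fixed end gives r vertices of
   degree at most K / 2.  Deleting these destroys fewer copies of K_t than the
   extremal count loses.

   In the equality case the parts of the gluing are the K-cliques and the
   components of the remaining graph.  Conversely, in a forest-like gluing all
   the edges of a clique lie in one part, so the counts of the parts add up. *)

(** * Binomial estimates *)

Lemma bin2S n : 'C(n.+1, 2) = 'C(n, 2) + n.
Proof. by rewrite binS bin1. Qed.

Lemma bin_ltn2l n a b : 0 < n <= b -> a < b -> 'C(a, n) < 'C(b, n).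
Proof.
case: n => // n; case: b => // b /andP[_ nb] ab; rewrite binS.
have h1 : 'C(a, n.+1) <= 'C(b, n.+1) by apply: leq_bin2l; lia.
have : 0 < 'C(b, n) by rewrite bin_gt0.
lia.
Qed.

(* The flag strict turns a weak inequality into its strict form, so that both are
   proved at once; strict counts as 1 in the sum. *)
Lemma bin_convex (strict : bool) n a b c :
  a <= b -> (strict -> [/\ a < b, 0 < c & 1 < n <= b + c]) ->
  'C(a + c, n) + 'C(b, n) + strict <= 'C(a, n) + 'C(b + c, n).
Proof.
case: n => [|n] ab; first by case: strict => [/(_ isT)[]|]; rewrite ?bin0.
elim: c strict => [|c IH] strict hs.
  by case: strict hs => [/(_ isT)[]//|_]; rewrite !addn0 addnC.
have {IH}/= := IH false ltac:(by []).
rewrite addn0 !addnS !binS.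
have h : 'C(a + c, n) <= 'C(b + c, n) by apply: leq_bin2l; lia.
case: strict hs => [/(_ isT)[h1 _ /andP[h2 h3]]|_]; last by move: h; clear; lia.
have : 'C(a + c, n) < 'C(b + c, n) by apply: bin_ltn2l; lia.
by clear -h; lia.
Qed.

Lemma bin_spread (strict : bool) n a b c d : a + b = c + d -> a <= c -> b <= c ->
  (strict -> [/\ a < c, b < c & 1 < n <= c]) ->
  'C(a, n) + 'C(b, n) + strict <= 'C(c, n) + 'C(d, n).
Proof.
move=> e ac bc hs; have db : d <= b by lia.
have := @bin_convex strict n d b (c - b) db.
have -> : d + (c - b) = a by lia.
have -> : b + (c - b) = c by lia.
rewrite ['C(d, n) + _]addnC; apply=> /hs[h1 h2 h3]; split=> //; lia.
Qed.

Lemma bin_mul2 n T : T.+1 * 'C(n, T) <= 'C(n.*2, T).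
Proof.
have h : 2 ^ T * 'C(n, T) <= 'C(n.*2, T).
  elim: T => [|T IH]; first by rewrite !bin0.
  rewrite -(leq_pmul2l (ltn0Sn T)) expnS.
  have e1 := mul_bin_left n T; have e2 := mul_bin_left n.*2 T.
  rewrite e2 mulnCA e1.
  have h : 2 * (2 ^ T * ((n - T) * 'C(n, T))) = (n - T).*2 * (2 ^ T * 'C(n, T)).
    by rewrite -mul2n; lia.
  have -> : 2 * 2 ^ T * ((n - T) * 'C(n, T)) = (n - T).*2 * (2 ^ T * 'C(n, T)).
    by rewrite -mulnA h.
  by apply: leq_mul => //; lia.
apply: leq_trans h; rewrite leq_mul2r.
by apply/orP; right; elim: T => // T IH; rewrite expnS; lia.
Qed.

Definition colex_rank (m : nat) : nat :=
  find (fun r => m < 'C(r.+1, 2)) (iota 0 m.+2).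

Lemma colex_rankP m : 'C(colex_rank m, 2) <= m < 'C((colex_rank m).+1, 2).
Proof.
have h : has (fun r => m < 'C(r.+1, 2)) (iota 0 m.+2).
  apply/hasP; exists m.+1; first by rewrite mem_iota; lia.
  by rewrite !bin2S; lia.
have := nth_find 0 h; rewrite -/(colex_rank m) => h1.
have hs : colex_rank m < m.+2 by move: h; rewrite has_find size_iota.
move: h1; rewrite nth_iota // add0n => ->; rewrite andbT.
case E: (colex_rank m) => [|r]; first by rewrite bin0n.
have hr : r < find (fun r => m < 'C(r.+1, 2)) (iota 0 m.+2).
  by rewrite -/(colex_rank m) E.
by have := before_find 0 hr; rewrite nth_iota ?add0n; lia.
Qed.

Lemma colex_rank_eq r s : s < r -> colex_rank ('C(r, 2) + s) = r.
Proof.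
move=> sr; have /andP[h1 h2] := colex_rankP ('C(r, 2) + s).
set R := colex_rank _ in h1 h2 *.
have [hlt|hlt|//] := ltngtP R r.
- have : 'C(R.+1, 2) <= 'C(r, 2) by apply: leq_bin2l.
  lia.
- have : 'C(r.+1, 2) <= 'C(R, 2) by apply: leq_bin2l.
  rewrite bin2S; lia.
Qed.

Lemma colexW m : exists r s, [/\ m = 'C(r, 2) + s, s < r & 0 < r].
Proof.
have /andP[h1 h2] := colex_rankP m.
exists (colex_rank m), (m - 'C(colex_rank m, 2)).
by move: h2; rewrite bin2S; split; lia.
Qed.

Lemma colex_rank_le r s d : s < r -> 'C(d.+1, 2) <= 'C(r, 2) + s -> d < r.
Proof.
move=> sr h; rewrite ltnNge; apply/negP => hrd.
have : 'C(r.+1, 2) <= 'C(d.+1, 2) by apply: leq_bin2l.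
rewrite bin2S; lia.
Qed.

Section ColexCount.
Variable w : nat.
Hypothesis w_gt0 : 0 < w.

(* The number of copies of K_{w+2} in the colex graph with m edges. *)
Definition colex_count (m : nat) : nat :=
  'C(colex_rank m, w.+2) + 'C(m - 'C(colex_rank m, 2), w.+1).

Local Notation F := colex_count.

Lemma colex_countE r s : s <= r -> F ('C(r, 2) + s) = 'C(r, w.+2) + 'C(s, w.+1).
Proof.
rewrite leq_eqVlt => /orP[/eqP->|sr].
  rewrite -bin2S -[X in F X]addn0 /colex_count colex_rank_eq //.
  by rewrite addn0 subnn bin0n addn0 binS.
by rewrite /colex_count colex_rank_eq // addKn.
Qed.

Lemma colex_count_clique r : F 'C(r, 2) = 'C(r, w.+2).
Proof. by rewrite -[X in F X]addn0 colex_countE // bin0n addn0. Qed.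

Lemma colex_count_add M d : 'C(d, 2) <= M -> F M + 'C(d, w.+1) <= F (M + d).
Proof.
move=> hM; have [r [s [e sr r0]]] := colexW (M + d).
have dr : d < r by apply: (colex_rank_le sr); rewrite bin2S; lia.
rewrite e colex_countE ?(ltnW sr) //.
have [ds|sd] := leqP d s.
  have -> : M = 'C(r, 2) + (s - d) by lia.
  rewrite colex_countE; last by lia.
  have := @bin_spread false w.+1 (s - d) d s 0; rewrite bin0n addn0; lia.
case: r => // r in e sr r0 dr *.
have -> : M = 'C(r, 2) + (r + s - d) by move: e; rewrite bin2S; lia.
rewrite colex_countE; last by lia.
rewrite binS; have := @bin_spread false w.+1 (r + s - d) d r s; lia.
Qed.

Lemma colex_count_super x y : F x + F y <= F (x + y).
Proof.
wlog yx : x y / y <= x => [W|].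
  by have [/W//|/ltnW/W] := leqP y x; rewrite addnC [y + x]addnC.
have [r [s [ey sr r0]]] := colexW y.
have hr j z : 'C(j, 2) <= z -> F z + 'C(j, w.+2) <= F (z + 'C(j, 2)).
  elim: j => [|j IH] hz; first by rewrite !bin0n !addn0.
  have := IH; have := @colex_count_add (z + 'C(j, 2)) j.
  by move: hz; rewrite !binS bin1 !addnA; lia.
have hs := leq_bin2l 2 (ltnW sr).
have := hr r (x + s); have := @colex_count_add x s.
have -> : x + y = x + s + 'C(r, 2) by lia.
have -> : F y = 'C(r, w.+2) + 'C(s, w.+1) by rewrite ey colex_countE // ltnW.
lia.
Qed.

End ColexCount.

Section ColexFill.
Variable w : nat.
Hypothesis w_gt0 : 0 < w.
Local Notation F := (colex_count w).

(* Moving edges from one partial clique to another until the latter is full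
   loses no K_{w+2}. *)
Lemma colex_count_fill (strict : bool) K x y :
  x <= 'C(K, 2) -> y <= 'C(K, 2) -> 'C(K, 2) <= x + y ->
  (strict -> [/\ x < 'C(K, 2), y < 'C(K, 2) & w.+1 < K]) ->
  F x + F y + strict <= F 'C(K, 2) + F (x + y - 'C(K, 2)).
Proof.
elim: K x y strict => [|K IH] x y strict.
  by rewrite bin0n => /[!leqn0] /eqP-> /eqP-> _; case: strict => [/(_ isT)[]|].
have {}IH a b h1 h2 h3 := IH a b false h1 h2 h3 ltac:(by []).
set D := 'C(K.+1, 2); set D' := 'C(K, 2) in IH.
have eD : D = D' + K by rewrite /D bin2S.
wlog yx : x y / y <= x => [W|].
  have [/W//|/ltnW/W{}W h1 h2 h3 h4] := leqP y x.
  by rewrite [F x + _]addnC [x + y]addnC; apply: W; rewrite 1?addnC // => /h4[].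
move=> xD yD xy hs.
have FD : F D = F D' + 'C(K, w.+1) by rewrite !colex_count_clique // binS.
have FD' : F D' = 'C(K, w.+2) by rewrite colex_count_clique.
have [yD'|D'y] := leqP y D'; last first.
  pose s1 := x - D'; pose s2 := y - D'.
  have ex : x = D' + s1 by rewrite /s1; lia.
  have ey : y = D' + s2 by rewrite /s2; lia.
  have Fx : F x = 'C(K, w.+2) + 'C(s1, w.+1) by rewrite ex colex_countE //; lia.
  have Fy : F y = 'C(K, w.+2) + 'C(s2, w.+1) by rewrite ey colex_countE //; lia.
  have [hle|hlt] := leqP K (s1 + s2).
    have -> : x + y - D = D' + (s1 + s2 - K) by lia.
    rewrite FD FD' Fx Fy colex_countE //; last by lia.
    have := @bin_spread strict w.+1 s1 s2 K (s1 + s2 - K).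
    have h : strict -> [/\ s1 < K, s2 < K & 1 < w.+1 <= K].
      by move=> /hs[h1 h2 h3]; split; lia.
    move=> /(_ _ _ _ h); clear -xD yD eD ex ey hle; lia.
  have [L eK] : exists L, K = L.+1 by exists K.-1; lia.
  have eD' : D' = 'C(L, 2) + L by rewrite /D' eK bin2S.
  have e1 : x + y - D = 'C(L, 2) + (s1 + s2).-1 by lia.
  have Fe : F (x + y - D) = 'C(L, w.+2) + 'C((s1 + s2).-1, w.+1).
    by rewrite e1 colex_countE //; lia.
  have hL : strict <= 'C(L, w).
    by case: strict hs => // /(_ isT)[_ _ h]; rewrite bin_gt0; lia.
  have h1 := @bin_spread false w.+1 s1 s2 (s1 + s2).-1 1.
  rewrite ['C(1, _)]bin_small // addn0 addn0 in h1.
  rewrite FD FD' Fx Fy Fe eK !binS.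
  move: h1 hL; clear -hlt D'y ex ey yx; lia.
have [D'x|xD'] := ltnP D' x.
  pose s := x - D'; pose a := K - s.
  have ex : x = D' + s by rewrite /s; lia.
  have -> : x + y - D = y - a by rewrite /a; lia.
  have h1 := IH y (D' - a).
  have e1 : y + (D' - a) - D' = y - a by lia.
  have [L eK] : exists L, K = L.+1 by exists K.-1; lia.
  have h2 : F D' + 'C(L - a, w.+1) = F (D' - a) + 'C(L, w.+1).
    have -> : D' - a = 'C(L, 2) + (L - a) by rewrite /D' eK bin2S; lia.
    by rewrite FD' eK colex_countE ?binS; lia.
  have h3 := @bin_spread strict w.+1 L (K - a) K (L - a).
  have Fx : F x = F D' + 'C(s, w.+1) by rewrite ex colex_countE ?FD' //; lia.
  have e3 : K - a = s by lia.
  have h : strict -> [/\ L < K, s < K & 1 < w.+1 <= K].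
    by move=> /hs[? ? ?]; split; lia.
  rewrite e1 in h1; rewrite e3 in h3; rewrite FD Fx.
  have {}h1 := h1 ltac:(lia) ltac:(lia) ltac:(lia).
  have {}h3 := h3 ltac:(lia) ltac:(lia) ltac:(lia) h.
  by move: h1 h2 h3; clear; lia.
pose z := x + y - D'.
have zK : x + y - D = z - K by lia.
have h1 := IH x y xD' yD' ltac:(lia).
have h2 := IH z (D' - K) ltac:(lia) ltac:(lia) ltac:(lia).
have e2 : z + (D' - K) - D' = z - K by lia.
rewrite e2 in h2; rewrite zK FD.
suff h3 : F D' + strict <= F (D' - K) + 'C(K, w.+1).
  by move: h1 h2 h3; rewrite -/z; clear; lia.
have [K3|[L eK]] : K < 3 \/ exists L, K = L.+3.
  by have [h|h] := ltnP K 3; [left|right; exists (K - 3); lia].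
  have K0 : K = 0.
    have : D' <= 'C(2, 2) by apply: leq_bin2l; lia.
    rewrite binn => hD'; apply/eqP; rewrite -leqn0 leqNgt; apply/negP => K0.
    have K1 : K = 1 by lia.
    by move: xD' yD' xy; rewrite eD /D' K1 bin_small //; lia.
  case: strict hs => [/(_ isT)[_ _]|_]; first by rewrite K0.
  by rewrite K0 subn0; clear; lia.
have -> : D' - K = 'C(L.+1, 2) + L by rewrite /D' eK !bin2S; lia.
rewrite colex_countE // FD' eK.
have c1 : 'C(L, w) <= 'C(L.+1, w) by apply: leq_bin2l.
have c2 : 'C(L.+1, w) + strict <= 'C(L.+2, w).
  case: strict hs => [/(_ isT)[_ _ h]|_]; rewrite ?addn0 ?addn1 ?leq_bin2l //.
  by rewrite bin_ltn2l; lia.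
by rewrite !binS; move: c1 c2; clear; lia.
Qed.
End ColexFill.

Lemma multiset_remove (cost n : nat -> nat) M l c :
  (forall x, x < l -> cost x <= M) -> c <= \sum_(x < l) n x ->
  exists n' : nat -> nat, [/\ forall x, n' x <= n x,
    \sum_(x < l) n x = \sum_(x < l) n' x + c &
    \sum_(x < l) n x * cost x <= \sum_(x < l) n' x * cost x + c * M].
Proof.
elim: l c => [|l IH] c hM hc.
  by exists n; move: hc; rewrite !big_ord0 leqn0 => /eqP->.
rewrite big_ord_recr /= in hc.
have [hle|hlt] := leqP c (n l).
  exists (fun x => if x == l then n l - c else n x).
  rewrite !big_ord_recr /= eqxx; split.
  - by move=> x; case: eqP => [->|//]; rewrite leq_subr.
  - by rewrite -addnA subnK //; congr (_ + _); apply: eq_bigr => i _; rewrite ltn_eqF.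
  rewrite -addnA leq_add //.
    by apply: leq_sum => i _; rewrite ltn_eqF.
  by rewrite -[X in X * _ <= _](subnK hle) mulnDl leq_add2l leq_mul2l hM ?orbT.
have [||n' [h1 h2 h3]] := IH (c - n l); first by move=> x xl; apply: hM; lia.
  by rewrite leq_subLR addnC.
exists (fun x => if x == l then 0 else n' x).
rewrite !big_ord_recr /= eqxx h2; split.
- by move=> x; case: eqP.
- rewrite addn0 -addnA subnK 1?ltnW //; congr (_ + _).
  by apply: eq_bigr => i _; rewrite ltn_eqF.
have -> : \sum_(i < l) (if i == l :> nat then 0 else n' i) * cost i = \sum_(i < l) n' i * cost i.
  by apply: eq_bigr => i _; rewrite ltn_eqF.
have h : n l * cost l <= n l * M by rewrite leq_mul2l hM ?orbT.
have e : c * M = (c - n l) * M + n l * M by rewrite -mulnDl subnK // ltnW.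
by rewrite mul0n addn0 e addnA leq_add.
Qed.

Section ColexPool.
Variable w : nat.
Hypothesis w_gt0 : 0 < w.
Local Notation F := (colex_count w).

Lemma bin_drop (strict : bool) c K eps :
  w.+1 * c <= 'C(K.-1, w) -> eps <= K -> (strict -> 0 < eps < K /\ w < K) ->
  eps * c + 'C(K - eps, w.+1) + strict <= 'C(K, w.+1).
Proof.
move=> hc he hs.
have e1 : w.+1 * (eps * c + 'C(K - eps, w.+1)) =
    eps * (w.+1 * c) + (K - eps) * 'C((K - eps).-1, w).
  by rewrite mulnDr mulnCA -mul_bin_diag.
have e2 : eps * 'C(K.-1, w) + (K - eps) * 'C(K.-1, w) = w.+1 * 'C(K, w.+1).
  by rewrite -mulnDl subnKC // mul_bin_diag.
have h3 : eps * (w.+1 * c) <= eps * 'C(K.-1, w) by rewrite leq_mul2l hc orbT.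
have h4 : 'C((K - eps).-1, w) <= 'C(K.-1, w) by apply: leq_bin2l; lia.
case: strict hs => [/(_ isT)[/andP[e0 eK] wK]|_].
  rewrite addn1 -(ltn_pmul2l (ltn0Sn w)) e1 -e2 -addnS leq_add //.
  by rewrite ltn_pmul2l ?subn_gt0 // bin_ltn2l; lia.
by rewrite addn0 -(leq_pmul2l (ltn0Sn w)) e1 -e2 leq_add // leq_mul2l h4 orbT.
Qed.

(* Think of n x edges, each lying in 'C(x, w) copies of K_{w+2}: taking as many
   edges away from K_K, in colex order, costs at least as many copies. *)
Lemma colex_count_pool (strict : bool) l K (n : nat -> nat) :
  l.*2 <= K -> (forall x, x < l -> n x <= x.+1) ->
  \sum_(x < l) n x <= 'C(K, 2) ->
  (strict -> 0 < \sum_(x < l) n x /\ w.+1 < K) ->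
  \sum_(x < l) n x * 'C(x, w) + F ('C(K, 2) - \sum_(x < l) n x) + strict <= F 'C(K, 2).
Proof.
elim: l K n strict => [|l IH] K n strict hK hn he hs.
  rewrite !big_ord0 subn0 in hs *.
  by case: strict hs => [/(_ isT)[]//|_]; rewrite addn0.
case: K hK he hs => [|K] hK he hs; first by lia.
move: he hs; set eps := \sum_(x < l.+1) n x => he hs.
have hc : w.+1 * 'C(l, w) <= 'C(K.-1, w).
  by apply: leq_trans (bin_mul2 l w) _; apply: leq_bin2l; lia.
have FD : F 'C(K.+1, 2) = 'C(K, w.+2) + 'C(K, w.+1) by rewrite colex_count_clique // binS.
have [eK|Ke] := ltnP eps K.
  have -> : 'C(K.+1, 2) - eps = 'C(K, 2) + (K - eps) by rewrite bin2S; lia.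
  rewrite colex_countE ?leq_subr // FD.
  have h1 : \sum_(x < l.+1) n x * 'C(x, w) <= eps * 'C(l, w).
    by rewrite big_distrl; apply: leq_sum => i _; rewrite leq_mul2l leq_bin2l ?orbT // -ltnS.
  have := @bin_drop strict _ _ eps hc (ltnW eK).
  have h : strict -> 0 < eps < K /\ w < K by move=> /hs[? ?]; split; lia.
  by move=> /(_ h); move: h1; clear; lia.
have enl : eps = \sum_(x < l) n x + n l by rewrite /eps big_ord_recr.
have hnl := hn l (ltnSn l).
have nlK : n l <= K by lia.
have cK : K - n l <= \sum_(x < l) n x by rewrite leq_subLR addnC -enl.
have [|n' [h1 h2 h3]] := @multiset_remove (fun x => 'C(x, w)) n 'C(l.-1, w) l _ _ cK.
  by move=> x xl; apply: leq_bin2l; lia.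
have e2 : 'C(K.+1, 2) = 'C(K, 2) + K by rewrite bin2S.
have he' : \sum_(x < l) n' x = eps - K by lia.
have hn' x : x < l -> n' x <= x.+1.
  by move=> xl; apply: leq_trans (h1 x) _; apply: hn; lia.
have := IH K n' false ltac:(lia) hn' ltac:(lia) ltac:(by []).
rewrite he'.
have -> : 'C(K, 2) - (eps - K) = 'C(K.+1, 2) - eps by rewrite e2; lia.
rewrite big_ord_recr /= FD colex_count_clique //.
suff : n l * 'C(l, w) + (K - n l) * 'C(l.-1, w) + strict <= 'C(K, w.+1).
  by move: h3 => /=; clear; lia.
have hw : w.+1 * (n l * 'C(l, w) + (K - n l) * 'C(l.-1, w)) <= w.+1 * 'C(K, w.+1).
  rewrite -mul_bin_diag -[X in _ <= X * _](subnKC nlK) mulnDr mulnDl.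
  rewrite mulnCA [w.+1 * (_ * 'C(l.-1, w))]mulnCA leq_add // leq_mul2l ?hc ?orbT //.
  apply/orP; right; apply: leq_trans hc; rewrite leq_mul2l leq_bin2l ?orbT //; lia.
case: strict hs => [/(_ isT)[e0 wK]|_]; last by rewrite addn0 -(leq_pmul2l (ltn0Sn w)).
have l0 : 0 < l.
  by rewrite lt0n; apply/eqP => l0; move: cK hnl; rewrite l0 big_ord0; lia.
rewrite addn1; have [lw|wl] := ltnP l w.
  by rewrite (bin_small lw) (@bin_small l.-1) ?muln0 ?bin_gt0; lia.
rewrite -(ltn_pmul2l (ltn0Sn w)) -mul_bin_diag -[X in _ < X * _](subnKC nlK) mulnDr mulnDl.
rewrite mulnCA [w.+1 * (_ * 'C(l.-1, w))]mulnCA -addnS leq_add ?leq_mul2l ?hc ?orbT //.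
rewrite ltn_mul2l; apply/andP; split; first by lia.
by apply: leq_trans hc; rewrite ltn_mul2l /= bin_ltn2l //; lia.
Qed.
End ColexPool.

Lemma sum_count_gt (g : nat -> nat) l ds : all (fun d => d <= l) ds ->
  \sum_(x < l) count (fun d => x < d) ds * g x = \sum_(d <- ds) \sum_(x < d) g x.
Proof.
elim: ds => [|d ds IH] /=; first by rewrite big_nil big1.
case/andP=> dl {}/IH IH; rewrite big_cons -IH.
under eq_bigr do rewrite mulnDl.
rewrite big_split /=; congr (_ + _).
rewrite (big_ord_widen _ g dl) [RHS]big_mkcond.
by apply: eq_bigr => i _; case: ltnP; rewrite ?mul1n.
Qed.

Lemma sum_bin_col w d : \sum_(x < d) 'C(x, w) = 'C(d, w.+1).
Proof. by elim: d => [|d IH]; rewrite ?big_ord0 // big_ord_recr IH binS. Qed.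

Lemma count_gt_iota x r : count (fun d => x < d) (iota 0 r) = r.-1 - x.
Proof.
elim: r => [|r IH] //; rewrite -[r.+1]addn1 iotaD count_cat IH /= add0n addn0.
by case: r {IH} => [|r] //=; lia.
Qed.

Section ExtremalCount.
Variable w : nat.
Hypothesis w_gt0 : 0 < w.
Local Notation F := (colex_count w).

(* The excess of ds over the degrees 0, ..., r - 1 and s of a partial clique is
   taken from a K_K. *)
Lemma colex_count_trade l K r s ds :
  l.*2 <= K -> w.+1 < K -> s < r -> size ds = r -> all (fun d => d <= l) ds ->
  (forall i, i < r -> r - i <= nth 0 ds i) ->
  let eps := sumn ds - ('C(r, 2) + s) in
  [/\ 'C(r, 2) + s <= sumn ds, eps <= 'C(K, 2) &
  \sum_(d <- ds) 'C(d, w.+1) + F ('C(K, 2) - eps)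
     < 'C(K, w.+2) + 'C(r, w.+2) + 'C(s, w.+1)].
Proof.
move=> lK wK sr szds dsl dsr eps.
have rl : r <= l.
  apply: leq_trans (_ : nth 0 ds 0 <= l); first by have := dsr 0; lia.
  by apply: (allP dsl); apply: mem_nth; rewrite szds; lia.
pose B := s :: iota 0 r.
have Bl : all (fun d => d <= l) B.
  by rewrite /= (leq_trans (ltnW sr) rl) /=; apply/allP => i; rewrite mem_iota add0n => /ltnW/leq_trans; apply.
have cB x : count (fun d => x < d) B = (x < s) + (r.-1 - x) by rewrite /= count_gt_iota.
have cds x : r - x <= count (fun d => x < d) ds.
  rewrite -(cat_take_drop (r - x) ds) count_cat; apply: leq_trans (leq_addr _ _).
  have szt : size (take (r - x) ds) = r - x by rewrite size_take szds; case: ltnP; lia.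
  rewrite -{1}szt leq_eqVlt; apply/orP; left; rewrite eq_sym -all_count.
  apply/(all_nthP 0) => i; rewrite szt => ix; rewrite nth_take //.
  by have := dsr i; lia.
pose n x := count (fun d => x < d) ds - count (fun d => x < d) B.
have nE x : count (fun d => x < d) ds = n x + count (fun d => x < d) B.
  by rewrite /n subnK // cB; have := cds x; case: ltnP; lia.
have nle x : n x <= x.+1.
  rewrite /n cB; have := count_size (fun d => x < d) ds; rewrite szds; lia.
have sumE (g : nat -> nat) : \sum_(d <- ds) \sum_(x < d) g x =
    \sum_(x < l) n x * g x + \sum_(d <- B) \sum_(x < d) g x.
  rewrite -(sum_count_gt g dsl) -(sum_count_gt g Bl) -big_split /=; apply: eq_bigr => i _.
  by rewrite nE mulnDl.
have sumB (j : nat) : \sum_(d <- B) 'C(d, j) = 'C(s, j) + 'C(r, j.+1).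
  by rewrite big_cons -sum_bin_col -[r in LHS]subn0 -/(index_iota 0 r) big_mkord.
have e1 : sumn ds = \sum_(x < l) n x + ('C(r, 2) + s).
  have s1 d : \sum_(x < d) 1 = 'C(d, 1) by rewrite sum1_card card_ord bin1.
  have := sumE (fun=> 1); rewrite (eq_bigr (fun d => 'C(d, 1)) (fun d _ => s1 d)).
  rewrite [X in _ + X](eq_bigr (fun d => 'C(d, 1)) (fun d _ => s1 d)) sumB bin1 addnC.
  rewrite sumnE (eq_bigr (fun d => d) (fun d _ => bin1 d)) => ->.
  by rewrite addnC [s + _]addnC; congr (_ + _); apply: eq_bigr => i _; rewrite muln1.
have e2 : \sum_(d <- ds) 'C(d, w.+1) =
    \sum_(x < l) n x * 'C(x, w) + ('C(s, w.+1) + 'C(r, w.+2)).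
  rewrite -sumB; have := sumE (fun x => 'C(x, w)).
  by under eq_bigr do rewrite sum_bin_col; under [X in _ = _ + X]eq_bigr do rewrite sum_bin_col.
have he : eps = \sum_(x < l) n x by rewrite /eps e1 addnK.
have hsum : \sum_(x < l) n x <= 'C(l.+1, 2).
  rewrite -sum_bin_col big_ord_recl /= add0n; apply: leq_sum => i _.
  by rewrite bin1 nle.
have hK : 'C(l.+1, 2) <= 'C(K, 2) by apply: leq_bin2l; lia.
have pos : 0 < \sum_(x < l) n x.
  have hr : 'C(r.+1, 2) <= sumn ds.
    rewrite sumnE (big_nth 0) szds big_mkord -sum_bin_col big_ord_recl /= add0n.
    rewrite (reindex_inj rev_ord_inj) /=; apply: leq_sum => i _.
    by rewrite bin1 /bump /=; have := dsr i (ltn_ord i); have := ltn_ord i; lia.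
  by move: hr; rewrite e1 bin2S; lia.
split; [by rewrite e1 leq_addl | by rewrite he; lia |].
have := @colex_count_pool w w_gt0 true l K n lK (fun x _ => nle x) _ _.
move=> /(_ (leq_trans hsum hK) (fun _ => conj pos wK)).
rewrite he e2 colex_count_clique //; lia.
Qed.

(* k_{w+2}(q K_K \cup L_b), where m = q C(K, 2) + b *)
Definition extremal_count (K m : nat) : nat :=
  m %/ 'C(K, 2) * 'C(K, w.+2) + F (m %% 'C(K, 2)).
Local Notation f := extremal_count.

Variable K : nat.
Hypothesis wK : w.+1 < K.

Let D_gt0 : 0 < 'C(K, 2). Proof. by rewrite bin_gt0; lia. Qed.

Lemma extremal_countE q b : b <= 'C(K, 2) ->
  f K (q * 'C(K, 2) + b) = q * 'C(K, w.+2) + F b.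
Proof.
rewrite leq_eqVlt => /orP[/eqP->|hb]; rewrite /f.
  rewrite -mulSnr mulnK // modnMl colex_count_clique // mulSnr.
  by have := colex_count_clique w 0; rewrite !bin0n => ->; rewrite addn0.
by rewrite divnMDl // divn_small // addn0 modnMDl modn_small.
Qed.

Lemma extremal_count_super m1 m2 : f K m1 + f K m2 <= f K (m1 + m2).
Proof.
rewrite (divn_eq m1 'C(K, 2)) (divn_eq m2 'C(K, 2)).
set q1 := m1 %/ _; set q2 := m2 %/ _.
have := ltn_pmod m1 D_gt0; have := ltn_pmod m2 D_gt0.
move: (m1 %% _) (m2 %% _) => b1 b2 h2 h1.
rewrite !extremal_countE ?(ltnW h1) ?(ltnW h2) //.
have [hlt|hge] := ltnP (b1 + b2) 'C(K, 2).
  have -> : q1 * 'C(K, 2) + b1 + (q2 * 'C(K, 2) + b2) = (q1 + q2) * 'C(K, 2) + (b1 + b2).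
    by rewrite mulnDl; lia.
  rewrite extremal_countE ?(ltnW hlt) // mulnDl.
  have := colex_count_super w_gt0 b1 b2; lia.
have -> : q1 * 'C(K, 2) + b1 + (q2 * 'C(K, 2) + b2) = (q1 + q2).+1 * 'C(K, 2) + (b1 + b2 - 'C(K, 2)).
  by rewrite mulSn mulnDl; lia.
rewrite extremal_countE; last by lia.
have := @colex_count_fill w w_gt0 false K b1 b2 (ltnW h1) (ltnW h2) hge ltac:(by []).
rewrite colex_count_clique // mulSn mulnDl; lia.
Qed.

Lemma extremal_count_super_lt m1 m2 :
  m1 < 'C(K, 2) -> m2 < 'C(K, 2) -> 'C(K, 2) <= m1 + m2 ->
  f K m1 + f K m2 < f K (m1 + m2).
Proof.
move=> h1 h2 h.
have := @colex_count_fill w w_gt0 true K m1 m2 (ltnW h1) (ltnW h2) h.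
move=> /(_ (fun _ => And3 h1 h2 wK)).
have E m : m < 'C(K, 2) -> f K m = F m.
  by move=> hm; have := @extremal_countE 0 m (ltnW hm); rewrite !mul0n !add0n.
rewrite (E m1 h1) (E m2 h2) colex_count_clique addn1 => hlt.
have -> : m1 + m2 = 1 * 'C(K, 2) + (m1 + m2 - 'C(K, 2)) by rewrite mul1n subnKC.
by rewrite extremal_countE ?mul1n //; lia.
Qed.

Lemma extremal_count_del m d : 'C(d.+1, 2) <= m %% 'C(K, 2) ->
  f K (m - d) + 'C(d, w.+1) <= f K m.
Proof.
move=> h; rewrite [in X in X <= _](divn_eq m 'C(K, 2)).
have hb := ltn_pmod m D_gt0; rewrite bin2S in h.
rewrite -addnBA; last by lia.
rewrite extremal_countE; last by lia.
rewrite /f -addnA leq_add2l.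
have := @colex_count_add w w_gt0 (m %% 'C(K, 2) - d) d; rewrite subnK; last by lia.
by apply; lia.
Qed.

Lemma extremal_count_trade l q r s ds m :
  l.*2 <= K -> s < r -> size ds = r -> all (fun d => d <= l) ds ->
  (forall i, i < r -> r - i <= nth 0 ds i) -> 'C(r, 2) + s < 'C(K, 2) ->
  m + sumn ds = q.+1 * 'C(K, 2) + ('C(r, 2) + s) ->
  f K m + \sum_(d <- ds) 'C(d, w.+1) < f K (m + sumn ds).
Proof.
move=> lK sr szds dsl dsr hb em.
have [h1 h2 h3] := colex_count_trade lK wK sr szds dsl dsr.
rewrite em; have -> : m = q * 'C(K, 2) + ('C(K, 2) - (sumn ds - ('C(r, 2) + s))).
  by move: em; rewrite mulSn; lia.
rewrite !extremal_countE ?leq_subr ?(ltnW hb) // mulSn.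
rewrite colex_countE ?(ltnW sr) //. lia.
Qed.
End ExtremalCount.

(** * Cliques and the Kruskal-Katona theorem *)

Section Cliques.
Variable T : finType.
Implicit Types (e : rel T) (A B S : {set T}) (x y v : T).

Definition clique e A := [forall x in A, forall y in A, (x != y) ==> e x y].
Definition kcliques e j := [set A : {set T} | (#|A| == j) && clique e A].
Definition nbhd e x := [set y | e x y].
Definition del e S : rel T := fun x y => [&& e x y, x \notin S & y \notin S].

Lemma cliqueP e A :
  reflect (forall x y, x \in A -> y \in A -> x != y -> e x y) (clique e A).
Proof.
apply: (iffP forall_inP) => [h x y xA yA|h x xA].
  by move/forall_inP: (h x xA) => /(_ y yA)/implyP.
by apply/forall_inP => y yA; apply/implyP; apply: h.
Qed.

Lemma kcliquesP e j A : reflect (#|A| = j /\ clique e A) (A \in kcliques e j).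
Proof. by rewrite inE; apply: (iffP andP) => -[/eqP]. Qed.

Lemma clique_sub e A B : A \subset B -> clique e B -> clique e A.
Proof.
by move=> /subsetP AB /cliqueP h; apply/cliqueP => x y /AB xB /AB; apply: h.
Qed.

Lemma subrel_clique e e' A : subrel e e' -> clique e A -> clique e' A.
Proof. by move=> ee' /cliqueP h; apply/cliqueP => x y xA yA xy; apply/ee'/h. Qed.

Lemma subrel_kcliques e e' j : subrel e e' -> kcliques e j \subset kcliques e' j.
Proof.
by move=> ee'; apply/subsetP => A /kcliquesP[? ?]; apply/kcliquesP; split; rewrite ?(subrel_clique ee').
Qed.

Lemma set2_kcliques e x y : symmetric e -> irreflexive e ->
  ([set x; y] \in kcliques e 2) = e x y.
Proof.
move=> es ei; apply/kcliquesP/idP => [[]|exy].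
  rewrite cards2; case: eqP => // /eqP xy _ /cliqueP; apply; rewrite ?set21 ?set22 //.
have xy : x != y by apply: contraTneq exy => ->; rewrite ei.
split; first by rewrite cards2 xy.
apply/cliqueP => u v /set2P[]-> /set2P[]->; rewrite ?eqxx // => _.
by rewrite es.
Qed.

Lemma kcliques2P e A : symmetric e -> irreflexive e ->
  reflect (exists x y, e x y /\ A = [set x; y]) (A \in kcliques e 2).
Proof.
move=> es ei; apply: (iffP idP) => [|[x [y [exy ->]]]]; last by rewrite set2_kcliques.
move=> /[dup] h /kcliquesP[/eqP/cards2P[x [y [xy eA]]] _].
by exists x, y; rewrite -(set2_kcliques x y es ei) -eA.
Qed.

Lemma del_sym e S : symmetric e -> symmetric (del e S).
Proof. by move=> es x y; rewrite /del es [in RHS]andbC -andbA [(_ \notin _) && e _ _]andbC; do 2!case: (_ \notin S); rewrite ?andbF ?andbT. Qed.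

Lemma del_irr e S : irreflexive e -> irreflexive (del e S).
Proof. by move=> ei x; rewrite /del ei. Qed.

Lemma del_subrel e S : subrel (del e S) e.
Proof. by move=> x y /and3P[]. Qed.

Lemma card_kcliques_in e A j : clique e A ->
  #|[set B in kcliques e j | B \subset A]| = 'C(#|A|, j).
Proof.
move=> cA; rewrite -(cards_draws A j); apply: eq_card => B; rewrite !inE.
by case: (boolP (B \subset A)) => BA; rewrite ?andbF // andbT (clique_sub BA cA) andbT.
Qed.

Lemma kcliques_del e v j : symmetric e -> irreflexive e -> 1 < j ->
  kcliques (del e [set v]) j = [set A in kcliques e j | v \notin A].
Proof.
move=> es ei j1; apply/setP => A; rewrite inE.
apply/kcliquesP/andP => [[cA clA]|[/kcliquesP[cA /cliqueP clA] vA]].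
  split; first by apply/kcliquesP; split=> //; apply: subrel_clique clA; apply: del_subrel.
  apply/negP => vA.
  have : 0 < #|A :\ v| by move: cA; rewrite (cardsD1 v) vA; lia.
  case/card_gt0P => y /setD1P[yv yA].
  by have := cliqueP _ _ clA _ _ yA vA yv; rewrite /del !inE eqxx !andbF.
split=> //; apply/cliqueP => x y xA yA xy; rewrite /del clA //= !inE.
by apply/andP; split; apply: contraNneq vA => <-.
Qed.

Definition link e v j := [set B in kcliques e j | B \subset nbhd e v].

Lemma card_kcliques_del e v j : symmetric e -> irreflexive e -> 0 < j ->
  #|kcliques e j.+1| = #|kcliques (del e [set v]) j.+1| + #|link e v j|.
Proof.
move=> es ei j0; rewrite kcliques_del // -(cardsID [set A : {set T} | v \in A]) addnC.
have vN : v \notin nbhd e v by rewrite inE ei.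
congr (_ + _); first by apply: eq_card => A; rewrite !inE andbC.
rewrite -(card_in_imset (f := fun B => v |: B) (D := link e v j)); last first.
  move=> B C /setIdP[_ hB] /setIdP[_ hC] h.
  have hv (D : {set T}) : D \subset nbhd e v -> (v |: D) :\ v = D.
    by move=> /subsetP hD; rewrite setU1K //; apply: contra vN => /hD.
  by rewrite -(hv B hB) -(hv C hC) h.
apply: eq_card => A; apply/setIP/imsetP.
  case=> /kcliquesP[cA clA] /[!inE] vA; exists (A :\ v); last by rewrite setD1K.
  rewrite inE; apply/andP; split.
    apply/kcliquesP; split; last by apply: clique_sub clA; apply: subsetDl.
    by move: cA; rewrite (cardsD1 v) vA add1n => -[].
  apply/subsetP => x /setD1P[xv xA]; rewrite inE.
  by apply: (cliqueP _ _ clA); rewrite // eq_sym.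
case=> B /setIdP[/kcliquesP[cB /cliqueP clB] /subsetP hB] ->; split; last by rewrite inE setU11.
have vB : v \notin B by apply: contra vN => /hB.
apply/kcliquesP; split; first by rewrite cardsU1 vB cB.
apply/cliqueP => x y /setU1P[->|xB] /setU1P[->|yB]; rewrite ?eqxx // => xy.
- by have := hB _ yB; rewrite inE.
- by have := hB _ xB; rewrite inE es.
- exact: clB.
Qed.

Lemma card_link_le e v j : #|link e v j| <= 'C(#|nbhd e v|, j).
Proof.
rewrite -(cards_draws (nbhd e v) j); apply/subset_leq_card/subsetP => B.
by rewrite !inE => /andP[/andP[-> _] ->].
Qed.

Lemma card_link1 e v : #|link e v 1| = #|nbhd e v|.
Proof.
rewrite -[RHS]bin1 -(cards_draws (nbhd e v) 1); apply: eq_card => B.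
rewrite !inE; case: (boolP (B \subset nbhd e v)) => BN; rewrite ?andbF // !andbT.
apply: andb_idr => /cards1P[x ->]; apply/cliqueP => a b /set1P-> /set1P->.
by rewrite eqxx.
Qed.

Lemma card_edges_del e v : symmetric e -> irreflexive e ->
  #|kcliques e 2| = #|kcliques (del e [set v]) 2| + #|nbhd e v|.
Proof. by move=> es ei; rewrite (card_kcliques_del v es ei) ?card_link1. Qed.

Lemma full_link_clique e v j : symmetric e -> 1 < j <= #|nbhd e v| ->
  #|link e v j| = 'C(#|nbhd e v|, j) -> clique e (v |: nbhd e v).
Proof.
move=> es /andP[j1 jN]; rewrite -(cards_draws (nbhd e v) j) => h.
have E : link e v j = [set A : {set T} | A \subset nbhd e v & #|A| == j].
  apply/eqP; rewrite eqEcard h leqnn andbT; apply/subsetP => B.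
  by rewrite !inE => /andP[/andP[-> _] ->].
apply/cliqueP => x y /setU1P[->|xN] /setU1P[->|yN]; rewrite ?eqxx // => xy.
- by move: yN; rewrite inE.
- by move: xN; rewrite inE es.
have [j2|hj] := leqP j 2.
  have : [set x; y] \in link e v j.
    rewrite E inE cards2 xy; apply/andP; split; last by rewrite eqn_leq j1 j2.
    by apply/subsetP => z /set2P[]->.
  by case/setIdP => /kcliquesP[_ /cliqueP h'] _; apply: h'; rewrite ?set21 ?set22.
have hc : 0 < #|[set A : {set T} | A \subset nbhd e v :\ x :\ y & #|A| == j.-2]|.
  rewrite cards_draws bin_gt0.
  have e1 := cardsD1 x (nbhd e v); have e2 := cardsD1 y (nbhd e v :\ x).
  have yN' : y \in nbhd e v :\ x by rewrite in_setD1 eq_sym xy yN.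
  by rewrite xN in e1; rewrite yN' in e2; lia.
case/card_gt0P: hc => B; rewrite inE => /andP[/subsetP BN /eqP cB].
have xB : x \notin B by apply/negP => /BN; rewrite !inE eqxx /= andbF.
have yB : y \notin B by apply/negP => /BN; rewrite !inE eqxx.
have : x |: (y |: B) \in link e v j.
  rewrite E inE !cardsU1 !inE negb_or xy xB yB cB /=; apply/andP; split; last by lia.
  apply/subsetP => z /setU1P[->//|/setU1P[->//|/BN]].
  by rewrite !inE => /and3P[].
by case/setIdP => /kcliquesP[_ /cliqueP h'] _; apply: h'; rewrite ?inE ?eqxx ?orbT.
Qed.

Lemma edges_lower e S d : symmetric e -> irreflexive e -> #|S| = d ->
  (forall x, x \in S -> d.-1 <= #|nbhd e x|) -> 'C(d, 2) <= #|kcliques e 2|.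
Proof.
elim: d e S => [|d IH] e S es ei cS hS; first by rewrite bin0n.
have [v vS] : exists v, v \in S by apply/card_gt0P; rewrite cS.
rewrite (card_edges_del v es ei) bin2S leq_add ?hS //.
apply: (IH _ (S :\ v)); [exact: del_sym | exact: del_irr | |].
  by move: cS; rewrite (cardsD1 v) vS add1n => -[].
move=> x /setD1P[xv xS]; have /= := hS x xS.
have -> : nbhd (del e [set v]) x = nbhd e x :\ v.
  by apply/setP => y; rewrite !inE /del !inE xv andbC.
by rewrite (cardsD1 v (nbhd e x)); case: (_ \in _); lia.
Qed.

End Cliques.

Section KruskalKatona.
Variable T : finType.
Implicit Types (e : rel T) (A B S : {set T}) (x y v : T).

Definition support e := [set x | [exists y, e x y]].

Lemma supportP e x : reflect (exists y, e x y) (x \in support e).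
Proof. by rewrite inE; apply: existsP. Qed.

Lemma nbhd_gt0 e x : (0 < #|nbhd e x|) = (x \in support e).
Proof.
apply/card_gt0P/supportP => -[y]; first by rewrite inE; exists y.
by exists y; rewrite inE.
Qed.

Lemma nbhd_del e v x : nbhd (del e [set v]) x = if x == v then set0 else nbhd e x :\ v.
Proof.
apply/setP => y; rewrite inE /del !inE.
by case: (x == v); rewrite !inE ?andbF //= andbC.
Qed.

Lemma min_degree_vertex e : symmetric e -> irreflexive e -> 0 < #|kcliques e 2| ->
  exists v, [/\ v \in support e,
    forall x, x \in support e -> #|nbhd e v| <= #|nbhd e x| &
    'C(#|nbhd e v|, 2) <= #|kcliques (del e [set v]) 2|].
Proof.
move=> es ei /card_gt0P[A /(kcliques2P _ es ei)[x [y [exy _]]]].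
have xs : x \in support e by apply/supportP; exists y.
have [v vs hv] := arg_minnP (fun x => #|nbhd e x|) xs.
exists v; split=> //.
apply: (@edges_lower _ _ (nbhd e v)) => // [||z]; [exact: del_sym|exact: del_irr|].
rewrite inE => evz; have zs : z \in support e by apply/supportP; exists v; rewrite es.
have zv : z != v by apply: contraTneq evz => ->; rewrite ei.
have := hv z zs; rewrite nbhd_del (negbTE zv) (cardsD1 v (nbhd e z)).
by case: (_ \in _); lia.
Qed.

Lemma del1_lt_edges e v : symmetric e -> irreflexive e -> v \in support e ->
  #|kcliques (del e [set v]) 2| < #|kcliques e 2|.
Proof. by move=> es ei; rewrite (card_edges_del v es ei) -nbhd_gt0; lia. Qed.

Lemma no_edges_no_kcliques e j : symmetric e -> irreflexive e -> 1 < j ->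
  #|kcliques e 2| = 0 -> #|kcliques e j| = 0.
Proof.
move=> es ei j1 e0; apply/eqP; rewrite -leqn0 leqNgt; apply/negP => /card_gt0P[A].
case/kcliquesP=> cA /cliqueP clA.
have /card_gt1P[x [y [xA yA xy]]] : 1 < #|A| by rewrite cA.
have : [set x; y] \in kcliques e 2 by rewrite set2_kcliques ?clA.
by move/card0_eq: e0 => ->.
Qed.

Variable w : nat.
Hypothesis w_gt0 : 0 < w.
Local Notation F := (colex_count w).

Theorem kruskal_katona e : symmetric e -> irreflexive e ->
  #|kcliques e w.+2| <= F #|kcliques e 2|.
Proof.
have [n] := ubnP #|kcliques e 2|; elim: n e => // n IH e hn es ei.
have [e0|e0] := posnP #|kcliques e 2|; first by rewrite no_edges_no_kcliques.
have [v [vs _ hv]] := min_degree_vertex es ei e0.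
have lt := del1_lt_edges es ei vs.
have := IH (del e [set v]) ltac:(lia) (del_sym _ es) (del_irr _ ei).
rewrite (card_kcliques_del v es ei) // (card_edges_del v es ei).
have := card_link_le e v w.+1; have := colex_count_add w_gt0 hv; lia.
Qed.

Lemma kruskal_katona_eq e v : symmetric e -> irreflexive e ->
  'C(#|nbhd e v|, 2) <= #|kcliques (del e [set v]) 2| ->
  #|kcliques e w.+2| = F #|kcliques e 2| ->
  let M := #|kcliques (del e [set v]) 2| in let d := #|nbhd e v| in
  [/\ #|kcliques (del e [set v]) w.+2| = F M, #|link e v w.+1| = 'C(d, w.+1) &
      F M + 'C(d, w.+1) = F (M + d)].
Proof.
move=> es ei hv h M d.
have h1 := kruskal_katona (del_sym [set v] es) (del_irr [set v] ei).
have h2 := card_link_le e v w.+1; have h3 := colex_count_add w_gt0 hv.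
move: h; rewrite (card_kcliques_del v es ei) // (card_edges_del v es ei) -/M -/d in h1 h2 h3 *.
by move=> h; split; lia.
Qed.

Lemma kruskal_katona_eq_mindeg e v r s : symmetric e -> irreflexive e ->
  #|kcliques e 2| = 'C(r, 2) + s -> s < r -> w.+1 < r ->
  'C(#|nbhd e v|, 2) <= #|kcliques (del e [set v]) 2| ->
  #|kcliques e w.+2| = F #|kcliques e 2| -> s < #|nbhd e v| ->
  v |: nbhd e v \in kcliques e r /\ #|nbhd e v|.+1 = r.
Proof.
move=> es ei em sr wr hv ek.
have [h1 h2 h3] := kruskal_katona_eq es ei hv ek.
have := card_edges_del v es ei; set M := #|kcliques (del _ _) 2| in hv h1 h3 *.
set d := #|nbhd e v| in hv h2 h3 * => eM sd.
have dr : d < r by apply: (colex_rank_le sr); rewrite bin2S; lia.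
have [q er] : exists q, r = q.+1 by exists r.-1; lia.
have eMq : M = 'C(q, 2) + (q + s - d) by move: em; rewrite er bin2S; lia.
have hd : d = q.
  apply/eqP; rewrite eqn_leq -ltnS -er dr /= leqNgt; apply/negP => dq.
  move: h3; rewrite eMq colex_countE; last by lia.
  have -> : 'C(q, 2) + (q + s - d) + d = 'C(r, 2) + s by rewrite er bin2S; lia.
  rewrite colex_countE ?(ltnW sr) // er binS => h3'.
  suff : 'C(q + s - d, w.+1) + 'C(d, w.+1) + true <= 'C(q, w.+1) + 'C(s, w.+1) by lia.
  by apply: bin_spread => [|||_]; try split; lia.
split; last by lia.
apply/kcliquesP; split.
  by rewrite cardsU1 inE ei /= -/d; lia.
by apply: full_link_clique h2 => //; rewrite -/d; lia.
Qed.

Lemma kruskal_katona_eq_clique e r s : symmetric e -> irreflexive e ->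
  #|kcliques e 2| = 'C(r, 2) + s -> s < r -> w.+1 < r ->
  #|kcliques e w.+2| = F #|kcliques e 2| -> exists A, A \in kcliques e r.
Proof.
have [n] := ubnP #|kcliques e 2|; elim: n e s => // n IH e s hn es ei em sr wr ek.
have e0 : 0 < #|kcliques e 2| by rewrite em; have := bin_gt0 r 2; lia.
have [v [vs _ hv]] := min_degree_vertex es ei e0.
have lt := del1_lt_edges es ei vs.
have [h1 h2 h3] := kruskal_katona_eq es ei hv ek.
have := card_edges_del v es ei; set M := #|kcliques (del _ _) 2| in hv lt h1 h3 *.
set d := #|nbhd e v| in hv h2 h3 * => eM.
have dr : d < r by apply: (colex_rank_le sr); rewrite bin2S; lia.
have [ds|sd] := leqP d s.
  have hM : #|kcliques (del e [set v]) 2| = 'C(r, 2) + (s - d) by lia.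
  have [||||A hA] := IH _ _ _ (del_sym [set v] es) (del_irr [set v] ei) hM; rewrite -/M //; try lia.
  by exists A; apply: subsetP hA; apply/subrel_kcliques/del_subrel.
by exists (v |: nbhd e v); have [] := kruskal_katona_eq_mindeg es ei em sr wr hv ek sd.
Qed.

Lemma clique_all_edges e A r : symmetric e -> irreflexive e -> A \in kcliques e r ->
  #|kcliques e 2| <= 'C(r, 2) -> forall x y, e x y -> x \in A /\ y \in A.
Proof.
move=> es ei /kcliquesP[cA clA] h x y exy.
have hs : [set B in kcliques e 2 | B \subset A] \subset kcliques e 2.
  by apply/subsetP => B /setIdP[].
have E : [set B in kcliques e 2 | B \subset A] = kcliques e 2.
  by apply/eqP; rewrite eqEcard hs card_kcliques_in // cA.
have : [set x; y] \in kcliques e 2 by rewrite set2_kcliques.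
by rewrite -E => /setIdP[_ /subsetP hA]; split; apply: hA; rewrite ?set21 ?set22.
Qed.

Lemma kruskal_katona_eq_colex e r s : symmetric e -> irreflexive e ->
  #|kcliques e 2| = 'C(r, 2) + s -> w < s < r ->
  #|kcliques e w.+2| = F #|kcliques e 2| ->
  exists A v, [/\ A \in kcliques e r, v \notin A, nbhd e v \subset A & #|nbhd e v| = s].
Proof.
move=> es ei em /andP[ws sr] ek.
have e0 : 0 < #|kcliques e 2| by rewrite em; lia.
have [v [vs hmin hv]] := min_degree_vertex es ei e0.
have [h1 h2 h3] := kruskal_katona_eq es ei hv ek.
have := card_edges_del v es ei; set M := #|kcliques (del _ _) 2| in hv h1 h3 *.
set d := #|nbhd e v| in hv h2 h3 hmin * => eM.
have dr : d < r by apply: (colex_rank_le sr); rewrite bin2S; lia.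
have d0 : 0 < d by rewrite nbhd_gt0.
have [ds|sd] := leqP d s.
  have {}ds : d = s.
    apply/eqP; rewrite eqn_leq ds /= leqNgt; apply/negP => dlt.
    have eMq : M = 'C(r, 2) + (s - d) by lia.
    have h4 : 'C(s - d, w.+1) + 'C(d, w.+1) + true <= 'C(s, w.+1) + 'C(0, w.+1).
      by apply: bin_spread => [|||_]; try split; lia.
    move: h3 h4; rewrite eMq bin0n colex_countE; last by lia.
    have -> : 'C(r, 2) + (s - d) + d = 'C(r, 2) + s by lia.
    by rewrite colex_countE ?(ltnW sr) //; lia.
  have es' := del_sym [set v] es; have ei' := del_irr [set v] ei.
  have eMr : M = 'C(r, 2) by lia.
  have hM : #|kcliques (del e [set v]) 2| = 'C(r, 2) + 0 by lia.
  have [|||A hA] := kruskal_katona_eq_clique es' ei' hM; rewrite -/M //; try lia.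
  have hAe : A \in kcliques e r by apply: subsetP hA; apply/subrel_kcliques/del_subrel.
  have hin := clique_all_edges es' ei' hA; rewrite -/M eMr leqnn in hin.
  have vA : v \notin A.
    apply/negP => vA; case/kcliquesP: hA => cA /cliqueP clA.
    have : 0 < #|A :\ v| by move: cA; rewrite (cardsD1 v) vA; lia.
    case/card_gt0P => y /setD1P[yv yA].
    by have := clA _ _ yA vA yv; rewrite /del !inE eqxx !andbF.
  exists A, v; split=> //.
  apply/subsetP => y yN.
  have : 0 < #|nbhd e v :\ y| by have := cardsD1 y (nbhd e v); rewrite yN -/d; lia.
  case/card_gt0P => z /setD1P[zy zN].
  have /cliqueP clN : clique e (v |: nbhd e v) by apply: full_link_clique h2 => //; rewrite -/d; lia.
  have eyz : e y z by apply: clN; rewrite ?in_setU1 ?yN ?zN ?orbT // eq_sym.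
  have nv u : u \in nbhd e v -> u != v by apply: contraTneq => ->; rewrite inE ei.
  by have [|//] := hin isT y z; rewrite /del eyz !inE !nv.
have wr : w.+1 < r by lia.
have [hA dr1] := kruskal_katona_eq_mindeg es ei em sr wr hv ek sd.
set A := v |: nbhd e v in hA.
have [sup|/subsetPn[u us uA]] := boolP (support e \subset A).
  have : #|kcliques e 2| <= 'C(r, 2).
    case/kcliquesP: (hA) => <- clA; rewrite -(card_kcliques_in 2 clA).
    apply/subset_leq_card/subsetP => B hB; rewrite inE hB.
    case/(kcliques2P _ es ei): hB => x [y [exy ->]]; apply/subsetP => z /set2P[]->.
      by apply: (subsetP sup); apply/supportP; exists y.
    by apply: (subsetP sup); apply/supportP; exists x; rewrite es.
  by rewrite em; lia.
have hA' : A \in kcliques (del e [set u]) r.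
  by rewrite kcliques_del //; [rewrite inE hA | lia].
have h4 : 'C(r, 2) <= #|kcliques (del e [set u]) 2|.
  case/kcliquesP: hA' => <- clA; rewrite -(card_kcliques_in 2 clA).
  by apply/subset_leq_card/subsetP => B /setIdP[].
by have := card_edges_del u es ei; have := hmin u us; lia.
Qed.
End KruskalKatona.

(** * Long paths and cycles in 2-connected graphs *)

Section Vine.
Variable T : finType.
Implicit Types (e : rel T) (L R X S : {set T}) (x y z : T) (p q s : seq T).

Lemma uniq_catP p q : reflect [/\ uniq p, uniq q & forall z, z \in p -> z \in q -> False]
  (uniq (p ++ q)).
Proof.
rewrite cat_uniq; apply: (iffP and3P) => -[h1 h2 h3]; split=> //.
  by move=> z zp zq; move/hasP: h2; apply; exists z.
by apply/hasP => -[z zq zp]; apply: (h3 z).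
Qed.

Lemma del_path_notin e S x p : path (del e S) x p -> {in p, forall z, z \notin S}.
Proof.
elim: p x => //= y p IH x /andP[/and3P[_ _ yS] /IH h] z.
by rewrite inE => /orP[/eqP->|/h].
Qed.

Lemma path_trim e X R x p : path e x p -> uniq (x :: p) -> x \in X -> last x p \in R ->
  exists w W, [/\ path e w W, uniq (w :: W), w \in X & last w W \in R] /\
    [/\ {subset w :: W <= x :: p}, (forall z, z \in W -> z \notin X) &
        forall z, z \in w :: W -> z \in R -> z = last w W].
Proof.
have [n] := ubnP (size p); elim: n x p => // n IH x p hn hp hu xX hR.
have [/hasP[z zp zX]|/hasPn hX] := boolP (has (mem X) p).
  case/splitPr: zp hn hp hu hR => p1 p2.
  rewrite size_cat /= cat_path last_cat /= cat_uniq => hn /and3P[_ _ h2] /andP[_ /and3P[_ _ hu]] hR.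
  have [|w [W [h [sub h3 h4]]]] := IH z p2 _ h2 hu zX hR; first by lia.
  exists w, W; split=> //; split=> // y /sub yz.
  by rewrite -cat_cons mem_cat yz orbT.
have [xR|xR] := boolP (x \in R).
  exists x, [::]; split; split=> // z; rewrite ?inE //; first by move=> ->.
  by move=> /eqP.
have hh : has (mem R) p.
  apply/hasP; exists (last x p) => //.
  by move: hR xR; have := mem_last x p; rewrite inE => /predU1P[->->|].
case: {-}_ / (split_find hh) hp hu hX => z p1 p2 zR /hasPn h1.
rewrite cat_path -cat_cons cat_uniq => /andP[hp _] /andP[hu _] hX.
exists x, (rcons p1 z); rewrite last_rcons; split; split=> //.
- by move=> y; rewrite !inE mem_cat => /orP[->//|->]; rewrite orbT.
- by move=> y yp; apply: hX; rewrite mem_cat yp.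
move=> y; rewrite inE mem_rcons inE => /or3P[/eqP->|/eqP->//|/h1/negP//].
by move=> h; rewrite h in xR.
Qed.

Lemma connect_trim e S X R x y : connect (del e S) x y -> x \notin S -> x \in X -> y \in R ->
  exists w W, [/\ path e w W, uniq (w :: W), w \in X & last w W \in R] /\
    [/\ (forall z, z \in w :: W -> z \notin S), (forall z, z \in W -> z \notin X) &
        forall z, z \in w :: W -> z \in R -> z = last w W].
Proof.
case/connectP=> p hp ->; case/shortenP: hp => p' hp hu _ xS xX yR.
have [w [W [[h1 h2 h3 h4] [h5 h6 h7]]]] := path_trim hp hu xX yR.
exists w, W; split; split=> //.
  by apply: sub_path h1; apply: del_subrel.
move=> z /h5; rewrite inE => /predU1P[->//|].
exact: (del_path_notin hp).
Qed.

(* Two disjoint paths from L to R, one starting at a and one ending at the last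
   vertex of s: the vertices of s become targets one at a time. *)
Lemma vine e L R a s : path e a s -> uniq (a :: s) -> a \in L -> last a s \in R ->
  (forall z, z \in s -> z \notin L) ->
  (forall z, z \in a :: s -> z \in R -> z = last a s) ->
  (forall v, exists x y, [/\ x \in L, y \in R, x != v, y != v & connect (del e [set v]) x y]) ->
  exists x1 q1 x2 q2,
   [/\ path e x1 q1, path e x2 q2, uniq ((x1 :: q1) ++ (x2 :: q2)), x1 \in L & x2 \in L] /\
   [/\ a = x1 \/ a = x2, last x1 q1 = last a s, last x2 q2 \in R,
       (forall z, z \in q1 ++ q2 -> z \notin L) &
       forall z, z \in (x1 :: q1) ++ (x2 :: q2) -> z \in R ->
         z = last x1 q1 \/ z = last x2 q2].
Proof.
elim/last_ind: s R => [|s b IH] R hp hu aL hR hL hs hcut.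
  have [x [y [xL yR xa ya hc]]] := hcut a.
  have [|w [W [[h1 h2 h3 h4] [h5 h6 h7]]]] := connect_trim hc _ xL yR; first by rewrite inE.
  exists a, [::], w, W; split; split=> //.
  - by rewrite cat1s cons_uniq h2 andbT; apply/negP => /h5; rewrite inE eqxx.
  - by left.
  by move=> z; rewrite cat1s inE => /predU1P[->|/h7 h /h]; [left|right].
rewrite last_rcons in hR hs *; set c := last a s.
move: hp hu hL hs; rewrite rcons_path -/c -rcons_cons rcons_uniq => /andP[hp ecb] /andP[bs hu] hL hs.
have bL : b \notin L by apply: hL; rewrite mem_rcons mem_head.
have sR z : z \in a :: s -> z \notin R.
  move=> zs; apply: contraNN bs => zR.
  by rewrite -(hs z) // mem_rcons inE zs orbT.
have cs : c \in a :: s by apply: mem_last.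
have cb : c != b by apply: contraNneq bs => <-.
have [|z zs|z zs|v|x1 [q1 [x2 [q2 [[hq1 hq2 hq x1L x2L] [ha e1 e2 hN hI]]]]]] := IH (c |: R) hp hu aL.
- by rewrite setU11.
- by apply: hL; rewrite mem_rcons inE zs orbT.
- by case/setU1P=> // zR; move: (sR z zs); rewrite zR.
- by have [x [y [xL yR xv yv h]]] := hcut v; exists x, y; rewrite in_setU1 yR orbT.
rewrite -/c in e1.
have [u1 u2 u12] := uniq_catP _ _ hq.
have c1 : c \in x1 :: q1 by rewrite -e1 mem_last.
have [E2 eE2] : exists E2, E2 = last x2 q2 by exists (last x2 q2).
rewrite -eE2 in e2 hI.
have m2 : E2 \in x2 :: q2 by rewrite eE2 mem_last.
have {}e2 : E2 \in R.
  by case/setU1P: e2 => // h; case: (u12 c c1); rewrite -h.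
have {}hI z : z \in (x1 :: q1) ++ (x2 :: q2) -> z \in R -> z = E2.
  move=> zq zR; have [] := hI z zq; rewrite ?in_setU1 ?zR ?orbT // e1 => zc.
  by move: (sR c cs); rewrite -zc zR.
have [eb|E2b] := eqVneq E2 b; last first.
  have bq : b \notin (x1 :: q1) ++ (x2 :: q2).
    by apply: contraNN E2b => /hI/(_ hR)->.
  exists x1, (rcons q1 b), x2, q2; rewrite last_rcons rcons_path hq1 e1 ecb -eE2; split; split=> //.
  - move: bq; rewrite mem_cat negb_or => /andP[bq1 bq2].
    apply/uniq_catP; split=> //; first by rewrite -rcons_cons rcons_uniq bq1.
    move=> z; rewrite -rcons_cons mem_rcons inE => /predU1P[->|/u12//].
    by rewrite (negbTE bq2).
  - by move=> z; rewrite mem_cat mem_rcons inE -orbA -mem_cat => /predU1P[->//|/hN].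
  move=> z; rewrite mem_cat inE mem_rcons inE orbCA -!orbA => /or3P[/eqP->|zx|zq]; first by left.
    by move=> zR; right; apply: hI => //; rewrite mem_cat inE zx.
  move=> zR; right; apply: hI => //; rewrite mem_cat inE.
  by case/orP: zq => ->; rewrite ?orbT.
have b2 : b \in x2 :: q2 by rewrite -eb.
have b1 : b \notin x1 :: q1 by apply/negP => h; apply: (u12 b).
have [x [y [xL yR xb yb hc]]] := hcut b.
pose X := L :|: [set z in (x1 :: q1) ++ (x2 :: q2)].
have [||w [W [[h1 h2 h3 h4] [h5 h6 h7]]]] := connect_trim (X := X) hc _ _ yR.
- by rewrite inE.
- by rewrite inE xL.
have {}h5 z : z \in w :: W -> z != b by move=> /h5; rewrite inE.
have WL z : z \in W -> z \notin L by move=> /h6; rewrite inE negb_or => /andP[].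
have W1 z : z \in W -> z \notin x1 :: q1.
  by move=> /h6; rewrite inE negb_or => /andP[_]; rewrite inE mem_cat negb_or => /andP[].
have W2 z : z \in W -> z \notin x2 :: q2.
  by move=> /h6; rewrite inE negb_or => /andP[_]; rewrite inE mem_cat negb_or => /andP[].
have uW : uniq W by case/andP: h2.
have wb : w != b by apply: h5; rewrite mem_head.
have [w1|w1] := boolP (w \in x1 :: q1).
  case/splitPl: w1 hq1 {h3} e1 c1 u1 u12 b1 W1 hN hI {hq} => p1 p2 lp1.
  rewrite cat_path => /andP[hp1 _] _ _ u1 u12 b1 W1 hN hI.
  have sub z : z \in x1 :: p1 -> z \in x1 :: p1 ++ p2 by rewrite -cat_cons mem_cat => ->.
  exists x2, q2, x1, (p1 ++ W); rewrite cat_path hp1 lp1 h1 last_cat lp1 -eE2; split; split=> //.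
  - apply/uniq_catP; split=> //.
      rewrite -cat_cons; apply/uniq_catP; split=> //; last by move=> z /sub zq /W1/negP.
      by move: u1; rewrite -cat_cons cat_uniq => /and3P[].
    move=> z z2; rewrite -cat_cons mem_cat => /orP[/sub/u12|/W2/negP]; exact.
  - by case: ha; [right|left].
  - move=> z; rewrite mem_cat => /orP[z2|]; first by apply: hN; rewrite mem_cat z2 orbT.
    by rewrite mem_cat => /orP[zp|/WL//]; apply: hN; rewrite !mem_cat zp.
  move=> z; rewrite mem_cat => /orP[z2 zR|].
    by left; apply: hI => //; rewrite mem_cat z2 orbT.
  rewrite -cat_cons mem_cat => /orP[/sub zp zR|zW zR].
    have zE : z = E2 by apply: hI; rewrite // mem_cat zp.
    by case: (u12 z zp); rewrite zE.
  by right; apply: h7; rewrite // inE zW orbT.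
have ub z : z \in x1 :: rcons q1 b -> z = b \/ z \in x1 :: q1.
  by rewrite inE mem_rcons inE orbCA => /predU1P[->|]; [left|right].
have u1b : uniq (x1 :: rcons q1 b) by rewrite -rcons_cons rcons_uniq b1.
have hp1b : path e x1 (rcons q1 b) by rewrite rcons_path hq1 e1.
have [w2|w2] := boolP (w \in x2 :: q2).
  case/splitPl: w2 hq2 {h3} eE2 u2 u12 b2 W2 hN hI {hq m2} => p1 p2 lp1.
  rewrite cat_path last_cat => /andP[hp1 _] eE2 u2 u12 b2 W2 hN hI.
  have sub z : z \in x2 :: p1 -> z \in x2 :: p1 ++ p2 by rewrite -cat_cons mem_cat => ->.
  have bp1 : b \notin x2 :: p1.
    have /uniq_catP[_ _ d] : uniq ((x2 :: p1) ++ p2) by [].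
    apply/negP => bp; apply: (d b bp).
    move: eb; rewrite eE2 lp1 => h; have := mem_last w p2.
    by rewrite h inE eq_sym (negbTE wb).
  exists x1, (rcons q1 b), x2, (p1 ++ W); rewrite last_rcons cat_path hp1 lp1 h1 last_cat lp1; split; split=> //.
  - apply/uniq_catP; split=> //.
      rewrite -cat_cons; apply/uniq_catP; split=> //; last by move=> z /sub zq /W2/negP.
      by move: u2; rewrite -cat_cons cat_uniq => /and3P[].
    move=> z /ub[->|z1]; rewrite -cat_cons mem_cat => /orP[zp|zW].
    + by rewrite zp in bp1.
    + by move: (h5 b); rewrite inE zW orbT eqxx => /(_ isT).
    + by apply: (u12 z) => //; apply: sub.
    + by move/W1/negP: zW.
  - move=> z; rewrite mem_cat mem_rcons inE -orbA => /predU1P[->//|].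
    case/orP=> [zq|]; first by apply: hN; rewrite mem_cat zq.
    by rewrite mem_cat => /orP[zp|/WL//]; apply: hN; rewrite !mem_cat zp !orbT.
  move=> z; rewrite mem_cat => /orP[/ub[->|z1] zR|]; first by left.
    by left; rewrite -eb; apply: hI => //; rewrite mem_cat z1.
  rewrite -cat_cons mem_cat => /orP[zp zR|zW zR].
    by left; rewrite -eb; apply: hI => //; rewrite mem_cat sub ?orbT.
  by right; apply: h7; rewrite // inE zW orbT.
have wL : w \in L.
  by move: h3; rewrite inE => /orP[//|]; rewrite inE mem_cat (negbTE w1) (negbTE w2).
case: ha => ha.
  exists x1, (rcons q1 b), w, W; rewrite last_rcons; split; split=> //.
  - apply/uniq_catP; split=> // z /ub[->|z1]; rewrite inE => /predU1P[h|zW].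
    + by rewrite h eqxx in wb.
    + by move: (h5 b); rewrite inE zW orbT eqxx => /(_ isT).
    + by rewrite -h z1 in w1.
    + by move/W1/negP: zW.
  - by left.
  - move=> z; rewrite mem_cat mem_rcons inE -orbA => /predU1P[->//|].
    by case/orP=> [zq|/WL//]; apply: hN; rewrite mem_cat zq.
  move=> z; rewrite mem_cat => /orP[/ub[->|z1] zR|zW zR]; first by left.
    by left; rewrite -eb; apply: hI => //; rewrite mem_cat z1.
  by right; apply: h7.
exists x2, q2, w, W; rewrite -eE2; split; split=> //.
- apply/uniq_catP; split=> // z z2; rewrite inE => /predU1P[h|zW].
    by rewrite -h z2 in w2.
  by move/W2/negP: zW.
- by left.
- move=> z; rewrite mem_cat => /orP[zq|/WL//].
  by apply: hN; rewrite mem_cat zq orbT.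
move=> z; rewrite mem_cat => /orP[z2 zR|zW zR]; last by right; apply: h7.
by left; apply: hI => //; rewrite mem_cat z2 orbT.
Qed.
End Vine.

Section Theta.
Variables (T : finType) (e : rel T).
Hypotheses (es : symmetric e) (ei : irreflexive e).
Implicit Types (L R X S : {set T}) (x y z : T) (p q s : seq T).

Lemma rev_upath x p : path e x p -> uniq (x :: p) ->
  exists q, [/\ path e (last x p) q, last (last x p) q = x, uniq (last x p :: q) &
    last x p :: q =i x :: p].
Proof.
move=> hp hu; exists (rev (belast x p)).
have E : last x p :: rev (belast x p) = rev (x :: p) by rewrite [in RHS]lastI rev_rcons.
split; rewrite ?E ?rev_uniq //; last by move=> z; rewrite mem_rev.
  by rewrite rev_path (eq_path (e' := e)).
have := congr1 (last x) E; rewrite rev_cons last_rcons.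
by [].
Qed.

(* Walk from i back to x, then jump to the first neighbour of x beyond i. *)
Lemma lollipop x p i : path e x p -> uniq (x :: p) -> e x (last x p) ->
  {subset nbhd e x <= x :: p} -> i \in x :: p -> i != last x p ->
  exists M, [/\ path e i M, last i M = last x p, uniq (i :: M),
    {subset i :: M <= x :: p} & {subset x |: nbhd e x <= i :: M}].
Proof.
move=> hp hu exl hN hi; case/splitPl: hi hp hu exl hN => p1 p2 lp1.
rewrite last_cat lp1 cat_path lp1 => /andP[hp1 hp2]; rewrite -cat_cons => hu exl hN il.
have [u1 u2 u12] := uniq_catP _ _ hu.
have hh : has (e x) p2.
  apply/hasP; exists (last i p2) => //.
  by have := mem_last i p2; rewrite inE eq_sym (negbTE il).
case: {-}_ / (split_find hh) (hh) hp2 hu exl hN il u2 u12 => z m1 m2 exz /hasPn hm _.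
rewrite cat_path last_cat rcons_path last_rcons => /andP[_ hm2] hu exl hN il u2 u12.
have [q [hq1 hq2 hq3 hq4]] := rev_upath hp1 u1; rewrite lp1 in hq1 hq2 hq3 hq4.
exists (q ++ z :: m2).
rewrite cat_path hq1 hq2 /= exz hm2 last_cat; split=> //.
- rewrite -[_ && _]/(uniq ((i :: q) ++ z :: m2)); apply/uniq_catP; split=> //.
    by move: u2; rewrite cat_rcons => /uniq_catP[].
  by move=> w; rewrite hq4 => /u12 h wz; apply: h; rewrite cat_rcons mem_cat wz orbT.
- move=> w; rewrite cat_rcons -(cat_cons i) -(cat_cons x) !(mem_cat w (_ :: _)) hq4.
  by case/orP=> [->//|]; rewrite mem_cat => ->; rewrite !orbT.
move=> w; rewrite -cat_cons mem_cat hq4 => /setU1P[->|wN]; first by rewrite mem_head.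
have := hN w wN; rewrite cat_rcons !mem_cat => /or3P[->//|/hm|->]; rewrite ?orbT //.
by move: wN; rewrite inE => ->.
Qed.

Lemma lollipop_rev z p i : path e z p -> uniq (z :: p) -> e (last z p) z ->
  {subset nbhd e (last z p) <= z :: p} -> i \in z :: p -> i != z ->
  exists M, [/\ path e z M, last z M = i, uniq (z :: M),
    {subset z :: M <= z :: p} & {subset last z p |: nbhd e (last z p) <= z :: M}].
Proof.
move=> hp hu ez hN hi iz.
have [q [hq1 hq2 hq3 hq4]] := rev_upath hp hu.
have [||||M [h1 h2 h3 h4 h5]] := @lollipop _ q i hq1 hq3; rewrite ?hq2 //.
- by move=> w /hN; rewrite hq4.
- by rewrite hq4.
have [q' [g1 g2 g3 g4]] := rev_upath h1 h3; rewrite h2 hq2 in g1 g2 g3 g4.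
exists q'; split=> //; first by move=> w; rewrite g4 => /h4; rewrite hq4.
by move=> w /h5; rewrite g4.
Qed.

Lemma theta_cycle L R x1 q1 x2 q2 M1 M2 :
  path e x2 M1 -> last x2 M1 = x1 -> uniq (x2 :: M1) -> {subset x2 :: M1 <= L} ->
  path e (last x1 q1) M2 -> last (last x1 q1) M2 = last x2 q2 ->
  uniq (last x1 q1 :: M2) -> {subset last x1 q1 :: M2 <= R} ->
  path e x1 q1 -> path e x2 q2 -> uniq ((x1 :: q1) ++ (x2 :: q2)) ->
  (forall z, z \in q1 ++ q2 -> z \notin L) ->
  (forall z, z \in (x1 :: q1) ++ (x2 :: q2) -> z \in R ->
         z = last x1 q1 \/ z = last x2 q2) ->
  (forall z, z \in L -> z \in R -> z = last x1 q1) ->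
  exists c, [/\ cycle e c, uniq c & {subset (x2 :: M1) ++ (last x1 q1 :: M2) <= c}].
Proof.
move=> hM1 lM1 uM1 M1L hM2 lM2 uM2 M2R hq1 hq2 hu hN hI hLR.
have [u1 u2 u12] := uniq_catP _ _ hu.
have x12 : x1 != x2.
  by apply/eqP => h; apply: (u12 x1); rewrite ?mem_head // h mem_head.
set b := last x1 q1 in hM2 lM2 uM2 M2R hI hLR *.
have b1 : b \in x1 :: q1 by apply: mem_last.
have [/andP[x2M uM1'] /andP[bM2 uM2']] := (uM1, uM2).
have x1M : x1 \in M1.
  by have := mem_last x2 M1; rewrite lM1 inE (negbTE x12).
have uq2 : uniq (rcons (belast x2 q2) (last x2 q2)) by rewrite -lastI.
have sq2 z : z \in belast x2 q2 -> z \in x2 :: q2 by rewrite lastI mem_rcons inE => ->; rewrite orbT.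
have q2L z : z \in belast x2 q2 -> z \in L -> z = x2.
  move=> /sq2; rewrite inE => /predU1P[//|zq] zL.
  by move: (hN z); rewrite mem_cat zq orbT zL => /(_ isT).
pose c := M1 ++ q1 ++ M2 ++ rev (belast x2 q2).
have hc : path e x2 c.
  rewrite !cat_path hM1 lM1 hq1 -/b hM2 lM2 /=.
  by rewrite rev_path (eq_path (e' := e)).
have lc : last x2 c = x2.
  rewrite !last_cat lM1 -/b lM2; case: (q2) => //= w q.
  by rewrite rev_cons last_rcons.
have x2c : x2 \in c.
  have h s : s != [::] -> last x2 s \in s by case: s => //= y s _; apply: mem_last.
  by rewrite -{1}lc; apply: h; rewrite /c; case: (M1) x1M.
exists c; split.
- by rewrite (cycle_path x2) lc.
- apply/uniq_catP; split=> //; last first.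
    move=> z z1; rewrite !mem_cat mem_rev => /or3P[zq|z2|zr].
    + by move: (hN z); rewrite mem_cat zq M1L ?inE ?z1 ?orbT // => /(_ isT).
    + have zb : z = b by apply: hLR; [apply: M1L|apply: M2R]; rewrite inE ?z1 ?z2 orbT.
      by rewrite -zb z2 in bM2.
    have zx : z = x2 by apply: q2L => //; apply: M1L; rewrite inE z1 orbT.
    by rewrite -zx z1 in x2M.
  apply/uniq_catP; split; first by case/andP: u1.
    apply/uniq_catP; split=> //.
      by rewrite rev_uniq; move: uq2; rewrite rcons_uniq => /andP[].
    move=> z z2; rewrite mem_rev => zr.
    have [||zb|zl] := hI z.
    + by rewrite mem_cat (sq2 z zr) orbT.
    + by apply: M2R; rewrite inE z2 orbT.
    + by rewrite -zb z2 in bM2.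
    by move: uq2; rewrite rcons_uniq -zl zr.
  move=> z zq; rewrite mem_cat mem_rev => /orP[z2|/sq2]; last by apply: u12; rewrite inE zq orbT.
  have z1 : z \in x1 :: q1 by rewrite inE zq orbT.
  have [||zb|zl] := hI z.
  + by rewrite mem_cat z1.
  + by apply: M2R; rewrite inE z2 orbT.
  + by rewrite -zb z2 in bM2.
  by apply: (u12 z z1); rewrite zl mem_last.
move=> z; rewrite mem_cat !inE -!orbA => /or4P[/eqP->//|z1|/eqP->|z2].
- by rewrite mem_cat z1.
- move: b1; rewrite inE => /predU1P[->|h]; first by rewrite mem_cat x1M.
  by rewrite !mem_cat h orbT.
by rewrite !mem_cat z2 !orbT.
Qed.
End Theta.

Section LongestPath.
Variables (T : finType) (e : rel T) (k : nat).
Hypotheses (es : symmetric e) (ei : irreflexive e).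
Hypothesis nolong : forall c, 3 <= size c -> ucycle e c -> size c < k.
Hypothesis nonsep : forall v x y, x \in support e -> y \in support e ->
  x != v -> y != v -> connect (del e [set v]) x y.
Hypothesis k3 : 3 < k.
Hypothesis k_sup : k <= #|support e|.
Implicit Types (L R X S : {set T}) (x y z : T) (p q s c : seq T).

Definition longest s := [/\ sorted e s, uniq s &
  forall s', sorted e s' -> uniq s' -> size s' <= size s].

Lemma connect_leave x y c : connect e x y -> x \in c -> y \notin c ->
  exists z z', [/\ z \in c, z' \notin c & e z z'].
Proof.
case/connectP=> p hp -> {y}; elim: p x hp => [|y p IH] x /=; first by move=> _ ->.
case/andP=> exy hp xc; have [yc|yc] := boolP (y \in c); first exact: IH.
by exists x, y.
Qed.

Lemma connect_support x y : x \in support e -> y \in support e -> connect e x y.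
Proof.
move=> xs ys; have : 0 < #|support e :\ x :\ y|.
  have := cardsD1 x (support e); have := cardsD1 y (support e :\ x); lia.
case/card_gt0P => v; rewrite !inE => /and3P[vy vx _].
have /connect_sub : subrel (del e [set v]) (connect e).
  by move=> a b /del_subrel; apply: connect1.
by apply; apply: nonsep; rewrite // eq_sym.
Qed.

Lemma no_longest_cycle c s : longest s -> cycle e c -> uniq c -> size c = size s ->
  2 < size c -> False.
Proof.
move=> [_ _ hs] hc uc sc c3.
have ck : size c < k by apply: nolong => //; apply/andP.
have cs z : z \in c -> z \in support e.
  by move=> zc; apply/supportP; exists (next c z); apply: next_cycle.
have [u us uc'] : exists2 u, u \in support e & u \notin c.
  apply/subsetPn; apply/negP => /subset_leq_card h.
  by have := leq_trans h (card_size c); lia.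
have [x xc] : exists x, x \in c by case: (c) c3 => // x ? _; exists x; rewrite mem_head.
have [z [z' [zc z'c ezz']]] := connect_leave (connect_support (cs x xc) us) xc uc'.
case/rot_to: zc => i c' hr.
have uc2 : uniq (z :: c') by rewrite -hr rot_uniq.
have pc2 : path e z c'.
  by have := hc; rewrite -(rot_cycle i) hr /= rcons_path => /andP[].
have szc : size c = (size c').+1 by rewrite -(size_rot i) hr.
have hs' : sorted e (z' :: z :: c') by rewrite /= es ezz' pc2.
have hu' : uniq (z' :: z :: c') by rewrite cons_uniq uc2 andbT -hr mem_rot.
by have /= := hs _ hs' hu'; rewrite -sc szc ltnn.
Qed.

Lemma longest_rev s : longest s -> longest (rev s).
Proof.
move=> [h1 h2 h3]; split; rewrite ?rev_uniq ?size_rev //.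
by rewrite rev_sorted (eq_sorted (e' := e)).
Qed.

Lemma longest_nbhd x p : longest (x :: p) -> {subset nbhd e x <= x :: p}.
Proof.
move=> [h1 h2 h3] y; rewrite inE => exy; apply/negPn/negP => yp.
have := h3 (y :: x :: p); rewrite /= es exy yp /= -[_ && uniq p]/(uniq (x :: p)) h2.
by move: h1 => /= -> /(_ isT isT); rewrite ltnn.
Qed.

Lemma longest_nbhd_last x p : longest (x :: p) -> {subset nbhd e (last x p) <= x :: p}.
Proof.
move=> /longest_rev h y; move: h; rewrite [x :: p]lastI rev_rcons => /longest_nbhd h /h.
by rewrite -rev_rcons mem_rev.
Qed.

Lemma card_nbhd_count x s : uniq s -> {subset nbhd e x <= s} ->
  #|nbhd e x| = count (e x) s.
Proof.
move=> us hN; rewrite -size_filter -(card_uniqP (filter_uniq (e x) us)).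
apply: eq_card => y; rewrite mem_filter !inE; case exy: (e x y) => //=.
by rewrite hN // inE.
Qed.

Lemma count_nth (a : pred T) x s : count a s = \sum_(0 <= i < size s) a (nth x s i).
Proof. by rewrite -sum1_count big_mkcond (big_nth x); apply: eq_bigr => i _; case: (a _). Qed.

Lemma longest_deg x p : longest (x :: p) ->
  #|nbhd e x| <= size p /\ #|nbhd e (last x p)| <= size p.
Proof.
move=> hl; split.
  apply: leq_trans (card_size p); apply/subset_leq_card/subsetP => z zN.
  have := longest_nbhd hl zN; rewrite inE => /predU1P[zx|//].
  by move: zN; rewrite zx inE ei.
rewrite -(size_belast x p); apply: leq_trans (card_size _).
apply/subset_leq_card/subsetP => z zN; have := longest_nbhd_last hl zN.
rewrite lastI mem_rcons inE => /predU1P[zy|//].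
by move: zN; rewrite zy inE ei.
Qed.

(* Choose a crossing i < j with j - i minimal: the segments up to i and from j on
   form a cycle.  By minimality no position is at once just before a neighbour
   of x and itself a neighbour of the last vertex, and no position strictly
   between i and j - 1 is either of the two. *)
Lemma crossing_bound x p : longest (x :: p) ->
  (exists i j, [/\ i < j < size (x :: p), e x (nth x (x :: p) j) &
     e (last x p) (nth x (x :: p) i)]) ->
  #|nbhd e x| + #|nbhd e (last x p)| < k.
Proof.
move=> hl; set s := x :: p; set y := last x p => -[i0 [j0 [/andP[ij0 j0p] ex0 ey0]]].
have [hs us hmax] := hl.
have ssz : size s = (size p).+1 by [].
pose P n := (0 < n) && [exists i : 'I_(size s), [&& i + n < size s, e x (nth x s (i + n)) & e y (nth x s i)]].
have hP : exists n, P n.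
  exists (j0 - i0); rewrite /P subn_gt0 ij0; apply/existsP.
  by exists (Ordinal (ltn_trans ij0 j0p)); rewrite /= subnKC ?j0p ?ex0 // ltnW.
have [n /andP[n0 /existsP[[i ip] /= /and3P[jp exj eyi]]] hmin] := ex_minnP hP.
have [j ej] : exists j, j = i + n by exists (i + n).
rewrite -ej in jp exj.
have noc a b : a < b -> b < size s -> b - a < n -> e x (nth x s b) -> e y (nth x s a) -> False.
  move=> ab bs hn eb ea; have : P (b - a).
    rewrite /P subn_gt0 ab; apply/existsP.
    by exists (Ordinal (ltn_trans ab bs)); rewrite /= subnKC ?bs ?eb // ltnW.
  by move/hmin; rewrite leqNgt hn.
rewrite ltnNge; apply/negP => hk.
have s3 : 2 < size s.
  by have [hx hy] := longest_deg hl; have := leq_trans hk (leq_add hx hy); lia.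
have yE : y = nth x s (size s).-1 by rewrite nth_last.
pose c := take i.+1 s ++ rev (drop j s).
have sc : size c = (size s - n).+1.
  rewrite size_cat size_rev size_drop size_takel //; lia.
have uc : uniq c.
  rewrite /c; apply/uniq_catP; rewrite rev_uniq take_uniq ?drop_uniq //; split=> // z.
  move=> z1; rewrite mem_rev => z2.
  have /uniq_catP[_ _ /(_ z)] : uniq (take j s ++ drop j s) by rewrite cat_take_drop.
  apply=> //.
  by rewrite -(take_takel s (_ : i.+1 <= j)) in z1; [exact: mem_take z1 | lia].
have hc : cycle e c.
  have e1 : take i.+1 s = x :: take i p by [].
  have l1 : last x (take i p) = nth x s i.
    by rewrite -[LHS]/(last x (x :: take i p)) -e1 (take_nth x ip) last_rcons.
  have e2 : drop j s = nth x s j :: drop j.+1 s by rewrite (drop_nth x).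
  have l2 : last (nth x s j) (drop j.+1 s) = y.
    by have : last x s = y by []; rewrite -{1}(cat_take_drop j s) last_cat e2.
  have p1 : path e x (take i p) by rewrite -[path _ _ _]/(sorted e (take i.+1 s)) take_sorted.
  have p2 : path e (nth x s j) (drop j.+1 s).
    by rewrite -[path _ _ _]/(sorted e (nth x s j :: drop j.+1 s)) -e2 drop_sorted.
  have r2 : rev (drop j s) = y :: rev (belast (nth x s j) (drop j.+1 s)).
    by rewrite e2 lastI rev_rcons l2.
  have p2' : path e y (rev (belast (nth x s j) (drop j.+1 s))).
    by rewrite -l2 rev_path (eq_path (e' := e)).
  have l3 : last y (rev (belast (nth x s j) (drop j.+1 s))) = nth x s j.
    rewrite -[LHS]/(last y (y :: rev (belast (nth x s j) (drop j.+1 s)))) -r2 e2.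
    by rewrite rev_cons last_rcons.
  rewrite /c e1 r2 /= rcons_path cat_path p1 l1 last_cat /= l3.
  by rewrite es eyi p2' /= es.
suff : #|nbhd e x| + #|nbhd e y| <= (size s - n).+1.
  rewrite -sc => hdeg.
  have hkc := leq_trans hk hdeg.
  have : size c < k by apply: nolong; [exact: leq_trans (ltnW k3) hkc | apply/andP].
  by rewrite ltnNge hkc.
rewrite (card_nbhd_count us (longest_nbhd hl)) (card_nbhd_count us (longest_nbhd_last hl)) -/s -/y.
rewrite !(count_nth _ x).
have -> : \sum_(0 <= l < size s) e x (nth x s l) = \sum_(0 <= l < (size s).-1) e x (nth x s l.+1).
  by rewrite big_nat_recl //= ei.
have -> : \sum_(0 <= l < size s) e y (nth x s l) = \sum_(0 <= l < (size s).-1) e y (nth x s l).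
  by rewrite -[size s]/(size p).+1 big_nat_recr //= -/s [nth x s _](_ : _ = y) ?ei ?addn0 // yE.
have [n1|n1] := leqP n 1.
  by exfalso; apply: (no_longest_cycle hl hc uc); rewrite sc -/s; move: n0 n1 s3; clear; lia.
have [N eN] : exists N, N = (size s).-1 by exists (size s).-1.
pose f l : nat := e x (nth x s l.+1) + e y (nth x s l).
have -> : \sum_(0 <= l < (size s).-1) e x (nth x s l.+1) + \sum_(0 <= l < (size s).-1) e y (nth x s l)
  = \sum_(0 <= l < N) f l by rewrite eN -big_split.
have ub l : l < N -> f l <= 1.
  move=> hl1; rewrite /f; case a: (e x _) => //; case b: (e y _) => //.
  by case: (@noc l l.+1) => //; move: hl1 eN n1 ssz; clear; lia.
have ub0 l : i.+1 <= l < j.-1 -> f l = 0.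
  move=> /andP[il lj]; have h1 : e x (nth x s l.+1) = false.
    by apply/negP => h; apply: (@noc i l.+1) => //; move: il lj ej jp ssz n0; clear; lia.
  have h2 : e y (nth x s l) = false.
    by apply/negP => h; apply: (@noc l j) => //; move: il lj ej jp ssz n0; clear; lia.
  by rewrite /f h1 h2.
have le1 a b : b <= N -> \sum_(a <= l < b) f l <= b - a.
  move=> hb; rewrite -[X in _ <= X]muln1 -sum_nat_const_nat big_nat_cond [X in _ <= X]big_nat_cond.
  by apply: leq_sum => l /andP[/andP[_ lb] _]; apply: ub; apply: leq_trans hb.
have z0 : \sum_(i.+1 <= l < j.-1) f l = 0.
  by rewrite big_nat_cond big1 // => l /andP[/ub0].
have iN : i.+1 <= N by move: eN jp ej n1 ssz; clear; lia.
have jN : i.+1 <= j.-1 <= N by move: eN jp ej n1 ssz; clear; lia.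
case/andP: jN => ij jN.
rewrite (@big_cat_nat _ _ _ i.+1) //=.
rewrite (@big_cat_nat _ _ _ j.-1 i.+1) //=.
rewrite z0; have := le1 0 i.+1 iN; have := le1 j.-1 N (leqnn N).
by move: (\sum_(_ <= l < N) _) (\sum_(0 <= l < _) _); move: eN jp ej n1 ssz; clear; lia.
Qed.

(* If the neighbourhoods of the ends do not cross, two disjoint paths between the
   stretches of the path which they span give a cycle through both ends and all
   their neighbours. *)
Lemma longest_ends x p : longest (x :: p) -> #|nbhd e x| + #|nbhd e (last x p)| < k.
Proof.
move=> hl; set s := x :: p; set y := last x p.
have [/existsP[[i j] /= /and3P[ij exj eyi]]|nc0] := boolP [exists ij : 'I_(size s) * 'I_(size s),
    [&& ij.1 < ij.2, e x (nth x s ij.2) & e y (nth x s ij.1)]].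
  by apply: crossing_bound => //; exists i, j; rewrite ij exj eyi ltn_ord.
have nc i j : i < size s -> j < size s -> e x (nth x s j) -> e y (nth x s i) -> j <= i.
  move=> hi hj exj eyi; rewrite leqNgt; apply: contraNN nc0 => ij.
  by apply/existsP; exists (Ordinal hi, Ordinal hj); rewrite /= ij exj.
rewrite ltnNge; apply/negP => hk.
have [hs us hmax] := hl.
have Nx := longest_nbhd hl; have Ny := longest_nbhd_last hl.
have ssz : size s = (size p).+1 by [].
have p2 : 1 < size p.
  by have [hx hy] := longest_deg hl; have := leq_trans hk (leq_add hx hy); lia.
have ys : y \in s by apply: mem_last.
have iy : index y s = size p by apply: index_last.
have hA : exists j, (j < size s) && e x (nth x s j).
  by exists 1; rewrite /s; case: (p) hs p2 => [|v p'] //= /andP[-> _].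
have hB : exists i, (i < size s) && e y (nth x s i).
  have e1 : (size p).-1.+1 = size p by rewrite prednK // ltnW.
  have /(sortedP x)/(_ (size p).-1) := hs; rewrite -/s e1 => /(_ (ltnSn _)).
  rewrite -{2}iy nth_index // es => h; exists (size p).-1; rewrite h andbT ssz.
  by rewrite ltnS leq_pred.
have [a /andP[as_ exa] amax] := ex_maxnP hA (fun j h => ltnW (proj1 (andP h))).
have [b /andP[bs eyb] bmin] := ex_minnP hB.
have ab : a <= b by apply: nc.
set va := nth x s a in exa; set vb := nth x s b in eyb.
pose L := [set z in take a.+1 s]; pose R := [set z in drop b s].
have mL z : z \in s -> (z \in L) = (index z s <= a).
  by move=> zs; rewrite inE in_take.
have Ls z : z \in L -> z \in s by rewrite inE => /mem_take.
have Rs z : z \in R -> z \in s by rewrite inE => /mem_drop.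
have mR z : z \in s -> (z \in R) = (b <= index z s).
  move=> zs; rewrite inE leqNgt -in_take //.
  have /uniq_catP[_ _ h] : uniq (take b s ++ drop b s) by rewrite cat_take_drop.
  apply/idP/negP => [zd zt|/negP zt]; first exact: (h z).
  by have := zs; rewrite -{1}(cat_take_drop b s) mem_cat (negbTE zt).
have iva : index va s = a by apply: index_uniq.
have ivb : index vb s = b by apply: index_uniq.
have vas : va \in s by apply: mem_nth.
have vbs : vb \in s by apply: mem_nth.
have LR z : z \in L -> z \in R -> z = vb.
  move=> zL zR; have zs := Ls z zL; move: zL zR; rewrite mL ?mR // => h1 h2.
  by rewrite -(nth_index x zs) /vb; congr nth; apply/eqP; rewrite eqn_leq h2 (leq_trans h1 ab).
have NxL : {subset x |: nbhd e x <= L}.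
  move=> z /setU1P[->|zN]; first by rewrite inE mem_head.
  have zs := Nx z zN; rewrite mL //; apply: amax.
  by rewrite index_mem zs nth_index //; rewrite inE in zN.
have NyR : {subset y |: nbhd e y <= R}.
  move=> z /setU1P[->|zN]; first by rewrite mR // iy -ltnS -ssz.
  have zs := Ny z zN; rewrite mR //; apply: bmin.
  by rewrite index_mem zs nth_index //; rewrite inE in zN.
have vaL : va \in L by rewrite NxL // !inE exa orbT.
have vbR : vb \in R by rewrite NyR // !inE eyb orbT.
pose q := drop a.+1 (take b.+1 s).
have e1 : va :: q = drop a (take b.+1 s).
  by rewrite (drop_nth x) ?nth_take // size_takel.
have e2 : va :: q = rcons (drop a (take b s)) vb.
  by rewrite e1 (take_nth x bs) drop_rcons // size_take bs.
have lq : last va q = vb by rewrite -[LHS]/(last x (va :: q)) e2 last_rcons.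
have pq : path e va q by rewrite -[path _ _ _]/(sorted e (va :: q)) e1 drop_sorted // take_sorted.
have uq : uniq (va :: q) by rewrite e1 drop_uniq // take_uniq.
have qL z : z \in q -> z \notin L.
  move=> zq; rewrite inE; apply/negP => zt.
  have /uniq_catP[_ _ h] : uniq (take a.+1 (take b.+1 s) ++ drop a.+1 (take b.+1 s)).
    by rewrite cat_take_drop take_uniq.
  by apply: (h z) => //; rewrite take_takel.
have qR z : z \in va :: q -> z \in R -> z = last va q.
  rewrite lq e2 mem_rcons inE => /predU1P[//|/mem_drop zt]; rewrite inE => zd.
  have /uniq_catP[_ _ h] : uniq (take b s ++ drop b s) by rewrite cat_take_drop.
  by case: (h z).
have supp z z' : e z z' -> z \in support e by move=> ezz'; apply/supportP; exists z'.
have cut v : exists z z', [/\ z \in L, z' \in R, z != v, z' != v & connect (del e [set v]) z z'].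
  have [z [zL zv zs]] : exists z, [/\ z \in L, z != v & z \in support e].
    have [xv|xv] := eqVneq x v; last by exists x; rewrite NxL ?setU11 // (supp x va).
    exists va; rewrite vaL (supp va x) 1?es // -xv; split=> //.
    by apply: contraTneq exa => ->; rewrite ei.
  have [z' [z'R z'v z's]] : exists z, [/\ z \in R, z != v & z \in support e].
    have [yv|yv] := eqVneq y v; last by exists y; rewrite NyR ?setU11 // (supp y vb).
    exists vb; rewrite vbR (supp vb y) 1?es // -yv; split=> //.
    by apply: contraTneq eyb => ->; rewrite ei.
  by exists z, z'; split=> //; apply: nonsep.
have [x1 [q1 [x2 [q2 [[h1 h2 h3 x1L x2L] [ha l1 l2 hN hI]]]]]] :=
  vine pq uq vaL (etrans (congr1 (mem R) lq) vbR) qL qR cut.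
have [u1 u2 u12] := uniq_catP _ _ h3.
rewrite lq in l1.
have x12 : x1 != x2 by apply/eqP => h; apply: (u12 x1); rewrite ?mem_head // h mem_head.
have tk : take a.+1 s = x :: take a p by [].
have ltk : last x (take a p) = va.
  by rewrite -[LHS]/(last x (take a.+1 s)) (take_nth x as_) last_rcons.
have ptk : path e x (take a p) by rewrite -[path _ _ _]/(sorted e (take a.+1 s)) take_sorted.
have utk : uniq (x :: take a p) by rewrite -tk take_uniq.
have left i : i \in L -> i != va -> exists M, [/\ path e i M, last i M = va, uniq (i :: M),
    {subset i :: M <= L} & {subset x |: nbhd e x <= i :: M}].
  move=> iL iva'.
  have exl : e x (last x (take a p)) by rewrite ltk.
  have hNl : {subset nbhd e x <= x :: take a p}.
    by move=> z zN; have := NxL z; rewrite !inE => ->; rewrite // inE in zN; rewrite zN orbT.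
  have il : i \in x :: take a p by move: iL; rewrite inE.
  have ine : i != last x (take a p) by rewrite ltk.
  have [M [g1 g2 g3 g4 g5]] := lollipop es ptk utk exl hNl il ine.
  by rewrite ltk in g2; exists M; split=> // z /g4 h; rewrite in_set tk.
have [M1 [m1 m2 m3 m4 m5]] : exists M, [/\ path e x2 M, last x2 M = x1, uniq (x2 :: M),
    {subset x2 :: M <= L} & {subset x |: nbhd e x <= x2 :: M}].
  case: ha => ha.
    by rewrite -ha; apply: left => //; rewrite ha eq_sym.
  have [|M [g1 g2 g3 g4 g5]] := left x1 x1L; first by rewrite ha.
  have [M' [f1 f2 f3 f4]] := rev_upath es g1 g3; rewrite g2 ha in f1 f2 f3 f4.
  exists M'; split=> //; first by move=> z; rewrite f4; apply: g4.
  by move=> z /g5; rewrite f4.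
have dr : drop b s = vb :: drop b.+1 s by rewrite (drop_nth x).
have ldr : last vb (drop b.+1 s) = y.
  by have : last x s = y by []; rewrite -{1}(cat_take_drop b s) last_cat dr.
have pdr : path e vb (drop b.+1 s).
  by rewrite -[path _ _ _]/(sorted e (vb :: drop b.+1 s)) -dr drop_sorted.
have udr : uniq (vb :: drop b.+1 s) by rewrite -dr drop_uniq.
have eyl : e (last vb (drop b.+1 s)) vb by rewrite ldr.
have hNr : {subset nbhd e (last vb (drop b.+1 s)) <= vb :: drop b.+1 s}.
  move=> z; rewrite ldr -dr => zN; have := NyR z; rewrite [z \in _ |: _]inE zN orbT.
  by rewrite inE => ->.
have E2r : last x2 q2 \in vb :: drop b.+1 s by move: l2; rewrite -dr inE.
have E2n : last x2 q2 != vb.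
  by apply/eqP => h; apply: (u12 vb); [rewrite -l1 mem_last | rewrite -h mem_last].
have [M2 [n1 n2 n3 n4 n5]] := lollipop_rev es pdr udr eyl hNr E2r E2n.
rewrite ldr in n5.
have M2R : {subset last x1 q1 :: M2 <= R} by move=> z; rewrite l1 => /n4; rewrite -dr inE.
have hLR z : z \in L -> z \in R -> z = last x1 q1 by rewrite l1; apply: LR.
rewrite -l1 in n1 n2 n3 n5.
have [c [c1 c2 c3]] := theta_cycle es m1 m2 m3 m4 n1 n2 n3 M2R h1 h2 h3 hN hI hLR.
have sub : (x |: nbhd e x) :|: (y |: nbhd e y) \subset c.
  apply/subsetP => z /setUP[/m5|/n5] zm; by apply: c3; rewrite mem_cat zm ?orbT.
have cap : (x |: nbhd e x) :&: (y |: nbhd e y) \subset [set vb].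
  by apply/subsetP => z /setIP[/NxL zL /NyR zR]; rewrite inE (LR z).
have := leq_trans (subset_leq_card sub) (card_size c).
have := subset_leq_card cap; rewrite cards1.
have := cardsUI (x |: nbhd e x) (y |: nbhd e y).
rewrite !cardsU1 !inE !ei /= => hUI hI1 hU.
have kc : k <= size c by move: hUI hI1 hU hk; clear; lia.
have : size c < k by apply: nolong; [exact: leq_trans (ltnW k3) kc | apply/andP].
by rewrite ltnNge kc.
Qed.

Lemma longest_exists : exists x p, 0 < size p /\ longest (x :: p).
Proof.
have [v vs] : exists v, v \in support e by apply/card_gt0P; lia.
have [y evy] := supportP _ _ vs.
pose P n := [exists s : n.-tuple T, sorted e s && uniq s].
have P2 : P 2.
  apply/existsP; exists [tuple v; y]; rewrite /= evy inE /= andbT.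
  by apply: contraTneq evy => ->; rewrite ei.
have Ple n : P n -> n <= #|T|.
  by case/existsP=> s /andP[_ /card_uniqP us]; rewrite -(size_tuple s) -us max_card.
have [n /existsP[s /andP[hs us]] hmax] := ex_maxnP (ex_intro _ 2 P2) Ple.
have n2 := hmax 2 P2; have szs := size_tuple s.
case E : (tval s) hs us szs => [|x p] hs us szs; first by move: n2; rewrite -szs.
exists x, p; split; first by move: n2; rewrite -szs.
split=> // s' hs' us'; rewrite szs; apply: hmax.
by apply/existsP; exists (in_tuple s'); rewrite hs' us'.
Qed.

(* Fix the end y of a longest path, of large degree if possible, and rotate at the
   neighbours of the other end. *)
Lemma low_degree_set : exists (S : {set T}) v, [/\ v \in support e,
  #|nbhd e v| <= #|S| & forall x, x \in S -> x \in support e /\ #|nbhd e x| <= k.-1./2].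
Proof.
have [x0 [p0 [p00 hl0]]] := longest_exists.
pose n := size (x0 :: p0).
have big0 : exists y x p, [/\ 0 < size p, longest (x :: p) & last x p = y /\
    (forall u q, longest (u :: q) -> last u q = y -> size q = size p -> #|nbhd e u| <= k.-1./2)].
  have [/existsP[s /and3P[hs us big]]|nb] := boolP [exists s : n.-tuple T,
      [&& sorted e s, uniq s & k.-1./2 < #|nbhd e (last x0 s)|]].
    have szs := size_tuple s; case E : (tval s) hs us szs big => [//|x p] hs us szs big.
    have hl : longest (x :: p).
      by case: hl0 => _ _ h; split=> // s' h1 h2; rewrite szs; apply: h.
    exists (last x p), x, p; split=> //; first by case: szs => ->.
    split=> // u q /longest_ends h e1 _; move: h; rewrite e1.
    by move: big => /=; clear; lia.
  exists (last x0 p0), x0, p0; split=> //; split=> // u q hl _ sq.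
  rewrite leqNgt; apply: contraNN nb => big; apply/existsP.
  have sz : size (rev (u :: q)) == n by rewrite size_rev /= sq.
  have [h1 h2 _] := longest_rev hl.
  by exists (Tuple sz); rewrite /= h1 h2 rev_cons last_rcons.
have [y [x [p [p_gt0 hl hy]]]] := big0.
have [hyl hlow] := hy; have [hs us hmax] := hl; have Nx := longest_nbhd hl.
set s := x :: p in hs us hmax Nx hl.
pose prev w := nth x s (index w s).-1.
have iN w : w \in nbhd e x -> 0 < index w s < size s.
  move=> wN; rewrite index_mem Nx // lt0n andbT; apply/eqP => h.
  have := nth_index x (Nx w wN); rewrite h /= => xw.
  by move: wN; rewrite -xw inE ei.
exists (prev @: nbhd e x), x; split.
- by apply/supportP; exists (head x p); move: hs; rewrite /s; case: (p) p_gt0 => //= u q _ /andP[].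
- rewrite card_in_imset // => w1 w2 h1 h2 /eqP.
  have /andP[i1 i1s] := iN w1 h1; have /andP[i2 i2s] := iN w2 h2.
  rewrite nth_uniq // ?(leq_ltn_trans (leq_pred _)) // => /eqP h.
  have h' : index w1 s = index w2 s by move: i1 i2 h; clear; lia.
  by rewrite -(nth_index x (Nx w1 h1)) h' nth_index // Nx.
move=> u /imsetP[w wN ->]; have /andP[i0 is_] := iN w wN.
set i := (index w s).-1; have ei1 : index w s = i.+1 by rewrite /i prednK.
have di : drop i.+1 s = w :: drop i.+2 s.
  by rewrite (drop_nth x) -?ei1 ?nth_index ?Nx.
have ti : take i.+1 s = rcons (take i s) (prev w).
  by rewrite (take_nth x) // /i prednK //; lia.
have es_ : s = take i.+1 s ++ w :: drop i.+2 s by rewrite -di cat_take_drop.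
pose q := rev (take i s) ++ w :: drop i.+2 s.
have hq : prev w :: q = rev (take i.+1 s) ++ w :: drop i.+2 s by rewrite ti rev_rcons.
have pq : perm_eq (prev w :: q) s.
  by rewrite hq [in X in perm_eq _ X]es_ perm_cat2r perm_rev.
have sq : size q = size p by have := perm_size pq => -[].
split.
  apply/supportP; exists (nth x s i.+1).
  by apply: (sortedP x hs); rewrite -ei1.
apply: (hlow _ q) => //; last first.
  by rewrite -hyl last_cat /=; have : last x s = last x p by []; rewrite {1}es_ last_cat /= => ->.
split; [|by rewrite (perm_uniq pq)|by move=> s' h1 h2; rewrite /= sq; apply: hmax].
have hsr : sorted e (rev (take i.+1 s)) by rewrite rev_sorted (eq_sorted (e' := e)) // take_sorted.
have hsd : sorted e (w :: drop i.+2 s) by rewrite -di drop_sorted.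
have exw : e x w by move: wN; rewrite inE.
have tr : rev (take i.+1 s) = rcons (rev (take i p)) x by rewrite /s /= rev_cons.
by rewrite hq tr cat_rcons sorted_cat_cons -tr hsr /= exw.
Qed.

End LongestPath.

(** * Clique blocks *)

Section StrictBound.
Variable T : finType.
Implicit Types (e : rel T) (A B C S : {set T}) (x y z v : T).

Definition circumference_lt k e :=
  forall c, 3 <= size c -> ucycle e c -> size c < k.

Lemma subrel_circumference k e e' : subrel e' e ->
  circumference_lt k e -> circumference_lt k e'.
Proof.
move=> sub h c c3 /andP[hc uc]; apply: h => //; apply/andP; split=> //.
by case: c hc {c3 uc} => //= x p; apply: sub_path.
Qed.

Lemma edges_support e : symmetric e -> irreflexive e ->
  kcliques e 2 \subset [set A : {set T} | A \subset support e & #|A| == 2].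
Proof.
move=> es ei; apply/subsetP => A hA; have [cA _] := kcliquesP _ _ _ hA.
rewrite inE cA eqxx andbT; case/(kcliques2P _ es ei): hA => x [y [exy ->]].
apply/subsetP => z /set2P[]->; apply/supportP; first by exists y.
by exists x; rewrite es.
Qed.

Lemma small_support_clique e k : symmetric e -> irreflexive e -> 1 < k ->
  #|support e| <= k -> 'C(k, 2) <= #|kcliques e 2| -> support e \in kcliques e k.
Proof.
move=> es ei k1 sk hk; have sub := edges_support es ei.
have h1 := subset_leq_card sub; rewrite cards_draws in h1.
have sE : #|support e| = k.
  apply/eqP; rewrite eqn_leq sk leqNgt; apply/negP => lt.
  by have := @bin_ltn2l 2 #|support e| k; lia.
have E : kcliques e 2 = [set A : {set T} | A \subset support e & #|A| == 2].
  by apply/eqP; rewrite eqEcard sub cards_draws sE.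
apply/kcliquesP; split=> //; apply/cliqueP => x y xs ys xy.
rewrite -(set2_kcliques x y es ei) E inE cards2 xy andbT.
by apply/subsetP => z /set2P[]->.
Qed.

Lemma separation_split e v x y : symmetric e -> irreflexive e ->
  x \in support e -> y \in support e -> x != v -> y != v ->
  ~~ connect (del e [set v]) x y ->
  exists e1 e2 : rel T, [/\ symmetric e1, symmetric e2, subrel e1 e, subrel e2 e &
    [/\ 0 < #|kcliques e1 2|, 0 < #|kcliques e2 2| &
      forall j, 1 < j -> #|kcliques e j| = #|kcliques e1 j| + #|kcliques e2 j|]].
Proof.
move=> es ei xs ys xv yv nxy.
pose C := [set z | connect (del e [set v]) x z].
have vC : v \notin C.
  rewrite inE; apply/negP => /connectP[p hp ev].
  have := mem_last x p; rewrite -ev inE eq_sym (negbTE xv) /=.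
  by move/(del_path_notin hp); rewrite inE eqxx.
have xC : x \in C by rewrite inE connect0.
have step a b : a \in C -> e a b -> b != v -> b \in C.
  move=> aC eab bv; move: (aC); rewrite !inE => /connect_trans; apply; apply: connect1.
  by rewrite /del eab !inE bv andbT /=; apply: contraNneq vC => <-.
pose e1 : rel T := fun a b => e a b && ((a \in C) || (b \in C)).
pose e2 : rel T := fun a b => e a b && ((a \notin C) && (b \notin C)).
have s1 : symmetric e1 by move=> a b; rewrite /e1 es orbC.
have s2 : symmetric e2 by move=> a b; rewrite /e2 es [(a \notin C) && _]andbC.
have sub1 : subrel e1 e by move=> a b /andP[].
have sub2 : subrel e2 e by move=> a b /andP[].
have i1 : irreflexive e1 by move=> a; rewrite /e1 ei.
have i2 : irreflexive e2 by move=> a; rewrite /e2 ei.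
exists e1, e2; split=> //; split.
- have [x' exx'] := supportP _ _ xs; apply/card_gt0P; exists [set x; x'].
  by rewrite set2_kcliques // /e1 exx' xC.
- have [y' eyy'] := supportP _ _ ys; apply/card_gt0P; exists [set y; y'].
  have yC : y \notin C by rewrite inE.
  rewrite set2_kcliques // /e2 eyy' yC /=; apply: contra yC => y'C.
  by apply: (step y') => //; rewrite es.
move=> j j1.
have pair A : #|A| = j -> exists a b, [/\ a \in A, b \in A & a != b].
  by move=> cA; apply/card_gt1P; rewrite cA.
have dis : [disjoint kcliques e1 j & kcliques e2 j].
  rewrite -setI_eq0 -subset0; apply/subsetP => A /setIP[/kcliquesP[cA /cliqueP c1] /kcliquesP[_ /cliqueP c2]].
  have [a [b [aA bA ab]]] := pair A cA.
  have /andP[_ h1] := c1 a b aA bA ab; have /andP[_ /andP[h2 h3]] := c2 a b aA bA ab.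
  by rewrite (negbTE h2) (negbTE h3) in h1.
rewrite -cardsUI (disjoint_setI0 dis) cards0 addn0.
congr #|pred_of_set _|; apply/eqP; rewrite eqEsubset; apply/andP; split.
  apply/subsetP => A /kcliquesP[cA /cliqueP clA]; rewrite inE.
  have [/existsP[a /andP[aA aC]]|hC] := boolP [exists a in A, a \in C].
    apply/orP; left; apply/kcliquesP; split=> //; apply/cliqueP => p q pA qA pq.
    have inC z : z \in A -> z != v -> z \in C.
      by move=> zA zv; have [->//|az] := eqVneq z a; apply: (step a) => //; apply: clA; rewrite // eq_sym.
    rewrite /e1 clA //=; have [pv|pv] := eqVneq p v; last by rewrite inC.
    by rewrite [q \in C]inC ?orbT // -pv eq_sym.
  apply/orP; right; apply/kcliquesP; split=> //; apply/cliqueP => p q pA qA pq.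
  have nC z : z \in A -> z \notin C.
    by move=> zA; apply: contra hC => zC; apply/existsP; exists z; rewrite zA.
  by rewrite /e2 clA // !nC.
by rewrite subUset !subrel_kcliques.
Qed.

Variables w K : nat.
Hypotheses (w_gt0 : 0 < w) (wK : w.+1 < K).
Local Notation f := (extremal_count w K).

(* ds lists the degrees at the moment of deletion. *)
Lemma delete_vertices e l r ss : symmetric e -> irreflexive e -> uniq ss ->
  {in ss, forall x, r <= #|nbhd e x| <= l} ->
  exists (e' : rel T) ds, [/\ symmetric e', irreflexive e', subrel e' e &
   [/\ size ds = size ss, all (fun d => d <= l) ds,
      forall i, i < size ss -> r - i <= nth 0 ds i,
      #|kcliques e 2| = #|kcliques e' 2| + sumn ds &
      #|kcliques e w.+2| <= #|kcliques e' w.+2| + \sum_(d <- ds) 'C(d, w.+1)]].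
Proof.
elim: ss e r => [|x ss IH] e r es ei.
  by move=> _ _; exists e, [::]; split=> //; split=> //=; rewrite ?addn0 // leq_addr.
rewrite cons_uniq => /andP[xss uss] hd.
have [y yss|e' [ds [es' ei' sub [h1 h2 h3 h4 h5]]]] :=
  IH (del e [set x]) r.-1 (del_sym _ es) (del_irr _ ei) uss.
  have yx : y != x by apply: contraNneq xss => <-.
  have := hd y; rewrite inE yss orbT nbhd_del (negbTE yx) => /(_ isT).
  by have := cardsD1 x (nbhd e y); case: (_ \in _); lia.
have /andP[dr dl] := hd x (mem_head _ _).
exists e', (#|nbhd e x| :: ds); split=> //; first by move=> a b /sub /del_subrel.
split=> //=.
- by rewrite h1.
- by rewrite dl h2.
- by move=> [|i] hi /=; rewrite ?subn0 //; have := h3 i hi; lia.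
- by rewrite (card_edges_del x es ei) h4 -addnA [sumn ds + _]addnC.
rewrite (card_kcliques_del x es ei) // big_cons.
by apply: leq_trans (leq_add h5 (card_link_le e x w.+1)) _; rewrite -addnA leq_add2l addnC.
Qed.

Theorem strict_bound e : symmetric e -> irreflexive e -> circumference_lt K.+1 e ->
  kcliques e K = set0 -> 'C(K, 2) <= #|kcliques e 2| ->
  #|kcliques e w.+2| < f #|kcliques e 2|.
Proof.
have D0 : 0 < 'C(K, 2) by rewrite bin_gt0; lia.
have [n] := ubnP #|kcliques e 2|; elim: n e => // n IH e hn es ei hc nK hD.
have free e' : subrel e' e -> kcliques e' K = set0.
  by move=> sub; apply/eqP; rewrite -subset0 -nK subrel_kcliques.
have weak e' : symmetric e' -> irreflexive e' -> subrel e' e ->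
    #|kcliques e' 2| < #|kcliques e 2| -> #|kcliques e' w.+2| <= f #|kcliques e' 2|.
  move=> es' ei' sub lt; have [h|h] := ltnP #|kcliques e' 2| 'C(K, 2).
    rewrite -[in X in _ <= X](add0n #|_|) -(mul0n 'C(K, 2)) extremal_countE ?(ltnW h) //.
    by rewrite mul0n add0n kruskal_katona.
  apply/ltnW/IH => //; [lia|exact: subrel_circumference hc|exact: free].
have strict e' : symmetric e' -> irreflexive e' -> subrel e' e ->
    #|kcliques e' 2| < #|kcliques e 2| -> 'C(K, 2) <= #|kcliques e' 2| ->
    #|kcliques e' w.+2| < f #|kcliques e' 2|.
  move=> es' ei' sub lt h; apply: IH => //; [lia|exact: subrel_circumference hc|exact: free].
have [sK|Ks] := leqP #|support e| K.
  have := small_support_clique es ei _ sK hD.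
  by rewrite nK inE => /(_ _)/negP; case; lia.
have [ns|] := boolP [forall v, forall x in support e, forall y in support e,
    (x != v) ==> (y != v) ==> connect (del e [set v]) x y]; last first.
  case/forallPn => v /forall_inPn[x xs /forall_inPn[y ys]].
  rewrite !negb_imply => /and3P[xv yv nxy].
  have [e1 [e2 [s1 s2 sub1 sub2 [p1 p2 hs]]]] := separation_split es ei xs ys xv yv nxy.
  have i1 : irreflexive e1 by move=> a; apply/negP => /sub1; rewrite ei.
  have i2 : irreflexive e2 by move=> a; apply/negP => /sub2; rewrite ei.
  have em := hs 2 isT; have et := hs w.+2 isT.
  have w1 := weak e1 s1 i1 sub1; have w2 := weak e2 s2 i2 sub2.
  have t1 := strict e1 s1 i1 sub1; have t2 := strict e2 s2 i2 sub2.
  have sup := extremal_count_super w_gt0 wK #|kcliques e1 2| #|kcliques e2 2|.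
  have supl := @extremal_count_super_lt w w_gt0 K wK #|kcliques e1 2| #|kcliques e2 2|.
  rewrite em in w1 w2 t1 t2 hD *; rewrite et.
  move: #|kcliques e1 2| #|kcliques e2 2| #|kcliques e1 w.+2| #|kcliques e2 w.+2| p1 p2 w1 w2 t1 t2 sup supl hD.
  move=> m1 m2 c1 c2 p1 p2 w1 w2 t1 t2 sup supl hD.
  have {}w1 : c1 <= f m1 by apply: w1; lia.
  have {}w2 : c2 <= f m2 by apply: w2; lia.
  have [h1|h1] := ltnP m1 'C(K, 2); last by have := t1 ltac:(lia) h1; move: w2 sup; clear; lia.
  have [h2|h2] := ltnP m2 'C(K, 2); last by have := t2 ltac:(lia) h2; move: w1 sup; clear; lia.
  by have := supl h1 h2 hD; move: w1 w2; clear; lia.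
have nonsep v x y : x \in support e -> y \in support e -> x != v -> y != v ->
    connect (del e [set v]) x y.
  move=> xs ys xv yv; move/forallP/(_ v)/forall_inP/(_ x xs)/forall_inP/(_ y ys): ns.
  by rewrite xv yv.
set m := #|kcliques e 2| in hn hD weak strict *.
have [r [s [eb sr r0]]] := colexW (m %% 'C(K, 2)).
have mdm := divn_eq m 'C(K, 2).
have q0 : 0 < m %/ 'C(K, 2) by rewrite divn_gt0.
have mD : 'C(K, 2) <= m %/ 'C(K, 2) * 'C(K, 2) by rewrite leq_pmull.
have [/existsP[v /andP[vs dv]]|hd] := boolP [exists v in support e, #|nbhd e v| < r].
  have lt := del1_lt_edges es ei vs.
  have s1 := del_sym [set v] es.
  have i1 := del_irr [set v] ei.
  have sub1 := @del_subrel _ e [set v].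
  have hstr := strict _ s1 i1 sub1.
  have hm := card_edges_del v es ei.
  rewrite (card_kcliques_del v es ei) //.
  have hr : 'C(#|nbhd e v|.+1, 2) <= m %% 'C(K, 2).
    by apply: leq_trans (_ : 'C(r, 2) <= _); [apply: leq_bin2l | rewrite eb leq_addr].
  have hmd : 'C(K, 2) <= #|kcliques (del e [set v]) 2|.
    by move: hr hm mD; rewrite bin2S -/m; move: mdm; clear; lia.
  have := extremal_count_del w_gt0 wK hr; have := card_link_le e v w.+1.
  have -> : m - #|nbhd e v| = #|kcliques (del e [set v]) 2| by rewrite /m hm addnK.
  by have := hstr lt hmd; clear; lia.
have [S [v [vs vS hS]]] := low_degree_set es ei hc nonsep ltac:(lia) Ks.
have hr x : x \in support e -> r <= #|nbhd e x|.
  by move=> xs; rewrite leqNgt; apply: contra hd => h; apply/existsP; exists x; rewrite xs.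
have rS : r <= #|S| by apply: leq_trans vS; apply: hr.
pose ss := take r (enum S).
have szs : size ss = r by rewrite size_takel // -cardE.
have hss : {in ss, forall x, r <= #|nbhd e x| <= K./2}.
  by move=> x /mem_take; rewrite mem_enum => /hS[/hr-> ->].
have uss : uniq ss by rewrite take_uniq // enum_uniq.
have [e' [ds [es' ei' sub [h1 h2 h3 h4 h5]]]] := delete_vertices es ei uss hss.
rewrite szs in h1 h3.
have ds0 : 0 < sumn ds.
  have := h3 0 r0; case: (ds) h1 => [|d ds'] /=; first by move=> h; rewrite -h in r0.
  by lia.
have hw := weak e' es' ei' sub ltac:(move: h4 ds0; rewrite -/m; clear; lia).
have lK : K./2.*2 <= K by rewrite -{2}(odd_double_half K) leq_addl.
have eq_m : #|kcliques e' 2| + sumn ds = (m %/ 'C(K, 2)).-1.+1 * 'C(K, 2) + ('C(r, 2) + s).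
  by rewrite -h4 prednK // -eb -mdm.
have hb : 'C(r, 2) + s < 'C(K, 2) by rewrite -eb ltn_pmod.
have := extremal_count_trade w_gt0 wK lK sr h1 h2 h3 hb eq_m.
by rewrite -h4 -/m; move: h5 hw; clear; lia.
Qed.
End StrictBound.

Section CliqueBlocks.
Variable T : finType.
Implicit Types (e : rel T) (A B : {set T}) (x y z : T).

Definition off_clique e A : rel T := fun x y => e x y && ~~ ((x \in A) && (y \in A)).

Definition rest_of e K : rel T :=
  fun x y => e x y && [forall A in kcliques e K, ~~ ((x \in A) && (y \in A))].

Lemma rest_of_sym e K : symmetric e -> symmetric (rest_of e K).
Proof.
move=> es x y; rewrite /rest_of es; congr (_ && _).
by apply: eq_forallb_in => A _; rewrite andbC.
Qed.

Lemma rest_of_subrel e K : subrel (rest_of e K) e.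
Proof. by move=> x y /andP[]. Qed.

Lemma rest_of_irr e K : irreflexive e -> irreflexive (rest_of e K).
Proof. by move=> ei x; rewrite /rest_of ei. Qed.

Lemma rest_of_off e K A : A \in kcliques e K -> subrel (rest_of e K) (off_clique e A).
Proof. by move=> hA x y /andP[exy /forall_inP/(_ A hA) h]; rewrite /off_clique exy. Qed.

Lemma clique_path e A z r : clique e A -> uniq (z :: r) -> {subset z :: r <= A} ->
  path e z r.
Proof.
move=> cA; elim: r z => //= y r IH z /and3P[zr yr ur] sub.
rewrite IH //=; last by move=> u ur'; apply: sub; rewrite inE ur' orbT.
  rewrite andbT; apply: (cliqueP _ _ cA); [exact: sub (mem_head _ _) | |].
    by apply: sub; rewrite !inE eqxx orbT.
  by move: zr; rewrite inE negb_or => /andP[].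
by rewrite yr.
Qed.

Section Blocks.
Variables (e : rel T) (K : nat).
Hypotheses (es : symmetric e) (ei : irreflexive e) (K2 : 1 < K).
Hypothesis nolong : circumference_lt K.+1 e.

(* An excursion outside A closes up, along all of A, to a cycle longer than K. *)
Lemma clique_block A x y : A \in kcliques e K -> x \in A -> y \in A ->
  connect (off_clique e A) x y -> x = y.
Proof.
move=> /kcliquesP[cA clA] xA yA /connectP[p hp ey]; apply/eqP/negPn/negP => xy.
move: ey; case/shortenP: hp => {}p hp hu _ ey.
have hh : has (mem A) p.
  apply/hasP; exists y => //.
  by have := mem_last x p; rewrite -ey inE eq_sym (negbTE xy).
case: {-}_ / (split_find hh) (hp) (hu) => z p1 p2 zA0 /hasPn h1.
have zA : z \in A by [].
rewrite cat_path rcons_path => /andP[/andP[hp1 /andP[ez nz]] _].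
rewrite -cat_cons => /uniq_catP[]; rewrite -rcons_cons rcons_uniq => /andP[zxp u1] _ _.
have xz : z != x by apply: contraNneq zxp => ->; rewrite mem_head.
have p1n : 0 < size p1.
  by case: (p1) nz => //=; rewrite xA zA.
pose r := enum (A :\ x :\ z).
have rA u : u \in r -> [/\ u \in A, u != x & u != z].
  by rewrite mem_enum !inE => /and3P[].
have szr : size r = K - 2.
  have zAx : z \in A :\ x by rewrite in_setD1 xz.
  by rewrite -cardE -cA (cardsD1 x A) xA (cardsD1 z (A :\ x)) zAx !add1n subn2.
have uzr : uniq (z :: r).
  by rewrite /= enum_uniq andbT; apply/negP => /rA[_ _]; rewrite eqxx.
have zrA : {subset z :: r <= A} by move=> u; rewrite inE => /predU1P[->//|/rA[]].
have hc : ucycle e (x :: p1 ++ z :: r).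
  apply/andP; split.
    have pz := clique_path clA uzr zrA.
    rewrite /= rcons_path cat_path last_cat /= ez pz andbT.
    have -> /= : path e x p1 by apply: sub_path hp1 => a b /andP[].
    apply: (cliqueP _ _ clA) => //; first by apply: zrA; apply: mem_last.
    by have := mem_last z r; rewrite inE => /predU1P[->//|/rA[]].
  rewrite -cat_cons; apply/uniq_catP; split=> // u.
  rewrite inE => /predU1P[->|up].
    by rewrite inE eq_sym (negbTE xz) /= => /rA[_]; rewrite eqxx.
  by move/zrA => uA; move: (h1 u up); rewrite /= uA.
have := nolong _ hc; rewrite /= size_cat /= szr => h.
by have := h ltac:(move: p1n K2; clear; lia); move: p1n K2; clear; lia.
Qed.

Lemma clique_sub_block A B x y : A \in kcliques e K -> clique e B ->
  x \in A -> x \in B -> y \in A -> y \in B -> x != y -> B \subset A.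
Proof.
move=> hA /cliqueP clB xA xB yA yB xy; apply/subsetP => z zB.
apply/negPn/negP => zA; move/eqP: xy; apply; apply: (clique_block hA) => //.
have zx : z != x by apply: contraNneq zA => ->.
have zy : z != y by apply: contraNneq zA => ->.
apply: (connect_trans (y := z)); apply: connect1; rewrite /off_clique (negbTE zA) ?andbF andbT.
  by apply: clB; rewrite // eq_sym.
exact: clB.
Qed.

Lemma clique_eq_block A B x y : A \in kcliques e K -> B \in kcliques e K ->
  x \in A -> x \in B -> y \in A -> y \in B -> x != y -> A = B.
Proof.
move=> hA hB xA xB yA yB xy; apply/esym/eqP.
have [cA _] := kcliquesP _ _ _ hA; have [cB clB] := kcliquesP _ _ _ hB.
by rewrite eqEcard cA cB leqnn andbT (clique_sub_block hA clB xA xB yA yB xy).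
Qed.

Lemma card_kcliques_rest j : 1 < j ->
  #|kcliques e j| = #|kcliques e K| * 'C(K, j) + #|kcliques (rest_of e K) j|.
Proof.
move=> j1; have sub := subrel_kcliques j (@rest_of_subrel e K).
have -> : #|kcliques e K| * 'C(K, j) =
    \sum_(B in kcliques e j) \sum_(A in kcliques e K) (B \subset A).
  rewrite exchange_big -sum_nat_const /=; apply: eq_bigr => A /kcliquesP[cA clA].
  rewrite -cA -(card_kcliques_in j clA) -sum1_card big_mkcond [RHS]big_mkcond /=.
  by apply: eq_bigr => B _; rewrite in_set; case: (B \in kcliques e j) => //=; case: (B \subset A).
have -> : #|kcliques (rest_of e K) j| = \sum_(B in kcliques e j) (B \in kcliques (rest_of e K) j).
  rewrite -sum1_card big_mkcond [RHS]big_mkcond /=; apply: eq_bigr => B _.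
  by case: ifP => [/(subsetP sub)->|_] //; case: ifP.
rewrite -big_split /= -sum1_card; apply: eq_bigr => B /kcliquesP[cB clB].
have [x [y [xB yB xy]]] : exists x y, [/\ x \in B, y \in B & x != y].
  by apply/card_gt1P; rewrite cB.
have [/existsP[A /andP[hA BA]]|none] := boolP [exists A in kcliques e K, B \subset A].
  have [xA yA] : x \in A /\ y \in A by split; apply: (subsetP BA).
  rewrite (bigD1 A) //= BA big1 ?addn0 => [|A' /andP[hA' AA']].
    have /negbTE-> // : B \notin kcliques (rest_of e K) j.
    apply/negP => /kcliquesP[_ /cliqueP/(_ x y xB yB xy)/andP[_ /forall_inP/(_ A hA)]].
    by rewrite xA yA.
  apply/eqP; rewrite eqb0; apply: contra AA' => /subsetP BA'.
  by rewrite (clique_eq_block hA hA' xA (BA' _ xB) yA (BA' _ yB) xy).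
rewrite big1 ?add0n => [|A hA]; last first.
  by apply/eqP; rewrite eqb0; apply: contra none => h; apply/existsP; exists A; rewrite hA.
apply/esym/eqP; rewrite eqb1; apply/kcliquesP; split=> //; apply/cliqueP => u v uB vB uv.
rewrite /rest_of (cliqueP _ _ clB) //=; apply/forall_inP => A hA.
apply: contra none => /andP[uA vA]; apply/existsP; exists A.
by rewrite hA (clique_sub_block hA clB uA uB vA vB uv).
Qed.

Lemma rest_of_clique_free : kcliques (rest_of e K) K = set0.
Proof.
apply/eqP; rewrite -subset0; apply/subsetP => A hA.
have hA' := subsetP (subrel_kcliques K (@rest_of_subrel e K)) A hA.
have [cA /cliqueP clA] := kcliquesP _ _ _ hA.
have [x [y [xA yA xy]]] : exists x y, [/\ x \in A, y \in A & x != y].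
  by apply/card_gt1P; rewrite cA.
have /andP[_ /forall_inP/(_ A hA')] := clA x y xA yA xy.
by rewrite xA yA.
Qed.
End Blocks.

Section Bound.
Variables (e : rel T) (w K : nat).
Hypotheses (es : symmetric e) (ei : irreflexive e) (w_gt0 : 0 < w) (wK : w.+1 < K).
Hypothesis nolong : circumference_lt K.+1 e.
Local Notation f := (extremal_count w K).
Local Notation m' := #|kcliques (rest_of e K) 2|.
Local Notation c' := #|kcliques (rest_of e K) w.+2|.

Theorem clique_bound : #|kcliques e w.+2| <= f #|kcliques e 2| /\
  (#|kcliques e w.+2| = f #|kcliques e 2| <-> m' < 'C(K, 2) /\ c' = colex_count w m').
Proof.
have K2 : 1 < K by lia.
have D0 : 0 < 'C(K, 2) by rewrite bin_gt0.
rewrite (card_kcliques_rest K2 nolong (j := 2)) // (card_kcliques_rest K2 nolong (j := w.+2)) //.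
have -> : f (#|kcliques e K| * 'C(K, 2) + m') = #|kcliques e K| * 'C(K, w.+2) + f m'.
  by rewrite /extremal_count divnMDl // modnMDl mulnDl addnA.
rewrite leq_add2l.
have rs := rest_of_sym K es; have ri := rest_of_irr K ei.
have [lt|ge] := ltnP m' 'C(K, 2).
  have -> : f m' = colex_count w m' by rewrite /extremal_count divn_small // modn_small.
  split; first exact: kruskal_katona.
  by split=> [/addnI->|[_ ->]].
have lt := strict_bound w_gt0 wK rs ri (subrel_circumference (@rest_of_subrel e K) nolong)
  (rest_of_clique_free e K2) ge.
split; first exact: ltnW.
by split=> [/addnI h|[]//]; rewrite h ltnn in lt.
Qed.
End Bound.
End CliqueBlocks.

(** * Counting cliques in the graphs of the statement *)

Lemma edgesE (G : sgraph) : edges G = kcliques (@sedge G) 2.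
Proof.
apply/setP => B; apply/imsetP/(kcliques2P _ (@sedge_sym G) (@sedge_irr G)).
  by case=> -[x y] /[!inE] /= exy ->; exists x, y.
by case=> x [y [exy ->]]; exists (x, y); rewrite ?inE.
Qed.

Lemma card_kcliques_fibers (T I : finType) (e : rel T) (p : T -> I) j :
  (forall x y, e x y -> p x = p y) -> 0 < j ->
  #|kcliques e j| = \sum_i #|[set A in kcliques e j | A \subset [set x | p x == i]]|.
Proof.
move=> hp j0.
have -> : \sum_i #|[set A in kcliques e j | A \subset [set x | p x == i]]| =
   \sum_i \sum_(A in kcliques e j) (A \subset [set x | p x == i]).
  apply: eq_bigr => i _; rewrite -sum1_card big_mkcond [RHS]big_mkcond /=.
  by apply: eq_bigr => A _; rewrite in_set; case: (A \in kcliques e j) => //=; case: (A \subset _).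
rewrite exchange_big /= -sum1_card; apply: eq_bigr => A /kcliquesP[cA /cliqueP clA].
have [x xA] : exists x, x \in A by apply/card_gt0P; rewrite cA.
rewrite (bigD1 (p x)) //= big1 => [|i ix]; last first.
  apply/eqP; rewrite eqb0; apply: contra ix => /subsetP/(_ x xA).
  by rewrite inE eq_sym.
rewrite addn0; apply/esym/eqP; rewrite eqb1; apply/subsetP => y yA; rewrite inE.
by have [->//|yx] := eqVneq y x; apply/eqP/hp/clA.
Qed.

Lemma card_kcliques_emb (T T' : finType) (e : rel T) (e' : rel T') (f : T' -> T) j :
  injective f -> (forall x y, e (f x) (f y) = e' x y) ->
  #|kcliques e' j| = #|[set A in kcliques e j | A \subset f @: setT]|.
Proof.
move=> fi fe; rewrite -(card_imset _ (imset_inj fi)); apply: eq_card => A.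
rewrite inE; apply/imsetP/andP => [[B /kcliquesP[cB /cliqueP clB] ->]|[/kcliquesP[cA /cliqueP clA] sA]].
  split; last by apply: imsetS; apply: subsetT.
  apply/kcliquesP; rewrite card_imset //; split=> //; apply/cliqueP => _ _ /imsetP[x xB ->] /imsetP[y yB ->].
  by rewrite (inj_eq fi) fe; apply: clB.
have EA : A = f @: (f @^-1: A).
  apply/setP => y; apply/idP/imsetP => [yA|[x /[!inE] ? ->//]].
  by have /imsetP[x _ ey] := subsetP sA y yA; exists x; rewrite ?inE -?ey.
exists (f @^-1: A) => //; apply/kcliquesP; split; first by rewrite -cA {2}EA card_imset.
by apply/cliqueP => x y /[!inE] xA yA xy; rewrite -fe clA // (inj_eq fi).
Qed.

Lemma kcliques_support (T : finType) (e : rel T) j A : symmetric e -> 1 < j ->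
  A \in kcliques e j -> A \subset support e.
Proof.
move=> es j1 /kcliquesP[cA /cliqueP clA]; apply/subsetP => x xA.
have : 0 < #|A :\ x| by move: cA; rewrite (cardsD1 x) xA; lia.
case/card_gt0P => y /setD1P[yx yA]; apply/supportP; exists y.
by apply: clA; rewrite // eq_sym.
Qed.

Lemma imset_val_setT (T : finType) (A : {set T}) : (val : {x | x \in A} -> T) @: setT = A.
Proof.
apply/setP => x; apply/imsetP/idP => [[[y yA] _ ->]//|xA].
by exists (exist _ x xA).
Qed.

Lemma ncliques_induced (G : sgraph) (A : {set G}) j :
  ncliques j (induced A) = #|[set B in cliques j G | B \subset A]|.
Proof.
have := @card_kcliques_emb G {x | x \in A} (@sedge G) (@sedge (induced A)) val j val_inj.
by rewrite imset_val_setT; apply.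
Qed.

Lemma ncliques_equiv (G H : sgraph) j : 1 < j -> sg_equiv G H -> ncliques j G = ncliques j H.
Proof.
move=> j1 [f [fb fe]].
have supp K : ncliques j K = ncliques j (induced (nonisolated K)).
  rewrite ncliques_induced; apply: eq_card => A; rewrite [in RHS]inE.
  apply/esym/andb_idr; exact: (@kcliques_support K (@sedge K) j A (@sedge_sym K)).
rewrite (supp G) (supp H); have := @card_kcliques_emb _ _ _ _ f j (bij_inj fb) fe.
rewrite /ncliques => ->; apply: eq_card => A; rewrite !inE; apply: andb_idr => _.
apply/subsetP => y _; have [g _ gK] := fb.
by apply/imsetP; exists (g y); rewrite ?gK.
Qed.

Lemma sg_equiv_refl G : sg_equiv G G.
Proof. by exists id; split=> //; exists id. Qed.

Lemma sg_equiv_sym G H : sg_equiv G H -> sg_equiv H G.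
Proof.
case=> f [[g fK gK] fe]; exists g; split; first by exists f.
by move=> x y; rewrite -fe !gK.
Qed.

Lemma sg_equiv_of (G H : sgraph) (f : G -> H) :
  {in nonisolated G &, injective f} ->
  {in nonisolated G &, forall x y, sedge (f x) (f y) = sedge x y} ->
  (forall y, y \in nonisolated H -> exists2 x, x \in nonisolated G & f x = y) ->
  sg_equiv G H.
Proof.
move=> fi fe fs.
have fN x : x \in nonisolated G -> f x \in nonisolated H.
  move=> xN; have /supportP[y exy] := xN; apply/(supportP (@sedge H)); exists (f y).
  by rewrite fe //; apply/supportP; exists x; rewrite sedge_sym.
pose F (x : induced (nonisolated G)) : induced (nonisolated H) := exist _ (f (val x)) (fN _ (valP x)).
exists F; split; last by move=> [x xN] [y yN]; apply: fe.
have Fi : injective F.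
  by move=> [x xN] [y yN] /(congr1 val)/= h; apply/val_inj/fi.
apply: (inj_card_bij Fi); rewrite -(card_codom Fi); apply/subset_leq_card/subsetP => -[y yN] _.
have [x xN fx] := fs y yN; apply/codomP; exists (exist _ x xN); apply/val_inj.
by rewrite /= fx.
Qed.

Lemma ncliques_complete n j : ncliques j (complete n) = 'C(n, j).
Proof.
have cT : clique (@sedge (complete n)) setT by apply/cliqueP.
have := card_kcliques_in j cT; rewrite cardsT card_ord => <-.
by apply: eq_card => A; rewrite [in RHS]inE subsetT andbT.
Qed.

Lemma ncliques_copies q (G : sgraph) j : 0 < j ->
  ncliques j (sg_copies q G) = q * ncliques j G.
Proof.
move=> j0; have := @card_kcliques_fibers _ _ (@sedge (sg_copies q G)) (fun x => x.1) j.
move=> /(_ _ j0) h; rewrite /ncliques [LHS]h; last by move=> x y /andP[/eqP].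
rewrite -[q in RHS]card_ord -sum_nat_const; apply: eq_bigr => i _.
have hi : injective (fun x : G => (i, x)) by move=> x y [].
have he x y : @sedge (sg_copies q G) (i, x) (i, y) = sedge x y.
  by rewrite /= /copies_edge /= eqxx.
rewrite [RHS](card_kcliques_emb j hi he); congr #|pred_of_set _|; apply/setP => A; rewrite !in_set.
have -> // : (fun x : G => (i, x)) @: setT = [set x | x.1 == i].
apply/setP => -[a x]; rewrite inE /=; apply/imsetP/eqP => [[y _ []]//|->]; by exists x.
Qed.

Lemma ncliques_union (G H : sgraph) j : 0 < j ->
  ncliques j (sg_union G H) = ncliques j G + ncliques j H.
Proof.
move=> j0; pose p (x : G + H) := if x is inl _ then true else false.
have := @card_kcliques_fibers _ _ (@sedge (sg_union G H)) p j.
move=> /(_ _ j0) h; rewrite /ncliques [LHS]h; last by case=> x [].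
rewrite (bigD1 true) //= (bigD1 false) //= big1 ?addn0; last by case.
have il : injective (@inl G H) by move=> x y [].
have ir : injective (@inr G H) by move=> x y [].
have el x y : @sedge (sg_union G H) (inl x) (inl y) = sedge x y by [].
have er x y : @sedge (sg_union G H) (inr x) (inr y) = sedge x y by [].
rewrite [X in _ = X + _](card_kcliques_emb j il el) [X in _ = _ + X](card_kcliques_emb j ir er).
have -> : [set x | p x == true] = (@inl G H) @: setT.
  apply/setP => -[x|x]; rewrite inE /=; apply/esym/imsetP; last by case.
  by exists x.
have -> // : [set x | p x == false] = (@inr G H) @: setT.
apply/setP => -[x|x]; rewrite inE /=; apply/esym/imsetP; first by case.
by exists x.
Qed.

Lemma card_ord_lt n y : y <= n -> #|[set i : 'I_n | i < y]| = y.
Proof.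
move=> yn; rewrite -sum1_card big_mkcond /=.
have -> : \sum_(i < n) (if i \in [set i : 'I_n | i < y] then 1 else 0) = \sum_(i < n | i < y) 1.
  by rewrite [RHS]big_mkcond; apply: eq_bigr => i _; rewrite inE.
by rewrite (big_ord_narrow yn) sum1_card card_ord.
Qed.

Section Colex.
Variable n : nat.
Implicit Types a b x y : 'I_n.

Lemma colex_pair a b x y : a < b -> x < y ->
  colex [set a; b] [set x; y] = (b < y) || ((b == y) && (a < x)).
Proof.
move=> ab xy; apply/existsP/orP.
  case=> z /andP[/setDP[zxy zab] /forall_inP h].
  have [by_|yb|eby] := ltngtP b y; [by left | | right].
    have : b <= z.
      apply: h; rewrite !inE !eqxx orbT /= andbT negb_or -!val_eqE /=.
      by apply/orP; left; apply/andP; split; lia.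
    by case/set2P: zxy => ->; lia.
  have {}eby : b = y by apply: val_inj.
  subst y; rewrite eqxx /=.
  have zx : z = x by case/set2P: zxy => // zb; rewrite zb !inE eqxx orbT in zab.
  subst z; rewrite ltnNge; apply/negP => xa.
  have ax : a != x by apply: contraNneq zab => <-; rewrite !inE eqxx.
  have : a <= x.
    apply: h; rewrite !inE eqxx /= (negbTE ax) /= -!val_eqE /= (ltn_eqF ab).
    by [].
  by rewrite leqNgt ltn_neqAle xa andbT eq_sym ax.
case=> [by_|/andP[/eqP eby ax]]; last subst b.
  exists y; rewrite !inE -!val_eqE /= eqxx orbT andbT negb_or; apply/andP; split.
    by apply/andP; split; lia.
  apply/forall_inP => w; rewrite !inE -!val_eqE /=; lia.
exists x; rewrite !inE -!val_eqE /= eqxx; apply/andP; split; first by lia.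
apply/forall_inP => w; rewrite !inE -!val_eqE /=; lia.
Qed.

Lemma card_colex_below x y : x < y ->
  #|[set B : {set 'I_n} | (#|B| == 2) && colex B [set x; y]]| = 'C(y, 2) + x.
Proof.
move=> xy; pose Y := [set i : 'I_n | i < y]; pose X := [set i : 'I_n | i < x].
have cY : #|Y| = y by apply/card_ord_lt/ltnW.
have cX : #|X| = x by apply/card_ord_lt/ltnW.
have yX a : a \in X -> a != y by rewrite inE -val_eqE /=; lia.
have -> : [set B : {set 'I_n} | (#|B| == 2) && colex B [set x; y]] =
    [set B : {set 'I_n} | B \subset Y & #|B| == 2] :|: [set [set a; y] | a in X].
  apply/setP => B; rewrite !inE; apply/andP/orP => [[/cards2P[a [b [ab eB]]]]|].
    wlog lt : a b ab eB / a < b => [W|].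
      have [h|h|h] := ltngtP a b; [exact: W h | | by move: ab; rewrite -val_eqE /= h eqxx].
      by apply: (W b a); rewrite // 1?eq_sym // setUC.
    rewrite eB colex_pair // => /orP[by_|/andP[/eqP eby ax]].
      left; rewrite cards2 ab andbT; apply/subsetP => z /set2P[]->; rewrite inE; lia.
    by right; rewrite eby; apply: imset_f; rewrite inE.
  case=> [/andP[/subsetP sB /cards2P[a [b [ab eB]]]]|/imsetP[a aX ->]].
    split; first by rewrite eB cards2 ab.
    wlog lt : a b ab eB / a < b => [W|].
      have [h|h|h] := ltngtP a b; [exact: W h | | by move: ab; rewrite -val_eqE /= h eqxx].
      by apply: (W b a); rewrite // 1?eq_sym // setUC.
    have : b \in Y by apply: sB; rewrite eB set22.
    by rewrite eB colex_pair // inE => ->.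
  have ax : a < x by rewrite inE in aX.
  rewrite cards2 yX //; split=> //; rewrite colex_pair ?eqxx ?ax ?orbT //.
  exact: ltn_trans xy.
rewrite cardsU cards_draws cY.
have -> : [set B : {set 'I_n} | B \subset Y & #|B| == 2] :&: [set [set a; y] | a in X] = set0.
  apply/eqP; rewrite -subset0; apply/subsetP => B /setIP[]; rewrite inE => /andP[/subsetP sB _] /imsetP[a _ eB].
  by have := sB y; rewrite eB set22 inE ltnn => /(_ isT).
rewrite cards0 subn0 card_in_imset ?cX // => a b aX bX h.
have : a \in [set b; y] by rewrite -h set21.
by case/set2P => // ay; move: (yX a aX); rewrite ay eqxx.
Qed.
End Colex.

Lemma colex_sedge m r s (x y : colex_graph m) : m = 'C(r, 2) + s -> s < r -> x < y ->
  sedge x y = (y < r) || ((y == r :> nat) && (x < s)).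
Proof.
move=> em sr xy; rewrite /sedge /= /colex_edge card_colex_below //.
have -> /= : x != y by rewrite -val_eqE /= ltn_eqF.
have hm c : (c < m) = (c < 'C(r, 2) + s) by rewrite -em.
rewrite hm.
have [yr|ry|->] := ltngtP y r => /=; last by rewrite ltn_add2l.
  have : 'C(y.+1, 2) <= 'C(r, 2) by apply: leq_bin2l.
  by rewrite bin2S; move: xy; clear; lia.
have : 'C(r.+1, 2) <= 'C(y, 2) by apply: leq_bin2l.
by rewrite bin2S; move: sr; clear; lia.
Qed.

Lemma card_kcliques_clique (T : finType) (e : rel T) A j : 1 < j -> clique e A ->
  (forall x y, e x y -> x \in A /\ y \in A) -> #|kcliques e j| = 'C(#|A|, j).
Proof.
move=> j1 clA hA; rewrite -(card_kcliques_in j clA); apply: eq_card => B.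
rewrite [in RHS]inE; apply/esym/andb_idr => /kcliquesP[cB /cliqueP clB].
apply/subsetP => x xB; have : 0 < #|B :\ x| by move: cB; rewrite (cardsD1 x) xB; lia.
by case/card_gt0P => y /setD1P[yx yB]; case: (hA x y) => //; apply: clB; rewrite // eq_sym.
Qed.

Lemma card_kcliques_star (T : finType) (e : rel T) A v j : symmetric e -> irreflexive e ->
  0 < j -> clique e A -> v \notin A -> nbhd e v \subset A ->
  (forall x y, e x y -> x != v -> y != v -> x \in A /\ y \in A) ->
  #|kcliques e j.+1| = 'C(#|A|, j.+1) + 'C(#|nbhd e v|, j).
Proof.
move=> es ei j0 clA vA vN hA; rewrite (card_kcliques_del v es ei) //; congr (_ + _).
  apply: card_kcliques_clique => //.
    apply/cliqueP => x y xA yA xy; rewrite /del (cliqueP _ _ clA) //= !inE.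
    by apply/andP; split; apply: contraNneq vA => <-.
  by move=> x y /and3P[exy]; rewrite !inE; apply: hA.
by rewrite -(card_kcliques_in j (clique_sub vN clA)).
Qed.

Lemma colex_structure m r s : m = 'C(r, 2) + s -> s < r ->
  let A := [set i : 'I_m.+1 | i < r] in
  [/\ r <= m.+1, #|A| = r, clique (@sedge (colex_graph m)) A &
   forall x y, @sedge (colex_graph m) x y -> (x \in A /\ y \in A) \/
      exists v : 'I_m.+1, [/\ v = r :> nat, x = v \/ y = v & 0 < s]].
Proof.
move=> em sr A.
have rm : r <= m.+1.
  case: r em sr {A} => // r em _; rewrite em bin2S.
  by case: r {em} => // r; rewrite bin2S; lia.
split=> //; first exact: card_ord_lt.
  apply/cliqueP => x y xA yA xy.
  wlog lt : x y xA yA xy / x < y => [W|].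
    have [h|h|h] := ltngtP x y; [exact: W h| |by move: xy; rewrite -val_eqE /= h eqxx].
    by rewrite sedge_sym; apply: W; rewrite // eq_sym.
  by rewrite (colex_sedge em sr lt); move: yA; rewrite inE => ->.
move=> x y exy.
have xy : x != y by apply: contraTneq exy => ->; rewrite sedge_irr.
wlog lt : x y exy xy / x < y => [W|].
  have [h|h|h] := ltngtP x y; [exact: W h| |by move: xy; rewrite -val_eqE /= h eqxx].
  rewrite sedge_sym in exy; rewrite eq_sym in xy.
  case: (W y x exy xy h) => [[? ?]|[v [? [] ? ?]]]; [by left|right|right].
    by exists v; split=> //; right.
  by exists v; split=> //; left.
move: (exy); rewrite (colex_sedge em sr lt) => /orP[yr|/andP[/eqP yr xs]].
  by left; rewrite !inE yr (ltn_trans lt yr).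
by right; exists y; split=> //; [right | lia].
Qed.

Lemma ncliques_colex w m : 0 < w -> ncliques w.+2 (colex_graph m) = colex_count w m.
Proof.
move=> w0; have [r [s [em sr r0]]] := colexW m.
rewrite [in RHS]em colex_countE ?(ltnW sr) //.
have [rm cA clA hA] := colex_structure em sr; set A := [set i | _] in cA clA hA.
have [s0|s0] := posnP s.
  rewrite s0 bin0n addn0 -[in RHS]cA; apply: card_kcliques_clique => // x y /hA[//|[v [_ _]]].
  by rewrite s0.
have rm' : r < m.+1.
  rewrite em ltnS; case: r em sr {A cA clA hA rm r0} => // r em sr; rewrite bin2S.
  by case: r {em sr} => // r; rewrite bin2S; lia.
pose v : 'I_m.+1 := Ordinal rm'.
have Nv : nbhd (@sedge (colex_graph m)) v = [set i : 'I_m.+1 | i < s].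
  apply/setP => x; rewrite !inE; have [xv|vx|xv] := ltngtP x v.
  - by rewrite sedge_sym (colex_sedge em sr xv) ltnn eqxx.
  - rewrite (colex_sedge em sr vx); move: vx => /= vx.
    by apply/idP/idP; lia.
  have -> : x = v by apply: val_inj.
  by rewrite sedge_irr /=; apply/esym/negbTE; rewrite -leqNgt ltnW.
have := @card_kcliques_star _ (@sedge (colex_graph m)) A v w.+1 (@sedge_sym _) (@sedge_irr _).
rewrite Nv cA card_ord_lt; last by lia.
apply=> //.
- by rewrite inE ltnn.
- by apply/subsetP => x; rewrite !inE => /ltn_trans; apply.
move=> x y /hA[//|[u [uv [] xu _]]] => /negP xv /negP yv.
- by case: xv; rewrite xu; apply/eqP/val_inj.
- by case: yv; rewrite xu; apply/eqP/val_inj.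
Qed.

Lemma star_equiv_colex (L : sgraph) m r s A v : m = 'C(r, 2) + s -> 0 < s < r ->
  nedges L = m -> A \in kcliques (@sedge L) r -> v \notin A ->
  nbhd (@sedge L) v \subset A -> #|nbhd (@sedge L) v| = s -> sg_equiv L (colex_graph m).
Proof.
move=> em /andP[s0 sr] eL hA vA vN cN.
have es := @sedge_sym L; have ei := @sedge_irr L.
set e := @sedge L in hA vN cN es ei *; set N := nbhd e v in vN cN.
have r1 : 1 < r by lia.
have [cA clA] := kcliquesP _ _ _ hA.
have hA' : A \in kcliques (del e [set v]) r by rewrite kcliques_del // inE hA.
have hin x y : e x y -> x != v -> y != v -> x \in A /\ y \in A.
  move=> exy xv yv; apply: (clique_all_edges (del_sym [set v] es) (del_irr [set v] ei) hA').
    have := card_edges_del v es ei; rewrite -/N cN.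
    by move: eL; rewrite /nedges edgesE em -/e => ->; clear; lia.
  by rewrite /del exy !inE xv yv.
pose l := enum N ++ enum (A :\: N) ++ [:: v].
have cAN : #|A :\: N| = r - s by rewrite cardsD (setIidPr vN) cA cN.
have szl : size l = r.+1 by rewrite !size_cat -!cardE cN cAN /=; lia.
have ml y : (y \in l) = (y \in A) || (y == v).
  rewrite !mem_cat !mem_enum in_setD mem_seq1.
  by have [yN|//] := boolP (y \in N); rewrite (subsetP vN).
have ul : uniq l.
  rewrite !cat_uniq !enum_uniq /= orbF mem_enum in_setD (negbTE vA) andbF !andbT /=.
  apply/hasPn => y; rewrite mem_cat mem_enum in_setD mem_seq1 => hy.
  suff : y \notin enum N by [].
  by rewrite mem_enum; case/orP: hy => [/andP[]//|/eqP->]; apply: contra vA; apply: (subsetP vN).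
have lv : nth v l r = v.
  by rewrite /l catA nth_cat size_cat -!cardE cN cAN subnKC ?ltnn ?subnn // ltnW.
have lA i : i < r -> nth v l i \in A.
  move=> ir; have i1 : i < size l by rewrite szl ltnS ltnW.
  have i2 : r < size l by rewrite szl.
  have := mem_nth v i1; rewrite ml => /orP[//|/eqP h].
  have := nth_uniq v i1 i2 ul; rewrite lv h eqxx => /esym/eqP ier.
  by rewrite ier ltnn in ir.
have lN i : i < r -> (nth v l i \in N) = (i < s).
  move=> ir; rewrite /l nth_cat -cardE cN; case: ltnP => si.
    by rewrite -mem_enum mem_nth // -cardE cN.
  rewrite nth_cat -cardE cAN ltn_sub2r //.
  have : nth v (enum (A :\: N)) (i - s) \in enum (A :\: N).
    by rewrite mem_nth // -cardE cAN ltn_sub2r.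
  by rewrite mem_enum in_setD => /andP[/negbTE].
have rm : r < m.+1.
  by rewrite em; case: r sr r1 {em hA cA hA' szl cAN lv lA lN} => // -[|r] // _ _; rewrite bin2S; lia.
pose f (i : colex_graph m) : L := nth v l (i : 'I_m.+1).
have le_r (i : 'I_m.+1) : i \in nonisolated (colex_graph m) -> i < r.+1.
  move=> /(supportP (@sedge (colex_graph m)))[y].
  have [iy|yi|/val_inj->] := ltngtP i y; last by rewrite sedge_irr.
    by rewrite (colex_sedge em sr iy) => /orP[yr|/andP[/eqP<- _]]; [apply: ltn_trans (ltn_trans iy yr) _|apply: ltnW].
  by rewrite sedge_sym (colex_sedge em sr yi) => /orP[/ltnW//|/andP[/eqP->]].
have fe (i j : 'I_m.+1) : i < r.+1 -> j < r.+1 -> e (f i) (f j) = @sedge (colex_graph m) i j.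
  wlog ij : i j / i < j => [W|] ir jr.
    have [h|h|/val_inj->] := ltngtP i j; [exact: W | | by rewrite ei sedge_irr].
    by rewrite es [RHS]sedge_sym; apply: W.
  rewrite (colex_sedge em sr ij).
  have ir' : i < r by apply: leq_trans ij _.
  have [jr'|rj|jE] := ltngtP j r; first last.
  - by rewrite /f jE lv es -(lN i ir') inE.
  - by move: jr; rewrite ltnS leqNgt rj.
  apply: (cliqueP _ _ clA); rewrite ?lA // nth_uniq ?szl ?ltnS ?(ltnW ir') ?(ltnW jr') //.
  by rewrite ltn_eqF.
apply: sg_equiv_sym; apply: (@sg_equiv_of (colex_graph m) L f).
- move=> i j /le_r ir /le_r jr /eqP; rewrite nth_uniq ?szl // => /eqP.
  exact: val_inj.
- by move=> i j /le_r ir /le_r jr; apply: fe.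
have inl x : x \in nonisolated L -> x \in l.
  move=> /(supportP e)[y exy]; rewrite ml; have [//|xv] := eqVneq x v; rewrite ?orbT //.
  have [yv|yv] := eqVneq y v; last by have [-> _] := hin x y exy xv yv.
  by rewrite (subsetP vN) // inE es -yv.
move=> y yN; have /(supportP e)[z eyz] := yN.
have zN : z \in nonisolated L by apply/(supportP e); exists y; rewrite es.
have idx u : u \in l -> exists i : 'I_m.+1, i < r.+1 /\ f i = u.
  move=> ul'; have iu : index u l < r.+1 by rewrite -szl index_mem.
  exists (Ordinal (leq_trans iu rm)); split=> //.
  by rewrite /f /= nth_index.
have [i [ir fi]] := idx y (inl y yN); have [j [jr fj]] := idx z (inl z zN).
exists i => //; apply/(supportP (@sedge (colex_graph m))); exists j.
by rewrite -fe // fi fj.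
Qed.

(** * Forest-like gluings *)

Lemma component_classP (G : sgraph) (A : {set G}) :
  A \in equivalence_partition (connect (@sedge G)) setT ->
  exists x, A = [set y | connect (@sedge G) x y].
Proof.
case/imsetP=> x _ ->; exists x; apply/setP => y; by rewrite !inE.
Qed.

Lemma component_class (G : sgraph) (x : G) :
  [set y | connect (@sedge G) x y] \in equivalence_partition (connect (@sedge G)) setT.
Proof.
apply/imsetP; exists x => //; apply/setP => y; by rewrite !inE.
Qed.

Lemma component_class_eq (G : sgraph) (A : {set G}) x :
  A \in equivalence_partition (connect (@sedge G)) setT -> x \in A ->
  A = [set y | connect (@sedge G) x y].
Proof.
move=> /component_classP[z ->] /[!inE] zx; apply/setP => y; rewrite !inE.
by apply: same_connect => //; apply: sym_connect_sym; apply: sedge_sym.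
Qed.

Lemma ncliques_components (F : sgraph) j : 0 < j ->
  \sum_(X <- components F) ncliques j X = ncliques j F.
Proof.
move=> j0; rewrite big_map big_enum /=.
under eq_bigr do rewrite ncliques_induced -sum1_card big_mkcond.
have E A : \sum_(B : {set F}) (if B \in [set B in cliques j F | B \subset A] then 1 else 0) =
    \sum_(B in cliques j F) (B \subset A).
  rewrite [RHS]big_mkcond; apply: eq_bigr => B _.
  by rewrite in_set; case: (B \in cliques j F) => //=; case: (B \subset A).
under eq_bigr do rewrite E.
rewrite exchange_big /= /ncliques -sum1_card; apply: eq_bigr => B /kcliquesP[cB /cliqueP clB].
have [x xB] : exists x, x \in B by apply/card_gt0P; rewrite cB.
rewrite (bigD1 _ (component_class x)) /= big1 ?addn0 => [|A /andP[hA AX]].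
  apply/eqP; rewrite eqb1; apply/subsetP => y yB; rewrite inE.
  by have [->|yx] := eqVneq y x; rewrite ?connect0 // connect1 // clB // eq_sym.
apply/eqP; rewrite eqb0; apply: contra AX => /subsetP/(_ x xB) xA.
by rewrite -(component_class_eq hA xA).
Qed.

Lemma components_complete n : 0 < n ->
  components (complete n) = [:: induced [set: complete n]].
Proof.
move=> n0; rewrite /components; suff -> : equivalence_partition (connect (@sedge (complete n))) setT = [set setT].
  by rewrite enum_set1.
have cT (x : complete n) : [set y | connect (@sedge (complete n)) x y] = setT.
  apply/setP => y; rewrite !inE; have [->|xy] := eqVneq x y; rewrite ?connect0 //.
  exact: connect1.
apply/setP => A; rewrite inE; apply/idP/eqP => [/component_classP[x ->]|->]; first exact: cT.
by have := @component_class (complete n) (Ordinal n0); rewrite cT.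
Qed.

Lemma evertsP (G : sgraph) (E : {set {set G}}) x :
  reflect (exists y, x != y /\ [set x; y] \in E) (x \in everts E).
Proof.
apply: (iffP (supportP (@sedge (edge_graph E)) x)) => -[y].
  by case/andP; exists y.
by case=> xy xyE; exists y; rewrite /= /edge_graph_rel xy.
Qed.

Lemma ncliques_Gforest (Fs : seq sgraph) (H : sgraph) t : 2 < t ->
  Gforest_conn Fs H -> ncliques t H = \sum_(F <- Fs) ncliques t F.
Proof.
move=> t2 [E [eE dE iE cE fE]].
rewrite (big_nth (complete 0)) big_mkord.
have -> : \sum_(i < size Fs) ncliques t (nth (complete 0) Fs i) =
    \sum_(i < size Fs) \sum_(B in cliques t H) (B \in cliques t (edge_graph (E i))).
  apply: eq_bigr => i _; rewrite -(ncliques_equiv _ (iE i)); last exact: ltnW.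
  rewrite /ncliques -sum1_card big_mkcond [RHS]big_mkcond; apply: eq_bigr => B _ /=.
  have sub : B \in kcliques (@sedge (edge_graph (E i))) t -> B \in kcliques (@sedge H) t.
    apply: subsetP B; apply: (@subrel_kcliques H) => x y /andP[xy xyE].
    rewrite -(set2_kcliques x y (@sedge_sym H) (@sedge_irr H)) -edgesE -eE.
    by apply/bigcupP; exists i.
  rewrite -[cliques t (edge_graph (E i))]/(kcliques (@sedge (edge_graph (E i))) t).
  rewrite -[cliques t H]/(kcliques (@sedge H) t).
  by case: (boolP (B \in _)) sub => [_ /(_ isT)->|_ _] //; case: ifP.
rewrite exchange_big /ncliques -sum1_card; apply: eq_bigr => B /kcliquesP[cB /cliqueP clB].
have edge x y : x \in B -> y \in B -> x != y -> exists i, [set x; y] \in E i.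
  move=> xB yB xy; have : [set x; y] \in edges H.
    by rewrite edgesE set2_kcliques ?clB //; [exact: sedge_sym|exact: sedge_irr].
  by rewrite -eE => /bigcupP[i _ h]; exists i.
have ev i x y : x != y -> [set x; y] \in E i -> x \in everts (E i) /\ y \in everts (E i).
  move=> xy h; split; apply/evertsP; first by exists y.
  by exists x; rewrite eq_sym setUC.
have two i j x y : x != y -> x \in everts (E i) -> x \in everts (E j) ->
    y \in everts (E i) -> y \in everts (E j) -> i = j.
  move=> xy xi xj yi yj; apply/eqP/negPn/negP => ij.
  have : 1 < #|everts (E i) :&: everts (E j)|.
    by apply/card_gt1P; exists x, y; rewrite !in_setI xi xj yi yj.
  by rewrite ltnNge cE.
have tri x y z i j l : x != y -> x != z -> y != z ->
    [set x; y] \in E i -> [set x; z] \in E j -> [set y; z] \in E l -> i = l.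
  move=> xy xz yz hi hj hl.
  have [xi yi] := ev _ _ _ xy hi; have [xj zj] := ev _ _ _ xz hj; have [yl zl] := ev _ _ _ yz hl.
  have [//|il] := eqVneq i l.
  have [ij|ij] := eqVneq i j.
    by case/eqP: il; apply: (two _ _ y z) => //; rewrite ij.
  have [jl|jl] := eqVneq j l.
    by case/eqP: il; apply: (two _ _ x y) => //; rewrite -jl.
  have aux a b (u : H) : a != b -> u \in everts (E a) -> u \in everts (E b) ->
      aux_edge E a b.
    by move=> ab ua ub; rewrite /aux_edge ab; apply/set0Pn; exists u; rewrite in_setI ua.
  have [] := fE [:: i; j; l] _.
    split=> //; apply/andP; split; last by rewrite /= !inE negb_or ij il jl.
    by rewrite /= (aux i j x) // (aux j l z) // (aux l i y) // eq_sym.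
  move=> v hv.
  have vi : v \in everts (E i) by apply: hv; rewrite mem_head.
  have vj : v \in everts (E j) by apply: hv; rewrite !inE eqxx orbT.
  have vl : v \in everts (E l) by apply: hv; rewrite !inE eqxx !orbT.
  have [vx|vx] := eqVneq v x; last by case/eqP: ij; apply: (two _ _ v x).
  by case/eqP: il; rewrite vx in vl; apply: (two _ _ x y).
have [x [y [xB yB xy]]] : exists x y, [/\ x \in B, y \in B & x != y].
  by apply/card_gt1P; rewrite cB ltnW.
have [i hi] := edge x y xB yB xy.
have all_i u v : u \in B -> v \in B -> u != v -> [set u; v] \in E i.
  have step z : z \in B -> z != x -> [set x; z] \in E i.
    move=> zB zx; have [->//|zy] := eqVneq z y.
    have [j hj] := edge x z xB zB ltac:(by rewrite eq_sym).
    have [l hl] := edge y z yB zB ltac:(by rewrite eq_sym).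
    suff -> : i = j by [].
    by apply: (tri y x z i l j) => //; rewrite 1?eq_sym // setUC.
  move=> uB vB uv; have [ux|ux] := eqVneq u x.
    by rewrite ux; apply: step => //; rewrite -ux eq_sym.
  have [vx|vx] := eqVneq v x; first by rewrite vx setUC; apply: step.
  have [l hl] := edge u v uB vB uv.
  suff -> : i = l by [].
  by apply: (tri x u v i i l) => //; [rewrite eq_sym | rewrite eq_sym | exact: step | exact: step].
rewrite (bigD1 i) //= big1 ?addn0 => [|j ji].
  apply/esym/eqP; rewrite eqb1; apply/kcliquesP; split=> //; apply/cliqueP => u v uB vB uv.
  by rewrite /= /edge_graph_rel uv all_i.
apply/eqP; rewrite eqb0; apply/negP => /kcliquesP[_ /cliqueP/(_ x y xB yB xy)/andP[_ hj]].
by move: (dE j i ji) => /pred0P/(_ [set x; y]); rewrite /= hj hi.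
Qed.

Lemma flatten_nseq1 (T : Type) q (x : T) : flatten (nseq q [:: x]) = nseq q x.
Proof. by elim: q => //= q ->. Qed.

Lemma gforest_parts q n L : 0 < n ->
  flatten [seq components F | F <- rcons (nseq q (complete n)) L] =
  nseq q (induced [set: complete n]) ++ components L.
Proof.
move=> n0; rewrite map_rcons map_nseq components_complete // -cats1 flatten_cat.
by rewrite flatten_nseq1 /= cats0.
Qed.

Lemma ncliques_Gforest_blocks q n t L H : 2 < t -> 0 < n ->
  Gforest (rcons (nseq q (complete n)) L) H -> ncliques t H = q * 'C(n, t) + ncliques t L.
Proof.
move=> t2 n0 /(ncliques_Gforest t2) ->; rewrite gforest_parts // big_cat /=.
rewrite ncliques_components; last by lia.
congr (_ + _); rewrite big_nseq iter_addn_0 mulnC; congr (_ * _).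
rewrite -ncliques_complete ncliques_induced; apply: eq_card => B.
by rewrite inE subsetT andbT.
Qed.

Lemma card_le1_eq (T : finType) (A B : {set T}) x y : #|A :&: B| <= 1 ->
  x \in A -> x \in B -> y \in A -> y \in B -> x = y.
Proof.
move=> h xA xB yA yB; apply/eqP/negPn/negP => xy; move: h; rewrite leqNgt => /negP; apply.
by apply/card_gt1P; exists x, y; rewrite !in_setI xA xB yA yB.
Qed.

(* In a cycle of parts, a part which meets the rest of the cycle in one vertex
   only can be skipped. *)
Lemma glued_forest_blocks l (G : sgraph) (E : 'I_l -> {set {set G}}) (P : pred 'I_l) :
  (forall i j, i != j -> #|everts (E i) :&: everts (E j)| <= 1) ->
  (forall i j, i != j -> ~~ P i -> ~~ P j -> everts (E i) :&: everts (E j) = set0) ->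
  (forall i, P i -> exists r : rel G, [/\ transitive r,
     forall k, k != i -> {in everts (E k) &, forall x y, r x y} &
     {in everts (E i) &, forall x y, r x y -> x = y}]) ->
  glued_forest E.
Proof.
move=> h1 h2 h3 c; have [n] := ubnP (size c); elim: n c => // n IH c hn [c3 hc].
have [i ic Pi] : exists2 i, i \in c & P i.
  apply/hasP; apply/negPn/negP => /hasPn nP.
  case: c c3 hc nP {hn} => [|a [|b c]] //= _ /andP[/andP[/andP[ab hab] _] _] nP.
  have := h2 a b ab (nP a _) (nP b _); rewrite !inE !eqxx ?orbT => /(_ isT isT) h.
  by rewrite h eqxx in hab.
have [r [rt rk ri]] := h3 i Pi.
case/rot_to: ic => m c' hr.
have mc z : (z \in c) = (z \in i :: c') by rewrite -hr mem_rot.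
suff [v hv] : exists v, forall j, j \in i :: c' -> v \in everts (E j).
  by exists v => j; rewrite mc; apply: hv.
have szc : size c = (size c').+1 by rewrite -(size_rot m) hr.
have : ucycle (@sedge (aux_graph E)) (i :: c') by rewrite -hr rot_ucycle.
case: c' hr mc szc => [|j1 p] hr mc szc; first by rewrite szc in c3.
case/andP; rewrite [cycle _ _]/= rcons_path.
move=> /andP[hi1 /andP[hp hlast]] ui; have /andP[ni uj] := ui.
have [/andP[_ /set0Pn[v1 /setIP[v1i v1j]]] /andP[_ /set0Pn[v2 /setIP[v2l v2i]]]] := (hi1, hlast).
have chain q j x y : path (@sedge (aux_graph E)) j q -> i \notin j :: q ->
    x \in everts (E j) -> y \in everts (E (last j q)) -> r x y.
  elim: q j x => [|k q IHq] j x /=.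
    by move=> _; rewrite inE eq_sym => ij xj yj; apply: (rk j).
  case/andP=> /andP[_ /set0Pn[z /setIP[zj zk]]] hq.
  rewrite inE negb_or eq_sym => /andP[ij nq] xj yl.
  by apply: rt (IHq k z hq nq zk yl); apply: (rk j).
have ev : v1 = v2 by apply: ri => //; apply: chain hp ni v1j v2l.
rewrite -ev in v2l v2i.
case: p hr mc szc hp hlast ui ni uj v2l chain => [|j2 p] hr mc szc hp hlast ui ni uj v2l chain.
  by rewrite szc in c3.
have nl : last j2 p != j1.
  have /andP[jn _] : uniq [:: j1, j2 & p] by [].
  by apply: contraNneq jn => <-; apply: mem_last.
case: p hr mc szc hp hlast ui ni uj v2l chain nl => [|j3 p] hr mc szc hp hlast ui ni uj v2l chain nl.
  by exists v1 => j; rewrite mem_seq3 => /or3P[] /eqP->.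
have [|//|u hu] := IH (j1 :: j2 :: j3 :: p).
  by move: hn; rewrite szc.
  split=> //; apply/andP; split=> //; rewrite [cycle _ _]/= -[X in is_true X]/(path (@sedge (aux_graph E)) j1 (rcons (j2 :: j3 :: p) j1)).
  rewrite rcons_path hp; rewrite [sedge _ _]/= /aux_edge [last _ _]/= nl.
  by apply/set0Pn; exists v1; rewrite in_setI v1j v2l.
have uv : u = v1.
  apply: (card_le1_eq (h1 (last j1 (j2 :: j3 :: p)) j1 nl)) => //; apply: hu; rewrite ?mem_head //.
  exact: mem_last.
by exists v1 => j; rewrite in_cons => /predU1P[->//|/hu]; rewrite uv.
Qed.

Lemma edge_graph_restrict (G : sgraph) (r : rel G) (A : {set G}) x y :
  symmetric r -> irreflexive r ->
  edge_graph_rel [set B in kcliques r 2 | B \subset A] x y = [&& r x y, x \in A & y \in A].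
Proof.
move=> rs ri; rewrite /edge_graph_rel in_set set2_kcliques // subUset !sub1set.
by have [->|//] := eqVneq x y; rewrite ri.
Qed.

Lemma sg_equiv_emb (G H : sgraph) (f : G -> H) : injective f ->
  (forall x y, sedge (f x) (f y) = sedge x y) ->
  (forall y, y \in nonisolated H -> exists x, f x = y) -> sg_equiv G H.
Proof.
move=> fi fe fs; apply: (sg_equiv_of (f := f)); [by move=> x y _ _; apply: fi | by [] |].
move=> y yH; have [x xy] := fs y yH; exists x => //.
move/supportP: yH => [z yz]; have zH : z \in nonisolated H.
  by apply/supportP; exists y; rewrite sedge_sym.
have [u uz] := fs z zH; apply/supportP; exists u; by rewrite -fe xy uz.
Qed.

Definition rest_graph (G : sgraph) K : sgraph :=
  SGraph (rest_of_sym K (@sedge_sym G)) (rest_of_irr K (@sedge_irr G)).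

Section GforestRest.
Variables (G : sgraph) (K : nat).
Hypotheses (K2 : 1 < K) (nolong : circumference_lt K.+1 (@sedge G)).
Let e := @sedge G.
Let L := rest_graph G K.
Let cl := enum (kcliques e K).
Let cs := enum (equivalence_partition (connect (@sedge L)) [set: L]).
(* The parts E i: the edges of the K-cliques come first, then those of the
   components of the rest. *)
Let V i : {set G} := nth set0 (cl ++ cs) i.
Let P i := i < size cl.
Let rl i : rel G := if P i then e else rest_of e K.
Let E i := [set B in kcliques (rl i) 2 | B \subset V i].

Let rl_sym i : symmetric (rl i).
Proof. by rewrite /rl; case: ifP => _; [apply: sedge_sym | apply: (@sedge_sym L)]. Qed.

Let rl_irr i : irreflexive (rl i).
Proof. by rewrite /rl; case: ifP => _; [apply: sedge_irr | apply: (@sedge_irr L)]. Qed.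

Let EE i x y : edge_graph_rel (E i) x y = [&& rl i x y, x \in V i & y \in V i].
Proof. exact: edge_graph_restrict. Qed.

Let ev i x : x \in everts (E i) -> x \in V i.
Proof. by case/supportP => y; rewrite [sedge _ _]EE => /and3P[]. Qed.

Let Vcl i : P i -> V i \in kcliques e K.
Proof. by move=> Pi; rewrite /V nth_cat -/(P i) Pi -mem_enum mem_nth. Qed.

Let Vcs i : ~~ P i -> i < size (cl ++ cs) ->
  V i \in equivalence_partition (connect (@sedge L)) [set: L].
Proof.
rewrite size_cat => Pi hi; rewrite /V nth_cat -[_ < size cl]/(P i) (negbTE Pi) -mem_enum mem_nth //.
by rewrite ltn_subLR // leqNgt.
Qed.

Let Vcl_inj i j : P i -> P j -> V i = V j -> i = j.
Proof.
rewrite /V !nth_cat => Pi Pj; rewrite !ifT // => /eqP.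
by rewrite nth_uniq ?enum_uniq // => /eqP.
Qed.

Let Vcs_inj i j : ~~ P i -> ~~ P j -> i < size (cl ++ cs) -> j < size (cl ++ cs) ->
  V i = V j -> i = j.
Proof.
rewrite /V !nth_cat -![_ < size cl]/(P _) size_cat => Pi Pj hi hj.
rewrite (negbTE Pi) (negbTE Pj) => /eqP; move: Pi Pj; rewrite -!leqNgt => Pi Pj.
rewrite nth_uniq ?enum_uniq ?ltn_subLR // => /eqP h.
by rewrite -(subnKC Pi) h subnKC.
Qed.

Let Vcs_connect i x y : ~~ P i -> i < size (cl ++ cs) -> x \in V i -> y \in V i ->
  connect (rest_of e K) x y.
Proof.
move=> Pi hi xi; rewrite (component_class_eq (Vcs Pi hi) xi).
by move=> yi; move: (yi : is_true (y \in [set _ | _])); rewrite inE.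
Qed.

Let Vcs_disj i j x : ~~ P i -> ~~ P j -> i < size (cl ++ cs) -> j < size (cl ++ cs) ->
  x \in V i -> x \in V j -> i = j.
Proof.
move=> Pi Pj hi hj xi xj; apply: Vcs_inj => //.
by rewrite (component_class_eq (Vcs Pi hi) xi) (component_class_eq (Vcs Pj hj) xj).
Qed.

Let connect_off A x y : A \in kcliques e K -> connect (rest_of e K) x y ->
  connect (off_clique e A) x y.
Proof. by move=> hA; apply: connect_sub => u v h; apply/connect1/(rest_of_off hA). Qed.

Let two i j x y : i < size (cl ++ cs) -> j < size (cl ++ cs) -> x != y ->
  x \in V i -> x \in V j -> y \in V i -> y \in V j -> i = j.
Proof.
move=> hi hj xy xi xj yi yj.
have aux a b : P a -> ~~ P b -> b < size (cl ++ cs) -> x \in V a -> x \in V b ->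
    y \in V a -> y \in V b -> False.
  move=> Pa Pb hb xa xb ya yb; case/eqP: xy; apply: (clique_block K2 nolong (Vcl Pa)) => //.
  by apply: connect_off (Vcl Pa) _; apply: Vcs_connect hb xb yb.
case: (boolP (P i)) (boolP (P j)) => Pi [] Pj.
- apply: Vcl_inj => //; apply: (clique_eq_block K2 nolong _ _ xi xj yi yj xy); exact: Vcl.
- by case: (aux i j).
- by case: (aux j i).
- exact: (Vcs_disj Pi Pj hi hj xi xj).
Qed.

Lemma Gforest_rest : Gforest (rcons (nseq #|kcliques e K| (complete K)) L) G.
Proof.
rewrite /Gforest gforest_parts; last exact: ltnW.
rewrite cardE -/cl; set Fs := _ ++ _.
have sFs : size Fs = size (cl ++ cs) by rewrite !size_cat size_nseq size_map.
have lt (i : 'I_(size Fs)) : i < size (cl ++ cs) by rewrite -sFs.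
exists (fun i => E i).
have h1 (i j : 'I_(size Fs)) : i != j -> #|everts (E i) :&: everts (E j)| <= 1.
  move=> ij; rewrite leqNgt; apply/negP => /card_gt1P[x [y []]].
  rewrite !in_setI => /andP[/ev xi /ev xj] /andP[/ev yi /ev yj] xy.
  by case/eqP: ij; apply: val_inj; apply: (two _ _ xy xi xj yi yj).
split=> //.
- apply/setP => B; rewrite edgesE; apply/bigcupP/idP => [[i _]|].
    rewrite in_set => /andP[hB _]; apply: subsetP hB; apply: subrel_kcliques => x y.
    by rewrite /rl; case: ifP => // _ /andP[].
  move=> hB; have /(kcliques2P _ (@sedge_sym G) (@sedge_irr G)) [x [y [xy eB]]] := hB.
  suff [i hi Bi] : exists2 i, i < size Fs & B \in E i by exists (Ordinal hi).
  rewrite sFs size_cat; case: (boolP (rest_of e K x y)) => [rxy|].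
    have hC := @component_class L x; set C := [set _ | _] in hC.
    have iC : index C cs < size cs by rewrite index_mem mem_enum.
    exists (size cl + index C cs); first by rewrite ltn_add2l.
    have nP : P (size cl + index C cs) = false by rewrite /P ltnNge leq_addr.
    rewrite in_set /rl nP /V nth_cat -[_ < size cl]/(P _) nP addKn nth_index ?mem_enum //.
    rewrite eB set2_kcliques ?rxy; [|exact: (@sedge_sym L)|exact: (@sedge_irr L)].
    by rewrite subUset !sub1set !in_set connect0; apply: connect1.
  rewrite /rest_of /e xy /= negb_forall_in => /exists_inP[A hA /negPn/andP[xA yA]].
  have iA : index A cl < size cl by rewrite index_mem mem_enum.
  exists (index A cl); first by rewrite (leq_trans iA) ?leq_addr.
  rewrite in_set /rl [P _]iA /V nth_cat iA nth_index ?mem_enum // hB.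
  by rewrite eB subUset !sub1set xA.
- move=> i j ij; apply/pred0P => B /=; apply/negbTE/negP.
  rewrite [in X in X && _]in_set [in X in _ && X]in_set => /andP[/andP[/(kcliques2P _ (@rl_sym i) (@rl_irr i)) [x [y [xy ->]]] sBi] /andP[_ sBj]].
  have nxy : x != y by apply: contraTneq xy => ->; rewrite rl_irr.
  move: sBi sBj; rewrite !subUset !sub1set => /andP[xi yi] /andP[xj yj].
  by case/eqP: ij; apply: val_inj; apply: (two _ _ nxy xi xj yi yj).
- move=> i; case: (boolP (P i)) => Pi.
    have -> : nth (complete 0) Fs i = induced [set: complete K].
      by rewrite nth_cat size_nseq ifT // nth_nseq ifT.
    have [cV /cliqueP clV] := kcliquesP _ _ _ (Vcl Pi).
    pose f (x : {x : 'I_K | x \in [set: 'I_K]}) : G := enum_val (cast_ord (esym cV) (val x)).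
    have fV x : f x \in V i by apply: enum_valP.
    have fi : injective f by move=> x y /enum_val_inj/cast_ord_inj/val_inj.
    apply/sg_equiv_sym/(@sg_equiv_emb (induced [set: complete K]) (edge_graph (E i)) f) => //.
      move=> x y; rewrite [LHS]EE !fV /rl Pi !andbT -[RHS]/(val x != val y) (inj_eq val_inj).
      have [->|xy] := eqVneq x y; first by rewrite /e sedge_irr.
      by apply: clV => //; rewrite (inj_eq fi).
    move=> y /ev yV; exists (exist _ (cast_ord cV (enum_rank_in yV y)) (in_setT _)).
    by rewrite /f /= cast_ordK enum_rankK_in.
  have -> : nth (complete 0) Fs i = @induced L (V i).
    have ics : i - size cl < size cs.
      by have := lt i; rewrite size_cat ltn_subLR // leqNgt.
    rewrite nth_cat size_nseq -[_ < size cl]/(P i) (negbTE Pi) (nth_map set0) //.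
    by rewrite /V nth_cat -[_ < size cl]/(P i) (negbTE Pi).
  apply/sg_equiv_sym/(@sg_equiv_emb (@induced L (V i)) (edge_graph (E i)) val); first exact: val_inj.
    by move=> x y; rewrite [LHS]EE /rl (negbTE Pi) !(valP x, valP y) !andbT.
  by move=> y /ev yV; exists (exist _ y yV).
apply: (@glued_forest_blocks _ _ _ (fun i => P i)) => // [i j ij Pi Pj|i Pi].
  apply/eqP; rewrite -subset0; apply/subsetP => x; rewrite in_setI => /andP[/ev xi /ev xj].
  by case/eqP: ij; apply: val_inj; apply: (Vcs_disj Pi Pj _ _ xi xj).
exists (connect (off_clique e (V i))); split; first exact: connect_trans.
  move=> k ki x y /ev xk /ev yk; case: (boolP (P k)) => Pk; last first.
    by apply: connect_off (Vcl Pi) _; apply: Vcs_connect xk yk.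
  have [->|xy] := eqVneq x y; first exact: connect0.
  have [_ /cliqueP clk] := kcliquesP _ _ _ (Vcl Pk).
  apply: connect1; rewrite /off_clique clk //=; apply/negP => /andP[xi yi].
  by case/eqP: ki; apply: val_inj; apply: (two _ _ xy xk xi yk yi).
move=> x y /ev xi /ev yi; exact: (clique_block K2 nolong (Vcl Pi)).
Qed.
End GforestRest.

Lemma sg_equiv_edgeless (L : sgraph) : nedges L = 0 -> sg_equiv L (complete 0).
Proof.
move/eqP; rewrite cards_eq0 edgesE => /eqP e0; apply: sg_equiv_sym.
have f (x : complete 0) : L by case: x.
apply: (sg_equiv_emb (f := f)) => [[]//|[]//|y /supportP[z yz]].
have : [set y; z] \in kcliques (@sedge L) 2.
  by rewrite set2_kcliques //; [apply: sedge_sym | apply: sedge_irr].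
by rewrite e0 in_set0.
Qed.

Lemma Cfamily_extremal w k b (L : sgraph) : 0 < w -> b <= 'C(k.-1, 2) ->
  no_cycle_geq k L -> nedges L = b -> ncliques w.+2 L = colex_count w b ->
  Cfamily w.+2 k b L.
Proof.
move=> w0 bk nL Lb Lw; have [b0|b0] := posnP b.
  by left; split=> //; apply: sg_equiv_edgeless; rewrite Lb.
right; rewrite b0; split=> //; have [r [s [eb sr _]]] := colexW b.
exists r, s; split=> //.
have em : #|kcliques (@sedge L) 2| = 'C(r, 2) + s by rewrite -edgesE -eb.
have eq : #|kcliques (@sedge L) w.+2| = colex_count w #|kcliques (@sedge L) 2|.
  by rewrite -edgesE -[#|edges L|]/(nedges L) Lb.
have [ws|sw] := leqP w.+1 s.
  apply: Or31; split=> //.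
  have [|A [v [hA vA nA cv]]] := kruskal_katona_eq_colex w0 (@sedge_sym L) (@sedge_irr L) em _ eq.
    by rewrite ws sr.
  by apply: (star_equiv_colex eb _ Lb hA vA nA cv); rewrite sr (leq_trans _ ws).
have [wr|rw] := leqP w.+2 r; last by apply: Or33; split=> //; right.
apply: Or32; split=> //; right; split=> //.
have [A hA] := kruskal_katona_eq_clique w0 (@sedge_sym L) (@sedge_irr L) em sr wr eq.
by apply/set0Pn; exists A.
Qed.

Lemma ncliques_Cfamily w k b (L : sgraph) : 0 < w ->
  Cfamily w.+2 k b L -> ncliques w.+2 L = colex_count w b.
Proof.
move=> w0.
have colex H : sg_equiv H (colex_graph b) -> ncliques w.+2 H = colex_count w b.
  by move/(@ncliques_equiv _ _ w.+2 isT) ->; apply: ncliques_colex.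
have ub H : nedges H = b -> ncliques w.+2 H <= colex_count w b.
  by move=> <-; rewrite /nedges edgesE; apply: kruskal_katona => //; [apply: sedge_sym | apply: sedge_irr].
case=> [[b0 h]|[_ [r [s [eb sr]]]]].
  rewrite (ncliques_equiv _ h) // ncliques_complete b0.
  by have := @colex_countE w 0 0 (leqnn 0); rewrite !bin0n.
have cE : colex_count w b = 'C(r, w.+2) + 'C(s, w.+1) by rewrite eb colex_countE // ltnW.
case=> [[_ /colex]//|[wr sw [/colex//|[Lb _ /set0Pn[A /kcliquesP[cA clA]]]]]|[rw [/colex//|[Lb _]]]].
  apply/eqP; rewrite eqn_leq ub // cE [X in _ + X]bin_small // addn0 -cA -(card_kcliques_in w.+2 clA).
  by apply: subset_leq_card; apply/subsetP => B; rewrite in_set => /andP[].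
apply/eqP; rewrite eqn_leq ub // cE !bin_small //.
by rewrite (leq_trans sr) // -ltnS.
Qed.

Theorem theorem1p10 (t k m q b : nat) (ht : 3 <= t) (htk : t < k)
    (hm : m = q * 'C(k.-1, 2) + b) (hb : b < 'C(k.-1, 2))
    (G : sgraph) (hGm : nedges G = m) (hGc : no_cycle_geq k G) :
  ncliques t G
    <= ncliques t (sg_union (sg_copies q (complete k.-1)) (colex_graph b))
  /\ (ncliques t G
        = ncliques t (sg_union (sg_copies q (complete k.-1)) (colex_graph b))
      <-> exists L H : sgraph,
            [/\ Cfamily t k b L,
                Gforest (rcons (nseq q (complete k.-1)) L) H
              & sg_equiv G H]).
Proof.
case: t ht htk => [|[|[|w]]] // _; set K := k.-1; move=> wk.
have w0 : 0 < w.+1 by [].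
have wK : w.+2 < K by rewrite /K; case: (k) wk.
have K2 : 1 < K by rewrite (leq_trans _ wK).
have kE : K.+1 = k by rewrite /K; case: (k) wk.
have nolong : circumference_lt K.+1 (@sedge G).
  by move=> c c3 hc; rewrite kE; apply: hGc.
have hm2 : #|kcliques (@sedge G) 2| = m by rewrite -edgesE.
have -> : ncliques w.+3 (sg_union (sg_copies q (complete K)) (colex_graph b)) = extremal_count w.+1 K m.
  rewrite ncliques_union // ncliques_copies // ncliques_complete ncliques_colex //.
  by rewrite hm extremal_countE // ltnW.
have [ub eqE] := clique_bound (@sedge_sym G) (@sedge_irr G) w0 wK nolong.
rewrite hm2 in ub eqE; split=> //; split=> [/eqE[]|[L [H [hL hH hGH]]]].
  set m' := #|_| => m'K cw.
  have mE : m = #|kcliques (@sedge G) K| * 'C(K, 2) + m'.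
    by rewrite -hm2 (card_kcliques_rest K2 nolong).
  have D0 : 0 < 'C(K, 2) by rewrite bin_gt0.
  have qE : #|kcliques (@sedge G) K| = q.
    by have := congr1 (divn^~ 'C(K, 2)) mE; rewrite hm !divnMDl // !divn_small // !addn0.
  have bE : m' = b.
    by have := congr1 (modn^~ 'C(K, 2)) mE; rewrite hm !modnMDl !modn_small.
  exists (rest_graph G K), G; split; last exact: sg_equiv_refl.
    apply: Cfamily_extremal => //; first exact: ltnW.
    - move=> c [c3 hc]; rewrite -kE.
      exact: (subrel_circumference (@rest_of_subrel _ (@sedge G) K) nolong).
    - by rewrite /nedges edgesE.
    - by rewrite -bE.
  by rewrite -qE; apply: Gforest_rest.
rewrite (ncliques_equiv _ hGH) // (ncliques_Gforest_blocks _ _ hH) ?(ltnW K2) //.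
by rewrite (ncliques_Cfamily w0 hL) hm extremal_countE // ltnW.
Qed.
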